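(* Let $\epsilon\in(0,\infty)$, $\alpha\in[0,1)$, $\beta\in(\alpha^2,1)$, and let $(\gamma_n)_{n\in\mathbb N}\subseteq(0,\infty)$ be a non-summable decreasing sequence converging to zero which satisfies $$\sup_{\varepsilon\in(0,\infty)}\ \liminf_{n\to\infty}\Bigl((\gamma_n)^{-1}\,\gamma_{n+\lceil(\gamma_n)^{-1}\varepsilon\rceil}\Bigr)>0 .$$ Let $(t_n)_{n\in\mathbb N_0}$ be the associated training times, let $p\in[2,\infty)$, $d\in\mathbb N$, $\vartheta\in\mathbb R^d$, let $(X,U)$ be a locally $p$-regular innovation, and let $(\theta_n)_{n\in\mathbb N_0}$ be the Adam algorithm with innovation $(X,U)$, step-sizes $(\gamma_n)_{n\in\mathbb N}$ and damping parameters $(\alpha,\beta,\epsilon)$ started in $\vartheta$. Let $(\Psi_t)_{t\in[0,\infty)}$ be the semiflow of the corresponding Adam vector field $f$. Then: (i) For all $T,R\in(0,\infty)$, $$\sup_{n\in\mathbb N_0,\ 0\le t_n-t_N\le T}\Bigl(\bigl|\theta_n-\Psi_{t_n-t_N}(\theta_N)\bigr|\,\mathbf 1_{\{|\theta_N|\le R\}}\Bigr)\longrightarrow 0\quad\text{as }N\to\infty,\ \text{in probability.}$$ (ii) If $\sum_{n=1}^\infty(\gamma_n)^{1+p/3}<\infty$, then for all $T,R\in(0,\infty)$, $$\sup_{n\in\mathbb N_0,\ 0\le t_n-t_N\le T}\Bigl(\bigl|\theta_n-\Psi_{t_n-t_N}(\theta_N)\bigr|\,\mathbf 1_{\{|\theta_N|\le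 R\}}\Bigr)\longrightarrow 0\quad\text{as }N\to\infty,\ \text{almost surely.}$$
   Context: Innovation: a pair $(X,U)$ where $U$ is a random variable on a probability space $(\Omega,\mathcal F,\mathbb P)$ with values in a measurable space $\mathcal U$ and $X:\mathcal U\times\mathbb R^d\to\mathbb R^d$ is product measurable. $X^{(j)}$ is the $j$-th component. For $p\in[2,\infty)$, $(X,U)$ is locally $p$-regular if there is a continuous $c:\mathbb R\to\mathbb R$ such that for all $\theta,\vartheta\in\mathbb R^d$: $\mathbb E[|X(U,\theta)|^p]\le c(0)(1+e^{c(0)|\theta|})$ and $\mathbb E[|X(U,\theta)-X(U,\vartheta)|^p]\le c(|\theta|+|\vartheta|)\,|\theta-\vartheta|^p$. Adam algorithm with innovation $(X,U)$, step-sizes $(\gamma_n)_{n\in\mathbb N}$, damping parameters $(\alpha,\beta,\epsilon)$, started in $\vartheta$: a process $(\theta_n)_{n\in\mathbb N_0}$ in $\mathbb R^d$ for which there are i.i.d. copies $U_1,U_2,\dots$ of $U$ such that $\theta_0=\vartheta$, $m_0=v_0=0\in\mathbb R^d$, and for all $n\in\mathbb N$, $j\in\{1,\dots,d\}$: $$m_n=\alpha m_{n-1}+(1-\alpha)X(U_n,\theta_{n-1}),\quad v_n^{(j)}=\beta v_{n-1}^{(j)}+(1-\beta)(X^{(j)}(U_n,\theta_{n-1}))^2,$$ $$\sigma_n^{(j)}=\bigl(\sqrt{v_n^{(j)}/(1-\beta^n)}+\epsilon\bigr)^{-1},\quad \theta_n^{(j)}=\theta_{n-1}^{(j)}+\gamma_n\sigma_n^{(j)}m_n^{(j)}.$$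 Adam vector field $f=(f^{(1)},\dots,f^{(d)}):\mathbb R^d\to\mathbb R^d$ of $(X,U)$ with damping parameters $(\alpha,\beta,\epsilon)$: with $(U_k)_{k\in\mathbb Z,k\le0}$ i.i.d. copies of $U$ (and $0^0=1$), $$f^{(j)}(\theta)=(1-\alpha)\,\mathbb E\Bigl[\Bigl(\Bigl[(1-\beta)\sum_{k=-\infty}^0\beta^{-k}|X^{(j)}(U_k,\theta)|^2\Bigr]^{1/2}+\epsilon\Bigr)^{-1}\sum_{k=-\infty}^0\alpha^{-k}X^{(j)}(U_k,\theta)\Bigr].$$ Semiflow: $\Psi_t:\mathbb R^d\to\mathbb R^d$, $t\in[0,\infty)$, solves $\dot\Psi_t(\theta)=f(\Psi_t(\theta))$, $\Psi_0(\theta)=\theta$ (for locally $p$-regular innovations and $\alpha<\sqrt\beta$ the field $f$ is bounded and locally Lipschitz, so the solution exists uniquely for all $t\ge0$). Training times: $t_n=\sum_{i=1}^n\gamma_i$, $n\in\mathbb N_0$. *)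

(* Defs.v *)
From HB Require Import structures.
From mathcomp Require Import all_boot all_order all_algebra archimedean.
From mathcomp Require Import finmap.
From mathcomp Require Import all_classical all_reals all_analysis.

Set Implicit Arguments.
Unset Strict Implicit.
Unset Printing Implicit Defensive.

Import Order.TTheory GRing.Theory Num.Theory.
Import numFieldNormedType.Exports.

Local Open Scope classical_set_scope.
Local Open Scope ring_scope.

(* The Euclidean norm; the library norm on row vectors is the maximum norm. *)
Definition enorm (R : realType) (d : nat) (x : 'rV[R]_d) : R :=
  Num.sqrt (\sum_(j < d) x 0 j ^+ 2).

(* R^d as a measurable space; the library has no such structure on matrices. *)
Definition borel_rV (R : realType) (d : nat) :=
  g_sigma_algebraType (@open 'rV[R]_d).

(* Laws are compared on measurable sets only: [distribution] is a pushforward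
   defined on all sets. *)
Definition iid_copies (R : realType) (d0 d1 dU : measure_display)
    (Omega0 : measurableType d0) (P0 : probability Omega0 R)
    (Omega1 : measurableType d1) (P1 : probability Omega1 R)
    (calU : measurableType dU)
    (U : {RV P0 >-> calU}) (V : nat -> {RV P1 >-> calU}) : Prop :=
  (forall n A, measurable A -> distribution P1 (V n) A = distribution P0 U A) /\
  (forall (J : {fset nat}) (A : nat -> set calU),
     (forall i, i \in J -> measurable (A i)) ->
     P1 (\bigcap_(i in [set` J]) (V i @^-1` A i)) =
     (\prod_(i <- J) P1 (V i @^-1` A i))%E).

Definition is_innovation (R : realType) (d : nat) (dU : measure_display)
    (calU : measurableType dU) (X : calU -> 'rV[R]_d -> 'rV[R]_d) : Prop :=
  measurable_fun [set: calU * borel_rV R d]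
    (fun z : calU * borel_rV R d => X z.1 z.2 : borel_rV R d).

Definition locally_regular (R : realType) (d : nat) (d0 dU : measure_display)
    (Omega0 : measurableType d0) (P0 : probability Omega0 R)
    (calU : measurableType dU) (p : R)
    (X : calU -> 'rV[R]_d -> 'rV[R]_d) (U : {RV P0 >-> calU}) : Prop :=
  exists c : R -> R, continuous c /\
    forall x y : 'rV[R]_d,
      ('E_P0[fun w => (enorm (X (U w) x) `^ p)%R]
         <= (c 0 * (1 + expR (c 0 * enorm x)))%:E)%E /\
      ('E_P0[fun w => (enorm (X (U w) x - X (U w) y) `^ p)%R]
         <= (c (enorm x + enorm y) * enorm (x - y) `^ p)%:E)%E.

(* The step-sizes are [gamma 1], [gamma 2], ...; [gamma 0] is never used.  The
   sequence [V] is indexed from 0: [V n] stands for U_(n+1). *)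
Definition is_adam (R : realType) (d : nat) (d0 d1 dU : measure_display)
    (Omega0 : measurableType d0) (P0 : probability Omega0 R)
    (Omega1 : measurableType d1) (P1 : probability Omega1 R)
    (calU : measurableType dU)
    (X : calU -> 'rV[R]_d -> 'rV[R]_d) (U : {RV P0 >-> calU})
    (gamma : nat -> R) (alpha beta eps : R) (start : 'rV[R]_d)
    (theta : nat -> Omega1 -> 'rV[R]_d) : Prop :=
  exists V : nat -> {RV P1 >-> calU}, iid_copies U V /\
  exists m v sigma : nat -> Omega1 -> 'rV[R]_d,
    (forall w, [/\ theta 0%N w = start, m 0%N w = 0 & v 0%N w = 0]) /\
    (forall n w,
      m n.+1 w = alpha *: m n w + (1 - alpha) *: X (V n w) (theta n w) /\
      forall j : 'I_d,
      [/\ v n.+1 w 0 j =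
            beta * v n w 0 j + (1 - beta) * (X (V n w) (theta n w) 0 j) ^+ 2,
          sigma n.+1 w 0 j =
            (Num.sqrt (v n.+1 w 0 j / (1 - beta ^+ n.+1)) + eps)^-1 &
          theta n.+1 w 0 j =
            theta n w 0 j + gamma n.+1 * sigma n.+1 w 0 j * m n.+1 w 0 j]).

(* [V k] stands for U_(-k).  The two series converge almost surely for the
   innovations considered; where one of them diverges its [limn] is 0. *)
Definition adam_field (R : realType) (d : nat) (d1 dU : measure_display)
    (Omega1 : measurableType d1) (P1 : probability Omega1 R)
    (calU : measurableType dU) (X : calU -> 'rV[R]_d -> 'rV[R]_d)
    (alpha beta eps : R) (V : nat -> {RV P1 >-> calU})
    (x : 'rV[R]_d) : 'rV[R]_d :=
  \row_j ((1 - alpha) * fine 'E_P1[(fun w : Omega1 =>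
    (Num.sqrt ((1 - beta) *
        limn (series (fun k => beta ^+ k * `|X (V k w) x 0 j| ^+ 2))) + eps)^-1 *
    limn (series (fun k => alpha ^+ k * X (V k w) x 0 j)))%R]).

(* The i.i.d. copies may live on any probability space: the field depends only
   on the law of [U]. *)
Definition is_adam_field (R : realType) (d : nat) (d0 dU : measure_display)
    (Omega0 : measurableType d0) (P0 : probability Omega0 R)
    (calU : measurableType dU)
    (X : calU -> 'rV[R]_d -> 'rV[R]_d) (U : {RV P0 >-> calU})
    (alpha beta eps : R) (f : 'rV[R]_d -> 'rV[R]_d) : Prop :=
  exists (d1 : measure_display) (Omega1 : measurableType d1)
    (P1 : probability Omega1 R) (V : nat -> {RV P1 >-> calU}),
    iid_copies U V /\ f = adam_field X alpha beta eps V.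

(* [Psi] is only meaningful at times t >= 0; at t = 0 the derivative is the
   right derivative. *)
Definition is_semiflow (R : realType) (d : nat) (f : 'rV[R]_d -> 'rV[R]_d)
    (Psi : R -> 'rV[R]_d -> 'rV[R]_d) : Prop :=
  forall x : 'rV[R]_d,
    [/\ Psi 0 x = x,
        (h^-1 *: (Psi h x - Psi 0 x)) @[h --> 0^'+] --> f (Psi 0 x) &
        forall t : R, 0 < t -> is_derive t 1 (Psi ^~ x) (f (Psi t x))].

Definition training_time (R : realType) (gamma : nat -> R) (n : nat) : R :=
  \sum_(1 <= i < n.+1) gamma i.

Definition cvg_in_probability (R : realType) (d1 : measure_display)
    (Omega1 : measurableType d1) (P1 : probability Omega1 R)
    (Y : nat -> Omega1 -> \bar R) (Z : Omega1 -> \bar R) : Prop :=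
  forall delta : R, 0 < delta ->
    P1 [set w | (delta%:E < `|Y n w - Z w|)%E] @[n --> \oo] --> 0%E.

Definition max_deviation (R : realType) (d : nat) (Omega1 : Type)
    (gamma : nat -> R) (theta : nat -> Omega1 -> 'rV[R]_d)
    (Psi : R -> 'rV[R]_d -> 'rV[R]_d) (T r : R) (N : nat) (w : Omega1)
    : \bar R :=
  let t := training_time gamma in
  ereal_sup [set (enorm (theta n w - Psi (t n - t N) (theta N w)) *
                  \1_[set x : 'rV[R]_d | enorm x <= r] (theta N w))%:E
            | n in [set n : nat | 0 <= t n - t N <= T]].

(* Submission.v *)
Require Import Defs.
From HB Require Import structures.
From mathcomp Require Import all_boot all_order all_algebra archimedean.
From mathcomp Require Import finmap.
From mathcomp Require Import all_classical all_reals all_analysis.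
From mathcomp Require Import measurable_realfun.
From mathcomp Require Import zify ring lra.
Import Order.TTheory GRing.Theory Num.Theory.
Import numFieldNormedType.Exports.
Local Open Scope classical_set_scope.
Local Open Scope ring_scope.

Set Implicit Arguments.
Unset Strict Implicit.
Unset Printing Implicit Defensive.

(** The Adam iteration reads
    theta_(i+1) = theta_i + gamma_(i+1) g_i, where the direction g_i depends on
    the whole past.  It is a perturbed Euler scheme for the Adam vector field f,
    so it follows the semiflow on a window of bounded length in training time
    as soon as the accumulated noise, the sum of gamma_(i+1) (g_i - f(theta_i)),
    stays small there: a discrete Gronwall argument ([flow_comparison],
    [tracking]).  Everything rests on a probability bound for that noise.

    Analytic input.  Since alpha^2 < beta, the Cauchy-Schwarz inequality bounds
    the first moment by a constant times the square root of the second moment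
    ([avg1_le]).  Hence directions are bounded, the parameter moves at bounded
    speed in training time, and a direction is a Lipschitz function of the past
    gradients in a weighted l2 norm ([direction_dist]).  Local p-regularity then
    makes f locally Lipschitz, and shows that the distant past contributes
    exponentially little.

    Probabilistic input.  Fix a block length K.  The direction g_i is compared
    with the direction computed from the K most recent innovations only, with
    the parameter frozen at the time the block starts.  Freezing costs little
    outside an event of probability of order K^(p+1) gamma^(p-1), by p-th moments
    ([freeze_event]); truncating the past costs an exponentially small amount in
    mean ([tail_event]).  What remains, minus its conditional mean, is bounded
    and, along each residue class of i modulo K, a martingale difference; an
    exponential moment bound controls its sum ([class_sum_moment],
    [deviation_event]).  The conditional mean is exponentially close to f.  With
    K of order gamma^(-1/9) the exceptional events together have probability of
    order gamma^(p/3) ([noise_bound]).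

    Independence is used in a single form.  The whole iteration is a function of
    the path of innovations, whose law is determined by the law of U, and
    integrating over that path is the same as first following one path and then,
    from a given time on, an independent second one ([resample]).

    For convergence in probability the window starts at N, and gamma_N tends to
    zero.  For almost sure convergence the windows start at the first indices
    N_k at which a unit of training time has elapsed since N_(k-1).  As the step
    sizes decrease, the sum of the gamma_(N_k)^(p/3) is at most the sum of all
    gamma_n^(1+p/3), and the Borel-Cantelli lemma applies; the noise from any
    other start is a difference of two noises from some N_k ([deviation_ae]). *)

(** * Index arithmetic *)

Fact subSB_le i k K : (k < K)%N -> (i.+1 - K <= i - k)%N.
Proof. lia. Qed.

Fact subBSB_le i k K : (i - k - (i.+1 - K) <= K)%N.
Proof. lia. Qed.

Fact leq_subSB M K i : (M + K <= i)%N -> (M <= i.+1 - K)%N.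
Proof. lia. Qed.

Fact subSS_leq i K : (0 < K)%N -> (i.+1 - K <= i)%N.
Proof. lia. Qed.

Fact subB_le M i k : (M <= i)%N -> (M - (i - k) <= k)%N.
Proof. lia. Qed.

(** * Euclidean norms *)

Section Euclidean.
Context {R : realType}.

(** Twice the gap is the sum of the squares [(a i * b j - a j * b i) ^+ 2]. *)
Lemma cauchy_schwarz (I : finType) (a b : I -> R) :
  (\sum_i a i * b i) ^+ 2 <= (\sum_i a i ^+ 2) * (\sum_i b i ^+ 2).
Proof.
have H : 0 <= \sum_i \sum_j (a i * b j - a j * b i) ^+ 2.
  by apply: sumr_ge0 => i _; apply: sumr_ge0 => j _; exact: sqr_ge0.
have E : \sum_i \sum_j (a i * b j - a j * b i) ^+ 2 =
    ((\sum_i a i ^+ 2) * (\sum_i b i ^+ 2) - (\sum_i a i * b i) ^+ 2) *+ 2.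
  transitivity (\sum_i \sum_j (a i ^+ 2 * b j ^+ 2) +
    \sum_i \sum_j (b i ^+ 2 * a j ^+ 2) -
    (\sum_i \sum_j ((a i * b i) * (a j * b j))) *+ 2).
    rewrite -big_split/= -sumrMnl -sumrB; apply: eq_bigr => i _.
    rewrite -big_split/= -sumrMnl -sumrB; apply: eq_bigr => j _.
    ring.
  have prodE (u v : I -> R) :
      \sum_i \sum_j u i * v j = (\sum_i u i) * (\sum_j v j).
    by rewrite mulr_suml; apply: eq_bigr => i _; rewrite mulr_sumr.
  by rewrite !prodE expr2 [X in _ + X - _]mulrC -mulr2n mulrnBl.
by move: H; rewrite E pmulrn_lge0// subr_ge0.
Qed.

Definition l2 (I : finType) (a : I -> R) := Num.sqrt (\sum_i a i ^+ 2).

Lemma l2_ge0 (I : finType) (a : I -> R) : 0 <= l2 a.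
Proof. exact: sqrtr_ge0. Qed.

Lemma sqr_l2 (I : finType) (a : I -> R) : l2 a ^+ 2 = \sum_i a i ^+ 2.
Proof. by rewrite sqr_sqrtr// sumr_ge0// => i _; exact: sqr_ge0. Qed.

Lemma l2N (I : finType) (a : I -> R) : l2 (fun i => - a i) = l2 a.
Proof. by congr Num.sqrt; apply: eq_bigr => i _; rewrite sqrrN. Qed.

Lemma normr_sum_le_l2 (I : finType) (a b : I -> R) :
  `|\sum_i a i * b i| <= l2 a * l2 b.
Proof.
rewrite -ler_sqr ?nnegrE ?mulr_ge0 ?l2_ge0//.
by rewrite real_normK ?num_real// exprMn !sqr_l2 cauchy_schwarz.
Qed.

Lemma l2D (I : finType) (a b : I -> R) : l2 (fun i => a i + b i) <= l2 a + l2 b.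
Proof.
rewrite -ler_sqr ?nnegrE ?addr_ge0 ?l2_ge0// sqr_l2 sqrrD !sqr_l2.
under eq_bigr do rewrite sqrrD.
rewrite big_split big_split/= lerD2r lerD2l sumrMnl lerMn2r/=.
exact: le_trans (ler_norm _) (normr_sum_le_l2 _ _).
Qed.

Lemma l2_dist (I : finType) (a b : I -> R) :
  `|l2 a - l2 b| <= l2 (fun i => a i - b i).
Proof.
have H (u v : I -> R) : l2 u - l2 v <= l2 (fun i => u i - v i).
  rewrite lerBlDr; apply: le_trans (l2D _ _).
  by rewrite /l2 ler_wsqrtr// ler_sum// => i _; rewrite subrK.
rewrite ler_norml H andbT lerNl opprB; apply: (le_trans (H _ _)).
rewrite -[leRHS]l2N /l2 ler_wsqrtr//; apply: ler_sum => i _.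
by rewrite opprB.
Qed.

Section Enorm.
Context {d : nat}.
Implicit Types x y : 'rV[R]_d.

Lemma enorm_ge0 x : 0 <= enorm x. Proof. exact: sqrtr_ge0. Qed.

Lemma enorm0 : enorm (0 : 'rV[R]_d) = 0.
Proof.
by rewrite /enorm big1 ?sqrtr0// => i _; rewrite mxE expr0n.
Qed.

Lemma enorm_l2 x : enorm x = l2 (fun j => x 0 j). Proof. by []. Qed.

Lemma enormD x y : enorm (x + y) <= enorm x + enorm y.
Proof.
rewrite !enorm_l2; apply: le_trans (l2D _ _).
by rewrite /l2 ler_wsqrtr// ler_sum// => i _; rewrite mxE.
Qed.

Lemma coordB x y j : (x - y) 0 j = x 0 j - y 0 j.
Proof. by rewrite !mxE. Qed.

Lemma enormN x : enorm (- x) = enorm x.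
Proof.
rewrite !enorm_l2 -[RHS]l2N; congr Num.sqrt.
by apply: eq_bigr => i _; rewrite mxE.
Qed.

Lemma enormB x y : enorm (x - y) = enorm (y - x).
Proof. by rewrite -enormN opprB. Qed.

Lemma enorm_le_dist x y : enorm x <= enorm y + enorm (x - y).
Proof. by rewrite -{1}[x](subrKC y) enormD. Qed.

Lemma coord_le_enorm x j : `|x 0 j| <= enorm x.
Proof.
rewrite -ler_sqr ?nnegrE ?enorm_ge0// real_normK ?num_real// enorm_l2 sqr_l2.
by rewrite (bigD1 j)//= lerDl sumr_ge0// => i _; exact: sqr_ge0.
Qed.

Lemma enorm_le_sum x : enorm x <= \sum_(j < d) `|x 0 j|.
Proof.
have S0 : 0 <= \sum_(j < d) `|x 0 j| by apply: sumr_ge0.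
rewrite -ler_sqr ?nnegrE ?enorm_ge0// enorm_l2 sqr_l2.
rewrite [leRHS]expr2 mulr_suml; apply: ler_sum => i _.
rewrite -(@real_normK _ (x 0 i)) ?num_real// expr2 ler_wpM2l//.
by rewrite (bigD1 i)//= lerDl sumr_ge0.
Qed.

Lemma enorm_le_bound x b : (forall j, `|x 0 j| <= b) -> enorm x <= b *+ d.
Proof.
move=> xb; apply: (le_trans (enorm_le_sum x)).
by rewrite -[leRHS]mulr_natl -[X in X%:R * _]card_ord mulr_natl -sumr_const ler_sum.
Qed.

Lemma enorm_sum (I : Type) (s : seq I) (Q : pred I) (F : I -> 'rV[R]_d) :
  enorm (\sum_(i <- s | Q i) F i) <= \sum_(i <- s | Q i) enorm (F i).
Proof.
elim/big_rec2: _ => [|i y1 y2 _ h]; first by rewrite enorm0.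
by apply: (le_trans (enormD _ _)); rewrite lerD2l.
Qed.

Lemma enormZ a x : enorm (a *: x) = `|a| * enorm x.
Proof.
rewrite /enorm; under eq_bigr do rewrite mxE exprMn.
by rewrite -mulr_sumr sqrtrM ?sqr_ge0// sqrtr_sqr.
Qed.

End Enorm.
End Euclidean.

(** * The Adam direction as a function of the past gradients *)

Section Direction.
Context {R : realType} (eps alpha beta : R).
Hypotheses (eps_gt0 : 0 < eps) (alpha_bd : 0 <= alpha < 1)
  (beta_bd : alpha ^+ 2 < beta < 1).
Implicit Types x y : nat -> R.

Definition avg1 n x : R := (1 - alpha) * \sum_(k < n) alpha ^+ k * x k.
Definition avg2 n x : R := (1 - beta) * \sum_(k < n) beta ^+ k * x k ^+ 2.
Definition direction n x : R := avg1 n x / (Num.sqrt (avg2 n x) + eps).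

(** The constant of the Cauchy-Schwarz inequality below: the weights
    [(alpha ^+ 2 / beta) ^+ k] sum to [1 / (1 - alpha ^+ 2 / beta)]. *)
Definition dir_bound : R :=
  (1 - alpha) / Num.sqrt ((1 - beta) * (1 - alpha ^+ 2 / beta)).

Lemma beta_gt0 : 0 < beta.
Proof. by case/andP: beta_bd => h _; apply: le_lt_trans h; exact: sqr_ge0. Qed.

Lemma beta_lt1 : beta < 1. Proof. by case/andP: beta_bd. Qed.

Lemma onem_beta_gt0 : 0 < 1 - beta. Proof. by rewrite subr_gt0 beta_lt1. Qed.

Let b0 := beta_gt0.
Let b1 := onem_beta_gt0.

Lemma ratio_bd : 0 <= alpha ^+ 2 / beta < 1.
Proof.
rewrite divr_ge0 ?sqr_ge0 ?(ltW b0)//= ltr_pdivrMr// mul1r.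
by case/andP: beta_bd.
Qed.

Lemma dir_bound_gt0 : 0 < dir_bound.
Proof.
case/andP: alpha_bd => a0 a1; case/andP: ratio_bd => r0 r1.
by rewrite divr_gt0 ?subr_gt0// sqrtr_gt0 mulr_gt0// subr_gt0.
Qed.

Lemma avg2_ge0 n x : 0 <= avg2 n x.
Proof.
rewrite mulr_ge0 ?(ltW b1)// sumr_ge0// => k _.
by rewrite mulr_ge0 ?sqr_ge0 ?exprn_ge0 ?(ltW b0).
Qed.

(* The square root of the second moment is a weighted Euclidean norm. *)
Let wt n x (k : 'I_n) := Num.sqrt ((1 - beta) * beta ^+ k) * x k.

Let avg2_l2 n x : Num.sqrt (avg2 n x) = l2 (@wt n x).
Proof.
congr Num.sqrt; rewrite /avg2 mulr_sumr; apply: eq_bigr => k _.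
by rewrite exprMn sqr_sqrtr ?mulr_ge0 ?exprn_ge0 ?(ltW b0) ?(ltW b1)// mulrA.
Qed.

Lemma sqrt_avg2_dist n x y :
  `|Num.sqrt (avg2 n x) - Num.sqrt (avg2 n y)| <=
  Num.sqrt (avg2 n (fun k => x k - y k)).
Proof.
rewrite !avg2_l2; apply: (le_trans (l2_dist _ _)).
by rewrite /l2 ler_wsqrtr// ler_sum// => k _; rewrite /wt mulrBr.
Qed.

Lemma geom_sum_le (r : R) n : 0 <= r < 1 -> \sum_(k < n) r ^+ k <= (1 - r)^-1.
Proof.
case/andP=> r0 r1; have h : 0 < 1 - r by rewrite subr_gt0.
rewrite -(ler_pM2l h) divff ?gt_eqF// -[1 - r]opprB mulNr -subrX1 opprB.
by rewrite gerBl exprn_ge0.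
Qed.

(** Cauchy-Schwarz, after writing [alpha ^+ k * x k] as the product of
    [(alpha / sqrt beta) ^+ k] and [sqrt beta ^+ k * x k]; the first factor is
    square summable precisely because [alpha ^+ 2 < beta]. *)
Lemma avg1_le n x : `|avg1 n x| <= dir_bound * Num.sqrt (avg2 n x).
Proof.
case/andP: alpha_bd => a0 a1; case/andP: (ratio_bd) => q0 q1.
have s0 : 0 < Num.sqrt beta by rewrite sqrtr_gt0.
pose v (k : 'I_n) := Num.sqrt beta ^+ k * x k.
pose u (k : 'I_n) := (alpha / Num.sqrt beta) ^+ k.
have sE k : Num.sqrt beta ^+ k ^+ 2 = beta ^+ k.
  by rewrite -exprM mulnC exprM sqr_sqrtr// ltW.
have -> : avg1 n x = (1 - alpha) * \sum_k u k * v k.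
  congr (_ * _); apply: eq_bigr => k _; rewrite /u /v mulrA -exprMn.
  by rewrite divfK ?gt_eqF.
have -> : Num.sqrt (avg2 n x) = Num.sqrt (1 - beta) * l2 v.
  rewrite /avg2 sqrtrM ?(ltW b1)//; congr (_ * Num.sqrt _).
  by apply: eq_bigr => k _; rewrite /v exprMn sE.
have ul2 : l2 u <= (Num.sqrt (1 - alpha ^+ 2 / beta))^-1.
  rewrite -sqrtrV ?subr_ge0 ?(ltW q1)//; apply: ler_wsqrtr.
  apply: le_trans (geom_sum_le n ratio_bd); apply: ler_sum => k _.
  by rewrite /u -exprM mulnC exprM expr_div_n sqr_sqrtr// ltW.
rewrite normrM (ger0_norm (_ : 0 <= 1 - alpha)) ?subr_ge0 ?(ltW a1)//.
have -> : dir_bound * (Num.sqrt (1 - beta) * l2 v) =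
    (1 - alpha) * ((Num.sqrt (1 - alpha ^+ 2 / beta))^-1 * l2 v).
  rewrite /dir_bound sqrtrM ?(ltW b1)//.
  have /gt_eqF/negbT : 0 < Num.sqrt (1 - beta) by rewrite sqrtr_gt0.
  have /gt_eqF/negbT : 0 < Num.sqrt (1 - alpha ^+ 2 / beta).
    by rewrite sqrtr_gt0 subr_gt0.
  by move=> ? ?; field; apply/andP.
rewrite ler_wpM2l ?subr_ge0 ?(ltW a1)//.
by apply: (le_trans (normr_sum_le_l2 _ _)); rewrite ler_wpM2r ?l2_ge0.
Qed.

Lemma direction_eq n x y : (forall k, (k < n)%N -> x k = y k) ->
  direction n x = direction n y.
Proof.
move=> xy; rewrite /direction /avg1 /avg2.
under eq_bigr => k _ do rewrite xy//.
by under [in X in _ / X]eq_bigr => k _ do rewrite xy//.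
Qed.

Lemma direction_le n x : `|direction n x| <= dir_bound.
Proof.
rewrite /direction normrM normfV.
have h : 0 < Num.sqrt (avg2 n x) + eps by rewrite ltr_wpDl ?sqrtr_ge0.
rewrite (gtr0_norm h) ler_pdivrMr//; apply: (le_trans (avg1_le n x)).
by rewrite ler_wpM2l ?(ltW dir_bound_gt0)// lerDl ltW.
Qed.

Lemma avg1B n x y : avg1 n x - avg1 n y = avg1 n (fun k => x k - y k).
Proof.
rewrite /avg1 -mulrBr -sumrB; congr (_ * _).
by apply: eq_bigr => k _; rewrite mulrBr.
Qed.

(** The numerator has Lipschitz constant [dir_bound] in the weighted norm; the
    change of the denominator costs no more, because the numerator is at most
    [dir_bound] times the denominator. *)
Lemma direction_dist n x y : `|direction n x - direction n y| <=
  2 * dir_bound / eps * Num.sqrt (avg2 n (fun k => x k - y k)).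
Proof.
set s := Num.sqrt _; rewrite /direction.
set a := Num.sqrt (avg2 n x); set b := Num.sqrt (avg2 n y).
have a0 : 0 <= a by exact: sqrtr_ge0.
have b'0 : 0 <= b by exact: sqrtr_ge0.
have s0 : 0 <= s by exact: sqrtr_ge0.
have ae : 0 < a + eps by rewrite ltr_wpDl.
have be : 0 < b + eps by rewrite ltr_wpDl.
have -> : avg1 n x / (a + eps) - avg1 n y / (b + eps) =
    (avg1 n x - avg1 n y) / (a + eps) + direction n y * (b - a) / (a + eps).
  by rewrite /direction -/b; field; rewrite !gt_eqF.
rewrite -mulrDl normrM normfV (gtr0_norm ae).
have -> : 2 * dir_bound / eps * s = (dir_bound * s + dir_bound * s) / eps by ring.
have C0 := ltW dir_bound_gt0.
apply: ler_pM; rewrite ?invr_ge0 ?(ltW ae)//; last first.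
  by rewrite lef_pV2 ?posrE// lerDr.
apply: (le_trans (ler_normD _ _)); apply: lerD.
  by rewrite avg1B avg1_le.
rewrite normrM; apply: ler_pM => //; first exact: direction_le.
by rewrite distrC sqrt_avg2_dist.
Qed.

Definition dir_lip : R := (2 * dir_bound / eps) ^+ 2.

Lemma dir_lip_ge0 : 0 <= dir_lip. Proof. exact: sqr_ge0. Qed.

(** By the arithmetic-geometric inequality the preceding bound becomes linear in
    the second moment, so that it can be integrated; [s] is the size below which
    errors are not worth counting. *)
Lemma direction_dist_avg2 n x y s : 0 < s ->
  `|direction n x - direction n y| <=
  s + dir_lip / s * avg2 n (fun k => x k - y k).
Proof.
move=> s0; apply: (le_trans (direction_dist n x y)).
set r := Num.sqrt _; have r0 : 0 <= r by exact: sqrtr_ge0.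
rewrite -(sqr_sqrtr (avg2_ge0 _ _)) -/r /dir_lip.
set c := 2 * dir_bound / eps.
have -> : s + c ^+ 2 / s * r ^+ 2 = (s ^+ 2 + (c * r) ^+ 2) / s.
  by field; rewrite gt_eqF.
rewrite ler_pdivlMr//; nra.
Qed.

Definition avg2_tail K n x : R :=
  (1 - beta) * \sum_(k < n | (K <= k)%N) beta ^+ k * x k ^+ 2.

Definition truncate K x k : R := if (k < K)%N then x k else 0.

(** Gradients of the distant past that vanish do not change a direction. *)
Lemma direction_truncate K n x :
  (K <= n)%N -> direction K x = direction n (truncate K x).
Proof.
move=> Kn; have sumE (F : nat -> R) (w : nat -> R) : (forall k, (K <= k)%N -> F k = 0) ->
    (forall k, (k < K)%N -> F k = w k) -> \sum_(k < n) F k = \sum_(k < K) w k.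
  move=> F0 FE; rewrite (bigID (fun k : 'I_n => (k < K)%N))/= [X in _ + X]big1.
    by rewrite addr0 (big_ord_widen _ w Kn); apply: eq_bigr => k /FE.
  by move=> k; rewrite -leqNgt => /F0.
rewrite /direction /avg1 /avg2.
rewrite (sumE (fun k => alpha ^+ k * truncate K x k) (fun k => alpha ^+ k * x k)).
- rewrite (sumE (fun k => beta ^+ k * truncate K x k ^+ 2)
    (fun k => beta ^+ k * x k ^+ 2))// => k kK; rewrite /truncate ?kK//.
  by rewrite ltnNge kK/= expr0n/= mulr0.
- by move=> k kK; rewrite /truncate ltnNge kK/= mulr0.
- by move=> k kK; rewrite /truncate kK.
Qed.

Lemma avg2_sub_truncate K n x z (e : R) : (K <= n)%N ->
  (forall k, (k < K)%N -> `|x k - z k| <= e) ->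
  avg2 n (fun k => x k - truncate K z k) <= e ^+ 2 + avg2_tail K n x.
Proof.
move=> Kn xz; rewrite /avg2 /avg2_tail (bigID (fun k : 'I_n => (k < K)%N))/= mulrDr.
apply: lerD; last first.
  rewrite ler_wpM2l ?(ltW b1)// (eq_bigl (fun k : 'I_n => K <= k)%N); last first.
    by move=> k; rewrite -leqNgt.
  by apply: ler_sum => k kK; rewrite /truncate ltnNge kK/= subr0.
have H : \sum_(k < n | (k < K)%N) beta ^+ k * (x k - truncate K z k) ^+ 2 <=
    \sum_(k < n) beta ^+ k * e ^+ 2.
  rewrite [leRHS](bigID (fun k : 'I_n => (k < K)%N))/= -[leLHS]addr0.
  apply: lerD; last first.
    by apply: sumr_ge0 => k _; rewrite mulr_ge0 ?sqr_ge0 ?exprn_ge0 ?(ltW b0).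
  apply: ler_sum => k kK; rewrite /truncate kK ler_wpM2l ?exprn_ge0 ?(ltW b0)//.
  rewrite -(@real_normK _ (_ - _)) ?num_real// ler_sqr ?nnegrE ?xz//.
  exact: le_trans (normr_ge0 _) (xz _ kK).
apply: (@le_trans _ _ ((1 - beta) * ((1 - beta)^-1 * e ^+ 2))).
  rewrite ler_wpM2l ?(ltW b1)//; apply: (le_trans H).
  by rewrite -mulr_suml ler_wpM2r ?sqr_ge0// geom_sum_le// (ltW b0) beta_lt1.
by rewrite mulrA divff ?mul1r// gt_eqF.
Qed.

(** Truncation and freezing at once: [x] is the true past, and [z] holds the [K]
    most recent gradients evaluated at a frozen parameter. *)
Lemma direction_window K n x z (e s : R) : (K <= n)%N -> 0 < s ->
  (forall k, (k < K)%N -> `|x k - z k| <= e) ->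
  `|direction n x - direction K z| <=
  s + dir_lip / s * (e ^+ 2 + avg2_tail K n x).
Proof.
move=> Kn s0 xz; rewrite (direction_truncate z Kn).
apply: (le_trans (direction_dist_avg2 _ _ _ s0)); rewrite lerD2l ler_wpM2l//.
  by rewrite divr_ge0 ?dir_lip_ge0// ltW.
exact: avg2_sub_truncate.
Qed.

(** The bias correction multiplies the square root of the second moment by a
    number between [1] and [1 / (1 - beta ^+ n)]. *)
Lemma direction_bias n x : (0 < n)%N ->
  `|avg1 n x / (Num.sqrt (avg2 n x / (1 - beta ^+ n)) + eps) - direction n x|
  <= dir_bound * (beta ^+ n / (1 - beta)).
Proof.
move=> n0; rewrite /direction.
have bn : beta ^+ n <= beta.
  by rewrite -[leRHS]expr1 ler_wiXn2l ?(ltW b0)// ltW// beta_lt1.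
have bn0 : 0 <= beta ^+ n by rewrite exprn_ge0 ?(ltW b0).
have c0 : 0 < 1 - beta ^+ n by rewrite subr_gt0 (le_lt_trans bn)// beta_lt1.
set c := (1 - beta ^+ n)^-1.
have c1 : 1 <= c by rewrite /c invf_ge1// gerBl.
rewrite sqrtrM ?avg2_ge0//.
set s := Num.sqrt (avg2 n x); set a := Num.sqrt c.
have s0 : 0 <= s by exact: sqrtr_ge0.
have a1 : 1 <= a by rewrite -(@sqrtr1 R) /a ler_sqrt// (le_trans _ c1).
have ac : a <= c.
  by rewrite -[leRHS](sqr_sqrtr (le_trans ler01 c1)) -/a expr2 ler_peMr// (le_trans ler01).
have se : 0 < s + eps by rewrite ltr_wpDl.
have sae : 0 < s * a + eps by rewrite ltr_wpDl// mulr_ge0// (le_trans ler01).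
have -> : avg1 n x / (s * a + eps) - avg1 n x / (s + eps) =
    (avg1 n x / (s + eps)) * (s / (s * a + eps)) * (1 - a).
  by field; rewrite !gt_eqF.
rewrite 2!normrM (distrC 1) (@ger0_norm _ (a - 1)) ?subr_ge0//.
apply: ler_pM; rewrite ?mulr_ge0 ?subr_ge0//.
  rewrite -[leRHS]mulr1; apply: ler_pM => //; first exact: direction_le.
  rewrite ger0_norm ?divr_ge0// ?(ltW sae)// ler_pdivrMr// mul1r.
  rewrite -[leLHS]addr0; apply: lerD; last exact: ltW.
  by rewrite ler_peMr.
apply: (@le_trans _ _ (c - 1)); first by rewrite lerD2r.
have -> : c - 1 = beta ^+ n / (1 - beta ^+ n).
  by rewrite /c; field; rewrite gt_eqF.
by rewrite ler_wpM2l// lef_pV2 ?posrE// lerD2l lerN2.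
Qed.

End Direction.

(** * Comparing a perturbed Euler scheme with the semiflow *)

Section Flow.
Context {R : realType} {d : nat} (f : 'rV[R]_d -> 'rV[R]_d) (C : R).
Hypotheses (C_ge0 : 0 <= C) (f_le : forall y j, `|f y 0 j| <= C)
  (f_lip : forall r, exists L, 0 <= L /\
    forall (x y : 'rV[R]_d) j, enorm x <= r -> enorm y <= r ->
    `|f x 0 j - f y 0 j| <= L * enorm (x - y)).
Context (Psi : R -> 'rV[R]_d -> 'rV[R]_d).
Hypothesis flow_Psi : is_semiflow f Psi.

Let C' := C *+ d.
Let C'_ge0 : 0 <= C'. Proof. exact: mulrn_wge0. Qed.

Lemma flow0 x : Psi 0 x = x. Proof. by have [] := flow_Psi x. Qed.

Lemma flow_is_derive (x : 'rV[R]_d) j (t : R) : 0 < t ->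
  is_derive t 1 (fun t => Psi t x 0 j) (f (Psi t x) 0 j).
Proof.
move=> t0; have [_ _ /(_ t t0) [dPsi ePsi]] := flow_Psi x.
have dj := (derivable_mxP (Psi ^~ x) t 1).1 dPsi.
split; first exact: dj.
by rewrite -ePsi derive_mx// mxE.
Qed.

(** At time zero the semiflow has only a right derivative, from which
    right-continuity follows. *)
Lemma flow_cvg0 (x : 'rV[R]_d) j : Psi h x 0 j @[h --> 0^'+] --> Psi 0 x 0 j.
Proof.
have [_ cPsi _] := flow_Psi x.
have : (h^-1 *: (Psi h x - Psi 0 x)) 0 j @[h --> 0^'+] --> f (Psi 0 x) 0 j.
  exact: (continuous_cvg _ (@coord_continuous R 1 d 0 j _) cPsi).
move=> cj; have id0 : h @[h --> (0 : R)^'+] --> (0 : R).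
  by apply: cvg_at_right_filter; exact: cvg_id.
have : Psi 0 x 0 j + h * (h^-1 *: (Psi h x - Psi 0 x)) 0 j @[h --> 0^'+] -->
    Psi 0 x 0 j + 0 * f (Psi 0 x) 0 j.
  by apply: cvgD; [exact: cvg_cst|exact: cvgM].
rewrite mul0r addr0; apply: cvg_trans; apply: near_eq_cvg.
near=> h; have h0 : 0 < h by near: h; exact: nbhs_right_gt.
by rewrite mxE coordB mulrA divff ?gt_eqF// mul1r addrC subrK.
Unshelve. all: by end_near. Qed.

Lemma flow_mvt (x : 'rV[R]_d) j (a b : R) : 0 <= a -> a < b -> exists xi, [/\ a < xi, xi < b &
  Psi b x 0 j - Psi a x 0 j = f (Psi xi x) 0 j * (b - a)].
Proof.
move=> a0 ab; pose g t := Psi t x 0 j.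
have cg t : 0 < t -> {for t, continuous g}.
  by move=> /(flow_is_derive x j) [dg _]; exact/differentiable_continuous/derivable1_diffP.
have [xi /itvP xiab E] := @MVT R g (fun t => f (Psi t x) 0 j) a b ab
  ltac:(by move=> t /itvP tab; apply: flow_is_derive; rewrite (le_lt_trans a0)// tab)
  ltac:(apply/continuous_within_itvP => //; split;
    [by move=> t; rewrite inE/= => /itvP tab; apply: cg; rewrite (le_lt_trans a0)// tab
    | | by apply: cvg_at_left_filter; apply: cg; exact: le_lt_trans ab];
    move: a0; rewrite le_eqVlt => /orP[/eqP <-|a0]; [exact: flow_cvg0|
      by apply: cvg_at_right_filter; exact: cg]).
by exists xi; split; rewrite ?xiab.
Qed.

Lemma flow_dist x (a b : R) : 0 <= a -> a <= b ->
  enorm (Psi b x - Psi a x) <= C' * (b - a).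
Proof.
move=> a0; rewrite le_eqVlt => /orP[/eqP <-|ab].
  by rewrite !subrr enorm0 mulr0.
rewrite /C' mulrnAl; apply: enorm_le_bound => j; rewrite coordB.
have [xi [_ _ ->]] := flow_mvt x j a0 ab.
by rewrite normrM (gtr0_norm (x := b - a)) ?subr_gt0// ler_wpM2r// subr_ge0 ltW.
Qed.

Section Comparison.
Variables (r L : R).
Hypotheses (L0 : 0 <= L)
  (LP : forall (x y : 'rV[R]_d) j, enorm x <= r -> enorm y <= r ->
    `|f x 0 j - f y 0 j| <= L * enorm (x - y)).

Let L' := L *+ d.
Let L'_ge0 : 0 <= L'. Proof. exact: mulrn_wge0. Qed.

Lemma enorm_lip x y : enorm x <= r -> enorm y <= r ->
  enorm (f x - f y) <= L' * enorm (x - y).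
Proof.
move=> xr yr; rewrite /L' mulrnAl; apply: enorm_le_bound => j.
by rewrite coordB; exact: LP.
Qed.

(** The local error of an Euler step: the field changes by at most the Lipschitz
    constant times the distance covered. *)
Lemma flow_euler x (a h : R) : 0 <= a -> 0 <= h ->
  (forall t, 0 <= t -> t <= a + h -> enorm (Psi t x) <= r) ->
  enorm (Psi (a + h) x - Psi a x - h *: f (Psi a x)) <= h * (L' * (C' * h)).
Proof.
move=> a0; rewrite le_eqVlt => /orP[/eqP <-|h0] ball.
  by rewrite addr0 subrr scale0r subrr enorm0 mul0r.
rewrite /L' mulrnAl mulrnAr; apply: enorm_le_bound => j.
have aah : a < a + h by rewrite ltrDl.
rewrite !coordB [X in _ - X]mxE; have [xi [axi xih ->]] := flow_mvt x j a0 aah.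
have xi0 := le_trans a0 (ltW axi).
rewrite [X in _ * X - _](addrAC a) subrr add0r mulrC -mulrBr normrM (gtr0_norm h0).
rewrite ler_pM2l//; apply: (@le_trans _ _ (L * enorm (Psi xi x - Psi a x))).
  by apply: LP; apply: ball => //; exact: ltW.
apply: ler_wpM2l => //; apply: (le_trans (flow_dist x a0 (ltW axi))).
by apply: ler_wpM2l => //; rewrite lerBlDl ltW.
Qed.

(** By induction the bound [A + L' * sum] itself stays below the exponential. *)
Lemma discrete_gronwall (h e : nat -> R) (A : R) M n : (forall i, 0 <= h i) ->
  0 <= A -> (M <= n)%N ->
  (forall m, (M <= m)%N -> (m <= n)%N ->
     e m <= A + L' * \sum_(M <= i < m) h i * e i) ->
  e n <= A * expR (L' * \sum_(M <= i < n) h i).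
Proof.
move=> h0 A0 Mn eP.
suff H : forall m, (M <= m)%N -> (m <= n)%N ->
   A + L' * \sum_(M <= i < m) h i * e i <= A * expR (L' * \sum_(M <= i < m) h i).
  by apply: (le_trans (eP n Mn (leqnn n))); exact: H.
move=> m; elim: m => [|m IH] Mm mn.
  by rewrite !big_geq ?leqn0//= !mulr0 expR0 mulr1 addr0.
move: Mm; rewrite leq_eqVlt => /orP[/eqP ->|].
  by rewrite !big_geq// !mulr0 expR0 mulr1 addr0.
rewrite ltnS => Mm; rewrite !big_nat_recr//=.
have {}IH := IH Mm (ltnW mn); have em := eP m Mm (ltnW mn).
set S := \sum_(M <= i < m) h i in IH *; set S' := \sum_(M <= i < m) _ in IH em *.
pose s := A * expR (L' * S); pose u := L' * h m.
have -> : A * expR (L' * (S + h m)) = s * expR u by rewrite mulrDr expRD mulrA.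
have -> : A + L' * (S' + h m * e m) = A + L' * S' + u * e m by rewrite /u; ring.
have u0 : 0 <= u by rewrite mulr_ge0.
have s0 : 0 <= s by rewrite mulr_ge0// expR_ge0.
apply: (@le_trans _ _ (s * (1 + u))); last first.
  by apply: ler_wpM2l => //; exact: expR_ge1Dx.
rewrite mulrDr mulr1; apply: lerD => //.
by rewrite mulrC; apply: ler_wpM2r => //; exact: le_trans em IH.
Qed.

(** The error is the sum of the initial distance, the perturbation [delta], the
    local errors of the Euler steps along the exact solution, and the differences
    of the field between the scheme and the solution, which Gronwall absorbs. *)
Lemma flow_comparison (h : nat -> R) (eta delta : R) (a : nat -> 'rV[R]_d) z M n :
  (forall i, 0 <= h i) -> (M <= n)%N ->
  (forall i, (M <= i)%N -> h i <= eta) ->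
  (forall m, (M <= m)%N -> (m <= n)%N ->
     enorm (a m - a M - \sum_(M <= i < m) h i *: f (a i)) <= delta) ->
  (forall m, (M <= m)%N -> (m <= n)%N -> enorm (a m) <= r) ->
  (forall t, 0 <= t -> t <= \sum_(M <= i < n) h i -> enorm (Psi t z) <= r) ->
  enorm (a n - Psi (\sum_(M <= i < n) h i) z) <=
  (enorm (a M - z) + delta + L' * (C' * eta) * \sum_(M <= i < n) h i) *
  expR (L' * \sum_(M <= i < n) h i).
Proof.
move=> h0 Mn heta ad ball ballz.
pose tau m := \sum_(M <= i < m) h i; rewrite -/(tau n) in ballz *.
have tau0 m : 0 <= tau m by apply: sumr_ge0.
have tauS m : (M <= m)%N -> tau m.+1 = tau m + h m by move=> Mm; rewrite /tau big_nat_recr.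
have taumn m : (M <= m)%N -> (m <= n)%N -> tau m <= tau n.
  by move=> Mm mn; rewrite /tau [leRHS](big_cat_nat Mm mn)/= lerDl sumr_ge0.
have eta0 : 0 <= eta by exact: le_trans (h0 M) (heta M (leqnn M)).
have delta0 : 0 <= delta by apply: le_trans (ad M (leqnn M) Mn); exact: enorm_ge0.
apply: (@discrete_gronwall h (fun m => enorm (a m - Psi (tau m) z))) => //.
  by rewrite !addr_ge0 ?enorm_ge0// !mulr_ge0.
move=> m Mm mn; pose q i := Psi (tau i.+1) z - Psi (tau i) z - h i *: f (Psi (tau i) z).
have -> : a m - Psi (tau m) z =
    (a m - a M - \sum_(M <= i < m) h i *: f (a i)) + (a M - z) +
    \sum_(M <= i < m) h i *: (f (a i) - f (Psi (tau i) z)) - \sum_(M <= i < m) q i.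
  have -> : \sum_(M <= i < m) q i =
      Psi (tau m) z - z - \sum_(M <= i < m) h i *: f (Psi (tau i) z).
    rewrite /q sumrB (telescope_sumr (fun i => Psi (tau i) z))//.
    by rewrite [tau M]/tau big_geq// flow0.
  under [X in _ + X - _]eq_bigr do rewrite scalerBr.
  rewrite sumrB; move: (\sum_(_ <= i < _) _ *: _) (\sum_(_ <= i < _) _) => u v.
  by apply/rowP => j; rewrite !mxE; ring.
apply: (le_trans (enormD _ _)); rewrite enormN.
apply: (le_trans (lerD (enormD _ _) (lexx _))).
apply: (le_trans (lerD (lerD (enormD _ _) (lexx _)) (lexx _))).
have H1 : enorm (\sum_(M <= i < m) h i *: (f (a i) - f (Psi (tau i) z))) <=
    L' * \sum_(M <= i < m) h i * enorm (a i - Psi (tau i) z).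
  apply: (le_trans (enorm_sum _ _ _)); rewrite mulr_sumr.
  rewrite big_nat_cond [leRHS]big_nat_cond.
  apply: ler_sum => i /andP[/andP[Mi im] _]; have im' := leq_trans (ltnW im) mn.
  rewrite enormZ ger0_norm// mulrCA; apply: ler_wpM2l => //.
  by apply: enorm_lip; [exact: ball|apply: ballz; rewrite ?taumn].
have H2 : enorm (\sum_(M <= i < m) q i) <= L' * (C' * eta) * tau n.
  apply: (le_trans (enorm_sum _ _ _)).
  apply: (@le_trans _ _ (L' * (C' * eta) * tau m)); last first.
    by apply: ler_wpM2l; [rewrite !mulr_ge0|exact: taumn].
  rewrite mulrC mulr_suml big_nat_cond [leRHS]big_nat_cond.
  apply: ler_sum => i /andP[/andP[Mi im] _].
  rewrite /q tauS//; apply: (@le_trans _ _ (h i * (L' * (C' * h i)))).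
    apply: flow_euler => // t t0 ti; apply: ballz => //; apply: (le_trans ti).
    by rewrite -tauS//; apply: taumn; [exact: leqW|exact: leq_trans im mn].
  apply: ler_wpM2l => //; apply: ler_wpM2l => //; apply: ler_wpM2l => //.
  exact: heta.
have H3 := ad m Mm mn.
move: H1 H2 H3; set x1 := enorm (\sum_(_ <= i < _) _ *: _).
set x2 := enorm (\sum_(_ <= i < _) _); set x3 := enorm (_ - _ - _).
set x4 := enorm _; set x5 := L' * _; set x6 := L' * _ * _ => H1 H2 H3.
lra.
Qed.

End Comparison.

(** The exact solution from [x], sampled at [K] equidistant times, is a perturbed
    Euler scheme; comparing it with the solution from [y] and letting [K] grow
    shows that time-[t] maps are Lipschitz on balls. *)
Lemma flow_lip_start r (t : R) : 0 <= t -> exists B, 0 <= B /\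
  forall x y, enorm x <= r -> enorm y <= r ->
  enorm (Psi t x - Psi t y) <= B * enorm (x - y).
Proof.
move=> t0; have [L [L0 LP]] := f_lip (r + C' * t).
have L'0 : 0 <= L *+ d by exact: mulrn_wge0.
exists (expR (L *+ d * t)); split; first exact: expR_ge0.
move=> x y xr yr.
have ball z s : enorm z <= r -> 0 <= s -> s <= t -> enorm (Psi s z) <= r + C' * t.
  move=> zr s0 st; apply: (le_trans (enorm_le_dist _ z)); apply: lerD => //.
  rewrite -{2}(flow0 z); apply: (le_trans (flow_dist z (lexx 0) s0)).
  by rewrite subr0 ler_wpM2l.
have H K : (0 < K)%N -> enorm (Psi t x - Psi t y) <=
    (enorm (x - y) + 2 * (L *+ d * (C' * t) * t) / K%:R) * expR (L *+ d * t).
  move=> K0; have KR : 0 < K%:R :> R by rewrite ltr0n.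
  pose h (i : nat) : R := t / K%:R; have h0 i : 0 <= h i by rewrite divr_ge0// ltW.
  have sh m : \sum_(0 <= i < m) h i = m%:R * (t / K%:R).
    by rewrite sumr_const_nat subn0 mulr_natl.
  have shK : \sum_(0 <= i < K) h i = t by rewrite sh mulrC divfK// gt_eqF.
  have sht m : (m <= K)%N -> m%:R * (t / K%:R) <= t.
    move=> mK; rewrite -[leRHS](divfK (lt0r_neq0 KR)) mulrC; apply: ler_wpM2l => //.
      by rewrite divr_ge0// ltW.
    by rewrite ler_nat.
  pose a (i : nat) := Psi (i%:R * (t / K%:R)) x.
  have aK : a K = Psi t x by rewrite /a mulrC divfK// gt_eqF.
  have a0 : a 0%N = x by rewrite /a mul0r flow0.
  have E m : (m <= K)%N -> enorm (a m - a 0%N - \sum_(0 <= i < m) h i *: f (a i)) <=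
      L *+ d * (C' * (t / K%:R)) * t.
    move=> mK; rewrite -(telescope_sumr a)// -sumrB.
    apply: (le_trans (enorm_sum _ _ _)).
    apply: (@le_trans _ _ (\sum_(0 <= i < m) h i * (L *+ d * (C' * (t / K%:R))))).
      rewrite big_nat_cond [leRHS]big_nat_cond.
      apply: ler_sum => i /andP[/andP[_ im] _].
      have iS : i.+1%:R * (t / K%:R) = i%:R * (t / K%:R) + h i.
        by rewrite -natr1 mulrDl mul1r.
      rewrite /a iS; apply: (flow_euler (r := r + C' * t) L0 LP) => //.
        by rewrite mulr_ge0// -/(h i).
      move=> s s0 sh'; apply: ball => //; apply: (le_trans sh'); rewrite -iS.
      exact: sht (leq_trans im mK).
    rewrite -mulr_suml sh mulrC; apply: ler_wpM2l; last exact: sht.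
    by rewrite !mulr_ge0// -/(h 0%N).
  have := @flow_comparison (r + C' * t) L L0 LP h (t / K%:R)
    (L *+ d * (C' * (t / K%:R)) * t) a y 0 K h0 (leq0n K) (fun _ _ => lexx _)
    (fun m _ => E m).
  rewrite shK aK a0 => /(_ _ _)/le_trans; apply.
  - by move=> m _ mK; apply: ball => //; [rewrite mulr_ge0// -/(h 0%N)|exact: sht].
  - by move=> s s0 st; exact: ball.
  rewrite -addrA; apply: ler_wpM2r; first exact: expR_ge0.
  by rewrite lerD2l le_eqVlt; apply/orP; left; apply/eqP; field; rewrite gt_eqF.
rewrite mulrC; apply/ler_addgt0Pr => e e0.
pose w := 2 * (L *+ d * (C' * t) * t) * expR (L *+ d * t).
have w0 : 0 <= w by rewrite !mulr_ge0 ?expR_ge0.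
have we : 0 <= w / e by rewrite divr_ge0// ltW.
have /andP[_ Kw] := truncn_itv we; set K := (Num.truncn _).+1 in Kw.
apply: (le_trans (H K isT)); rewrite mulrDl lerD2l.
have -> : 2 * (L *+ d * (C' * t) * t) / K%:R * expR (L *+ d * t) = w / K%:R.
  by rewrite /w; ring.
by rewrite ler_pdivrMr// mulrC -ler_pdivrMr// ltW.
Qed.

Lemma norm_coord_le (x : 'rV[R]_d) j : `|x 0 j| <= `|x|.
Proof.
rewrite [leRHS]/Num.Def.normr/= mx_normrE.
exact: (le_bigmax _ (fun ij : 'I_1 * 'I_d => `|x ij.1 ij.2|) (0, j)).
Qed.

(** The source of the measurability of the maximal deviation. *)
Lemma continuous_flow (t : R) j : 0 <= t -> continuous (fun x => Psi t x 0 j).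
Proof.
move=> t0 x; apply: (iffRL (@cvgrPdist_le R R^o 'rV[R]_d (nbhs x) _ (fun y => Psi t y 0 j) (Psi t x 0 j))) => e e0.
have [B [B0 BP]] := flow_lip_start (enorm x + d%:R) t0.
have B1 : 0 < B *+ d + 1 by rewrite ltr_wpDl// mulrn_wge0.
have hd : 0 < Num.min 1 (e / (B *+ d + 1)) by rewrite lt_min ltr01 divr_gt0.
near=> y.
have /andP[xy1 xye] : (`|x - y| <= 1) && (`|x - y| <= e / (B *+ d + 1)).
  rewrite -le_min; near: y.
  by have /cvgrPdist_le := @cvg_id _ (nbhs x); apply.
have xyd : enorm (x - y) <= `|x - y| *+ d.
  by apply: enorm_le_bound => k; exact: norm_coord_le.
have yr : enorm y <= enorm x + d%:R.
  apply: (le_trans (enorm_le_dist _ x)); rewrite lerD2l enormB.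
  by apply: (le_trans xyd); rewrite lerMn2r xy1 orbT.
rewrite -coordB; apply: (le_trans (coord_le_enorm _ _)).
apply: (le_trans (BP _ _ _ yr)); first by rewrite lerDl.
apply: (le_trans (ler_wpM2l B0 xyd)); rewrite mulrnAr -mulrnAl.
move: xye; rewrite ler_pdivlMr//; apply: le_trans.
by rewrite mulrC ler_wpM2l// lerDl.
Unshelve. all: by end_near. Qed.

End Flow.

(** * The space of innovation paths *)

Section PathSpace.
Context {R : realType} {dU : measure_display} {calU : measurableType dU}.

Definition box (A : nat -> set calU) : set (nat -> calU) :=
  [set s | forall k, A k (s k)].

Definition cylinder : set (set (nat -> calU)) :=
  [set C | exists A m, [/\ forall k, measurable (A k),
    forall k, (m <= k)%N -> A k = setT & C = box A]].

(** The product sigma-algebra on sequences, generated by the boxes that constrain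
    finitely many coordinates. *)
Definition path : measurableType cylinder.-sigma := g_sigma_algebraType cylinder.

Lemma cylinder_setI : setI_closed cylinder.
Proof.
move=> _ _ [A [m [mA Am ->]]] [B [n [mB Bn ->]]].
exists (fun k => A k `&` B k), (maxn m n); split.
- by move=> k; exact: measurableI.
- by move=> k; rewrite geq_max => /andP[/Am -> /Bn ->]; rewrite setIT.
- apply/seteqP; split=> s /=; first by move=> [hA hB] k; split.
  by move=> h; split => k; have [] := h k.
Qed.

Lemma cylinder_setT : cylinder setT.
Proof.
exists (fun=> setT), 0%N; split => //.
by apply/seteqP; split.
Qed.

Lemma measurable_coord k : measurable_fun setT (fun s : path => s k).
Proof.
move=> _ B mB; rewrite setTI; apply: sub_sigma_algebra.
exists (fun i => if i == k then B else setT), k.+1; split.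
- by move=> i; case: ifP.
- by move=> i ki; rewrite gtn_eqF.
- apply/seteqP; split=> s /=; first by move=> sB i; case: eqP => // ->.
  by move/(_ k); rewrite eqxx.
Qed.

Lemma measurable_to_path d (T : measurableType d) (h : T -> path) :
  (forall k, measurable_fun setT (fun t => h t k)) -> measurable_fun setT h.
Proof.
move=> mh; apply: (@measurability _ _ T path setT h cylinder) => //.
move=> _ [_ [A [m [mA _ ->]]] <-]; rewrite setTI.
have -> : h @^-1` box A = \bigcap_k ((fun t => h t k) @^-1` A k).
  by apply/seteqP; split=> t /= H k; [move=> _; exact: H|exact: (H k I)].
by apply: bigcapT_measurable => k; rewrite -[X in measurable X]setTI; exact: mh.
Qed.

Definition iid_law (mu : probability calU R) (Q : probability path R) :=
  forall A m, (forall k, measurable (A k)) ->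
    (forall k, (m <= k)%N -> A k = setT) ->
    Q (box A) = (\prod_(k < m) mu (A k))%E.

Lemma measurable_box A : (forall k, measurable (A k)) ->
  measurable (box A : set path).
Proof.
move=> mA; have -> : box A = \bigcap_k ((fun s : path => s k) @^-1` A k).
  by apply/seteqP; split=> t /= H k; [move=> _; exact: H|exact: (H k I)].
apply: bigcapT_measurable => k; rewrite -[X in measurable X]setTI.
exact: measurable_coord.
Qed.

(** Cylinders are stable under intersection and generate the sigma-algebra. *)
Lemma iid_law_unique mu (Q : probability path R)
  (Q' : {measure set path -> \bar R}) : iid_law mu Q ->
  (forall A m, (forall k, measurable (A k)) ->
    (forall k, (m <= k)%N -> A k = setT) ->
    Q' (box A) = (\prod_(k < m) mu (A k))%E) ->
  forall C, measurable C -> Q C = Q' C.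
Proof.
move=> iQ iQ'; apply: (@measure_unique _ R path cylinder (fun=> setT)) => //.
- exact: cylinder_setI.
- by move=> _; exact: cylinder_setT.
- by rewrite -subTset => x _; exists 0%N.
- move=> _ [A [m [mA Am ->]]].
  by transitivity (\prod_(k < m) mu (A k))%E; [exact: iQ|exact/esym/iQ'].
- move=> _; apply: (@le_lt_trans _ _ 1%E); last exact: ltry.
  exact: probability_le1.
Qed.

(** The direction at time [n + L] lists the innovations backwards from that time.
    [splice n L s s'] follows [s] before time [n] and [s'] afterwards, the first
    [L + 1] entries of [s'] being read backwards, so that [s' 0] becomes the
    entry at time [n + L]. *)
Definition flip L r := if (r <= L)%N then (L - r)%N else r.

Lemma flipK L : involutive (flip L).
Proof.
move=> r; rewrite /flip; case: (leqP r L) => rL.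
  by rewrite leq_subr subKn.
by rewrite leqNgt rL.
Qed.

Lemma flip_lt L m r : (L < m)%N -> (r < m)%N -> (flip L r < m)%N.
Proof. by rewrite /flip => Lm rm; case: ifP => // _; rewrite (leq_ltn_trans (leq_subr _ _)). Qed.

Definition splice n L (s s' : path) : path :=
  fun k => if (k < n)%N then s k else s' (flip L (k - n)).

Lemma measurable_splice n L :
  measurable_fun setT (fun z : path * path => splice n L z.1 z.2).
Proof.
apply: measurable_to_path => k; rewrite /splice; case: (k < n)%N.
  exact: measurableT_comp (measurable_coord k) measurable_fst.
exact: measurableT_comp (measurable_coord _) measurable_snd.
Qed.

Lemma iid_law_splice mu (Q : probability path R) n L : iid_law mu Q ->
  forall A m, (forall k, measurable (A k)) ->
    (forall k, (m <= k)%N -> A k = setT) ->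
    (Q \x Q)%E [set z | box A (splice n L z.1 z.2)] =
    (\prod_(k < m) mu (A k))%E.
Proof.
move=> iQ A m mA Am.
pose A1 k := if (k < n)%N then A k else setT.
pose A2 r := A (n + flip L r)%N.
(* Beyond both [m] and [L], so that the reversal permutes ['I_M]. *)
pose M := (m + L.+1)%N.
have mA1 k : measurable (A1 k) by rewrite /A1; case: ifP.
have -> : [set z | box A (splice n L z.1 z.2)] = box A1 `*` box A2.
  apply/seteqP; split=> -[s s'] /=; rewrite /splice.
    move=> H; split=> k; rewrite /A1/A2.
      by case: ifPn => // kn; have := H k; rewrite kn.
    by have := H (n + flip L k)%N; rewrite ltnNge leq_addr/= addKn flipK.
  move=> [H1 H2] k; case: ifPn => kn; first by have := H1 k; rewrite /A1 kn.
  by have := H2 (flip L (k - n))%N; rewrite /A2 flipK subnKC// leqNgt.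
rewrite product_measure1E; last 2 first.
- exact: measurable_box.
- by apply: measurable_box => r; exact: mA.
transitivity ((\prod_(k < n) mu (A1 k)) * \prod_(k < M) mu (A2 k))%E.
  congr (_ * _)%E; first by apply: iQ => // k nk; rewrite /A1 ltnNge nk.
  apply: iQ => [r|]; first exact: mA.
  move=> r Mr; rewrite /A2 /flip leqNgt.
  have -> : (L < r)%N by rewrite (leq_trans _ Mr)// leq_addl.
  by rewrite /= Am// (leq_trans _ (leq_addl _ _))// (leq_trans (leq_addr _ _) Mr).
have LM : (L < M)%N by rewrite leq_addl.
pose h (r : 'I_M) := Ordinal (flip_lt LM (ltn_ord r)).
have hK : involutive h by move=> r; apply: val_inj; exact: flipK.
rewrite [X in (_ * X)%E](reindex_inj (inv_inj hK))/=.
under [X in (_ * X)%E]eq_bigr do rewrite /A2 flipK.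
rewrite -(big_mkord xpredT (fun k => mu (A1 k))).
rewrite -(big_mkord xpredT (fun k => mu (A k))).
rewrite -(big_mkord xpredT (fun k => mu (A (n + k)%N))).
rewrite (eq_big_nat _ _ (F2 := fun k => mu (A k))); last first.
  by move=> k /= kn; rewrite /A1 kn.
have -> : (\prod_(0 <= k < M) mu (A (n + k)%N) =
           \prod_(n <= k < n + M) mu (A k))%E.
  rewrite -{2}[n]add0n big_addn addnC addnK.
  by apply: eq_bigr => k _; rewrite addnC.
rewrite -big_cat_nat ?leq_addr//=.
have mM : (m <= n + M)%N by rewrite (leq_trans _ (leq_addl _ _))// leq_addr.
rewrite (@big_cat_nat _ _ _ m)//= [X in (_ * X)%E]big_nat_cond.
rewrite [X in (_ * X)%E]big1 ?mule1// => k.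
by rewrite andbT => /andP[mk _]; rewrite Am// probability_setT.
Qed.

(** Both sides integrate [h] against laws on paths that agree on boxes: a box
    splits into a condition on [s] and a condition on a permutation of [s'].
    Taking [h] to depend on the path up to some time, the inner integral is a
    conditional expectation given the past of [n]. *)
Lemma resample mu (Q : probability path R) n L (h : path -> \bar R) :
  iid_law mu Q -> measurable_fun setT h -> (forall s, 0 <= h s)%E ->
  (\int[Q]_s h s = \int[Q]_s \int[Q]_s' h (splice n L s s'))%E.
Proof.
move=> iQ mh h0.
pose X : {mfun (path * path)%type >-> path} :=
  HB.pack (fun z : path * path => splice n L z.1 z.2)
    (isMeasurableFun.Build _ _ _ _ _ (measurable_splice n L)).
have QE C : measurable C -> Q C = pushforward (Q \x Q)%E X C.
  move=> mC; rewrite -[RHS]/(distribution (Q \x Q)%E X C).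
  by apply: (iid_law_unique iQ) => // A m mA Am; exact: iid_law_splice.
rewrite (eq_measure_integral (distribution (Q \x Q)%E X)); last first.
  by move=> C mC _; exact: QE.
rewrite ge0_integral_distribution//.
rewrite fubini_tonelli1//; last by move=> z; exact: h0.
exact: measurableT_comp (measurable_splice n L).
Qed.

End PathSpace.

Section PathLaw.
Context {R : realType} {d0 d1 dU : measure_display}
  {Omega0 : measurableType d0} {P0 : probability Omega0 R}
  {Omega1 : measurableType d1} {P1 : probability Omega1 R}
  {calU : measurableType dU} {U : {RV P0 >-> calU}} {V : nat -> {RV P1 >-> calU}}.

Definition path_of (w : Omega1) : @path dU calU := fun k => V k w.

Lemma measurable_path_of : measurable_fun setT path_of.
Proof. by apply: measurable_to_path => k; exact: measurable_funP. Qed.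

HB.instance Definition _ :=
  isMeasurableFun.Build _ _ _ _ path_of measurable_path_of.

Lemma iid_law_path_of : iid_copies U V ->
  iid_law (distribution P0 U) (distribution P1 path_of).
Proof.
move=> [lawV indV] A m mA Am.
have := indV [fset i in iota 0 m]%fset A (fun i _ => mA i).
have -> : \bigcap_(i in [set` [fset i in iota 0 m]%fset]) (V i @^-1` A i) =
    path_of @^-1` box A.
  apply/seteqP; split=> w /= H k.
    case: (ltnP k m) => km; last by rewrite Am.
    by apply: (H k) => /=; rewrite !inE mem_iota.
  by move=> _; exact: H.
move=> E; apply: (eq_trans E).
rewrite (perm_big (iota 0 m)); last first.
  apply: uniq_perm; rewrite ?iota_uniq//; first exact: fset_uniq.
  by move=> i; rewrite !inE.
rewrite -[m in iota 0 m]subn0 -/(index_iota 0 m) big_mkord.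
by apply: eq_bigr => k _; exact: lawV.
Qed.

End PathLaw.

(** * Measurability of vector-valued maps *)

Section BorelVectors.
Context {R : realType} {d : nat}.

Lemma measurable_coord_rV j :
  measurable_fun setT (fun x : borel_rV R d => x 0 j).
Proof.
apply: (@measurability _ _ (borel_rV R d) (measurableTypeR R) setT _
  (@RGenOInfty.G R)); first exact: RGenOInfty.measurableE.
move=> _ [_ [x ->] <-]; rewrite setTI; apply: sub_sigma_algebra.
have /continuousP := @coord_continuous R 1 d 0 j; apply.
exact: interval_open.
Qed.

(** Measurability of the coordinates suffices because open sets of row vectors
    are countable unions of rational boxes. *)
Lemma measurable_to_rV d' (T : measurableType d') (h : T -> borel_rV R d) :
  (forall j, measurable_fun setT (fun t => h t 0 j)) -> measurable_fun setT h.
Proof.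
move=> mh; apply: (@measurability _ _ T (borel_rV R d) setT h
  (@open 'rV[R]_d)) => // _ [A oA <-].
rewrite setTI.
pose q2r (q : 'rV[rat]_d) : 'rV[R]_d := \row_j ratr (q 0 j).
pose D (z : 'rV[rat]_d * nat) : set T :=
  if `[< ball (q2r z.1) (z.2.+1%:R^-1 : R) `<=` A >] then
    \bigcap_j [set t | `|q2r z.1 0 j - h t 0 j| < z.2.+1%:R^-1] else set0.
have -> : h @^-1` A = \bigcup_z D z.
  apply/seteqP; split=> [t /= At|t [[q n] _]]; last first.
    rewrite /D/=; case: ifPn => //= /asboolP qA H; apply: qA.
    split; first by rewrite invr_gt0 ltr0n.
    by move=> i j; rewrite (ord1 i); exact: H.
  have /nbhs_ballP[e /= e0 eA] : nbhs (h t : 'rV[R]_d) A.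
    exact: open_nbhs_nbhs.
  have [n ne] : exists n, 2 * (n.+1%:R^-1 : R) < e.
    have e2 : 0 < e / 2 by rewrite divr_gt0.
    have [n] := ltr_add_invr (e2 : 0 < e / 2).
    by rewrite add0r => ne; exists n; rewrite mulrC -ltr_pdivlMr.
  have n0 : (0 : R) < n.+1%:R^-1 by rewrite invr_gt0 ltr0n.
  have /choice[q qh] : forall j, exists q : rat,
      `|ratr q - h t 0 j| < n.+1%:R^-1.
    move=> j; have /rat_in_itvoo[q] : h t 0 j - n.+1%:R^-1 < h t 0 j + n.+1%:R^-1.
      by rewrite ltrD2l gt0_cp.
    by rewrite in_itv/= => hq; exists q; rewrite distrC ltr_distlC.
  exists (\row_j q j, n) => //; rewrite /D/=; case: asboolP => [_|[]]; last first.
    move=> y [_ yb]; apply: eA; split=> // i j; rewrite (ord1 i).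
    have := yb 0 j; rewrite /ball/= !mxE => yq.
    apply: le_lt_trans ne; rewrite mulr2n mulrDl mul1r.
    rewrite -(subrKA (ratr (q j) : R)); apply: (le_trans (ler_normD _ _)).
    by rewrite distrC lerD// ltW// distrC.
  by move=> j _ /=; rewrite !mxE.
apply: countable_bigcupT_measurable; first exact: countableP.
move=> -[q n]; rewrite /D/=; case: ifP => _ //.
apply: fin_bigcap_measurable => // j _.
rewrite -[X in measurable X]setTI.
apply: (measurable_fun_ltr (f := fun t => `|q2r q 0 j - h t 0 j|)
  (g := cst (n.+1%:R^-1)) _ _ measurableT) => //.
by apply: measurableT_comp => //; exact: measurable_funB.
Qed.

Lemma measurable_enorm d' (T : measurableType d') (h : T -> 'rV[R]_d) :
  (forall j, measurable_fun setT (fun t => h t 0 j)) ->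
  measurable_fun setT (fun t => enorm (h t)).
Proof.
move=> mh; apply: measurableT_comp.
  apply: continuous_measurable_fun; exact: sqrt_continuous.
apply: measurable_sum => j.
exact: measurable_funX.
Qed.

End BorelVectors.

(** * Integration on probability spaces *)

Section ProbabilityBounds.
Context {R : realType} {d} {T : measurableType d} (P : probability T R).
Local Open Scope ereal_scope.

Lemma integral_affine_le (f g : T -> R) (a b G : R) :
  measurable_fun setT f -> measurable_fun setT g ->
  (forall x, 0 <= f x)%R -> (forall x, 0 <= g x)%R -> (0 <= a)%R -> (0 <= b)%R ->
  (forall x, f x <= a + b * g x)%R ->
  \int[P]_x (g x)%:E <= G%:E -> \int[P]_x (f x)%:E <= (a + b * G)%:E.
Proof.
move=> mf mg f0 g0 a0 b0 fg gG.
apply: (@le_trans _ _ (\int[P]_x (a%:E + b%:E * (g x)%:E))).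
  apply: ge0_le_integral => //.
  - by move=> x _; rewrite lee_fin.
  - exact/measurable_EFinP.
  - apply: emeasurable_funD => //; apply: measurable_funeM; exact/measurable_EFinP.
  - by move=> x _; rewrite -EFinM -EFinD lee_fin.
rewrite ge0_integralD//; last 2 first.
- by move=> x _; rewrite mule_ge0 ?lee_fin.
- by apply: measurable_funeM; exact/measurable_EFinP.
rewrite integral_cst//= probability_setT mule1 ge0_integralZl//; last first.
- by move=> x _; rewrite lee_fin.
- exact/measurable_EFinP.
by rewrite EFinD EFinM leeD2l// lee_wpmul2l// lee_fin.
Qed.

(** Markov's inequality for a strict level set of a nonnegative variable. *)
Lemma prob_gt_le (g : T -> R) (e G : R) :
  measurable_fun setT g -> (forall x, 0 <= g x)%R -> (0 < e)%R ->
  \int[P]_x (g x)%:E <= G%:E -> P [set x | (e < g x)%R] <= (G / e)%:E.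
Proof.
move=> mg g0 e0 gG.
have mA : measurable [set x | (e < g x)%R].
  by rewrite -[X in measurable X]setTI; exact: measurable_fun_ltr.
set A := [set x | _] in mA *.
rewrite -[A]setIT -(integral_indic P measurableT mA) mulrC.
rewrite -[(e^-1 * G)%R]add0r.
apply: (@integral_affine_le _ g 0 e^-1) => //; rewrite ?invr_ge0 ?(ltW e0)//.
move=> x; rewrite add0r indicE; case: (boolP (x \in A)) => [|_].
  by rewrite inE /A/= => ex; rewrite mulrC ler_pdivlMr// mul1r ltW.
by rewrite mulr_ge0 ?invr_ge0 ?(ltW e0).
Qed.

Lemma integral_sum_le (I : eqType) (s : seq I) (Q : pred I)
    (w G : I -> R) (f : I -> T -> R) :
  (forall i, 0 <= w i)%R -> (forall i, measurable_fun setT (f i)) ->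
  (forall i x, 0 <= f i x)%R ->
  (forall i, i \in s -> Q i -> \int[P]_x (f i x)%:E <= (G i)%:E) ->
  \int[P]_x (\sum_(i <- s | Q i) w i * f i x)%:E <=
  (\sum_(i <- s | Q i) w i * G i)%:E.
Proof.
move=> w0 mf f0 fG.
under eq_integral do rewrite -sumEFin.
rewrite -big_filter; under eq_integral do rewrite -big_filter.
rewrite ge0_integral_sum//; last 2 first.
- by move=> i; apply/measurable_EFinP; apply: measurable_funM.
- by move=> i x _; rewrite lee_fin mulr_ge0.
rewrite -sumEFin big_seq [leRHS]big_seq; apply: lee_sum => i.
rewrite mem_filter => /andP[Qi si].
under eq_integral do rewrite EFinM.
rewrite ge0_integralZl//; last 3 first.
- exact/measurable_EFinP.
- by move=> x _; rewrite lee_fin.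
- by rewrite lee_fin.
by rewrite EFinM lee_wpmul2l ?lee_fin// fG.
Qed.

Lemma bounded_integrable (f : T -> R) (C : R) : measurable_fun setT f ->
  (forall x, `|f x| <= C)%R -> P.-integrable setT (EFin \o f).
Proof.
move=> mf fC; apply: (@le_integrable _ _ _ P setT measurableT _ (cst C%:E)).
- exact/measurable_EFinP.
- move=> x _ /=; rewrite lee_fin (le_trans (fC x))// ler_norm.
  by [].
- exact: finite_measure_integrable_cst.
Qed.

Lemma Rintegral_dist_le (f g : T -> R) (C D : R) :
  measurable_fun setT f -> measurable_fun setT g ->
  (forall x, `|f x| <= C)%R -> (forall x, `|g x| <= C)%R ->
  \int[P]_x (`|f x - g x|)%:E <= D%:E ->
  (`|(\int[P]_x f x)%R - (\int[P]_x g x)%R| <= D)%R.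
Proof.
move=> mf mg fC gC H.
have fi := bounded_integrable mf fC; have gi := bounded_integrable mg gC.
rewrite -RintegralB//; apply: (le_trans (le_normr_Rintegral _ _)) => //.
  apply: (@bounded_integrable _ (C + C)%R); first exact: measurable_funB.
  by move=> x; rewrite (le_trans (ler_normB _ _))// lerD.
have ni : P.-integrable setT (EFin \o (fun x => `|f x - g x|%R)).
  apply: (@bounded_integrable _ (C + C)%R).
    by apply: measurableT_comp => //; exact: measurable_funB.
  move=> x; rewrite normr_id (le_trans (ler_normB _ _))// lerD//.
rewrite -lee_fin /Rintegral fineK//.
exact: integrable_fin_num.
Qed.

Lemma Rintegral_norm_le (f : T -> R) (C : R) : measurable_fun setT f ->
  (forall x, `|f x| <= C)%R -> (`|\int[P]_x f x| <= C)%R.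
Proof.
move=> mf fC.
have fi := bounded_integrable mf fC.
apply: (le_trans (le_normr_Rintegral _ _)) => //.
have ni : P.-integrable setT (EFin \o (fun x => `|f x|%R)).
  apply: (@bounded_integrable _ C); first exact: measurableT_comp.
  by move=> x; rewrite normr_id.
rewrite -lee_fin /Rintegral fineK; last exact: integrable_fin_num.
rewrite -[C]addr0 -[X in (C + X)%R](mul0r 0%R).
apply: (@integral_affine_le _ (cst 0%R)) => //.
- exact: measurableT_comp.
- have [x] : exists x : T, True by exists point.
  by move=> _; exact: le_trans (fC x).
- by move=> x; rewrite mul0r addr0.
- by rewrite integral0_eq.
Qed.

End ProbabilityBounds.

(** * Limits of measurable real sequences *)

Section MeasurableLimits.
Context {R : realType} {d} {T : measurableType d}.

(** Convergence of a real sequence is a Cauchy condition over countably many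
    indices, hence an event. *)
Lemma measurable_cvgn (h : nat -> T -> R) :
  (forall n, measurable_fun setT (h n)) ->
  measurable [set t | cvgn (h ^~ t)].
Proof.
move=> mh.
have -> : [set t | cvgn (h ^~ t)] = \bigcap_k \bigcup_N \bigcap_m
    [set t | `|h N t - h (N + m)%N t| < k.+1%:R^-1].
  apply/seteqP; split=> t /=.
    move=> /cvg_cauchy/cauchy_ballP hc k _.
    have k0 : (0 : R) < k.+1%:R^-1 by rewrite invr_gt0 ltr0n.
    have [[A B] /= [[N _ AN] [M _ BM]] AB] := hc _ k0.
    exists (maxn N M) => // m _ /=; apply: (AB (_, _)); split=> /=.
      by apply: AN => /=; rewrite leq_maxl.
    by apply: BM => /=; rewrite (leq_trans (leq_maxr N M))// leq_addr.
  move=> H; apply: cauchy_cvg; apply: cauchy_exP => e e0.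
  have [k] := ltr_add_invr (e0 : 0 < e); rewrite add0r => ke.
  have [N _ HN] := H k I; exists (h N t); exists N => // m /= Nm.
  by have := HN (m - N)%N I; rewrite /= subnKC// => /lt_trans; apply.
apply: bigcapT_measurable => k; apply: bigcupT_measurable => N.
apply: bigcapT_measurable => m; rewrite -[X in measurable X]setTI.
apply: (measurable_fun_ltr (f := fun t => `|h N t - h (N + m)%N t|)
  (g := cst (k.+1%:R^-1)) _ _ measurableT) => //.
by apply: measurableT_comp => //; exact: measurable_funB.
Qed.

Lemma measurable_limn (h : nat -> T -> R) :
  (forall n, measurable_fun setT (h n)) ->
  measurable_fun setT (fun t => limn (h ^~ t)).
Proof.
move=> mh; set E := [set t | cvgn (h ^~ t)].
have mE : measurable E by exact: measurable_cvgn.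
apply: (@measurable_fun_cvg _ _ _ _
  (fun n t => if t \in E then h n t else point)).
  move=> n; apply: measurable_fun_ifT => //.
  apply: (@measurable_fun_bool _ _ _ _ true); rewrite setTI.
  rewrite (_ : _ @^-1` _ = E)//; apply/seteqP; split=> t /=.
    by move/set_mem.
  by move/mem_set.
move=> t _; case: (boolP (t \in E)) => [/set_mem//|tE].
rewrite dvgP; first exact: cvg_cst.
by move=> Et; move/negP: tE; apply; exact/mem_set.
Qed.

Lemma measurable_funV (h : T -> R) : measurable_fun setT h ->
  (forall t, 0 <= h t) -> measurable_fun setT (fun t => (h t)^-1).
Proof.
move=> mh h0; under eq_fun do rewrite -powR_inv1//.
exact: (measurableT_comp (@measurable_powR R (-1))).
Qed.

Lemma measurable_fun_sqrt (h : T -> R) : measurable_fun setT h ->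
  measurable_fun setT (fun t => Num.sqrt (h t)).
Proof.
move=> mh; apply: measurableT_comp mh.
by apply: continuous_measurable_fun; exact: sqrt_continuous.
Qed.

Lemma measurable_fun_expR (h : T -> R) : measurable_fun setT h ->
  measurable_fun setT (fun t => expR (h t)).
Proof.
move=> mh; apply: (measurableT_comp _ mh).
by apply: continuous_measurable_fun; exact: continuous_expR.
Qed.

Lemma measurable_direction (eps alpha beta : R) n (x : nat -> T -> R) :
  0 < eps -> (forall k, measurable_fun setT (x k)) ->
  measurable_fun setT (fun t => direction eps alpha beta n (x ^~ t)).
Proof.
move=> e0 mx; apply: measurable_funM.
  apply: measurable_funM => //; apply: measurable_sum => k.
  exact: measurable_funM.
apply: measurable_funV; last by move=> t; rewrite addr_ge0 ?sqrtr_ge0 ?ltW.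
apply: measurable_funD => //; apply: measurable_fun_sqrt.
apply: measurable_funM => //; apply: measurable_sum => k.
by apply: measurable_funM => //; exact: measurable_funX.
Qed.

Lemma measurable_avg2_tail (beta : R) K n (x : nat -> T -> R) :
  (forall k, measurable_fun setT (x k)) ->
  measurable_fun setT (fun t => avg2_tail beta K n (x ^~ t)).
Proof.
move=> mx; rewrite /avg2_tail; under eq_fun do rewrite big_mkcond.
apply: measurable_funM => //; apply: measurable_sum => k; case: (K <= k)%N => //.
by apply: measurable_funM => //; exact: measurable_funX.
Qed.

Lemma geom_tail_le (r : R) K n : 0 <= r < 1 ->
  \sum_(k < n | (K <= k)%N) r ^+ k <= r ^+ K / (1 - r).
Proof.
move=> /andP[r0 r1]; have h : 0 < 1 - r by rewrite subr_gt0.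
rewrite ler_pdivlMr//.
suff -> : (\sum_(k < n | (K <= k)%N) r ^+ k) * (1 - r) =
    r ^+ K - r ^+ maxn n K by rewrite gerBl exprn_ge0.
elim: n => [|n IH]; first by rewrite big_ord0 mul0r max0n subrr.
rewrite big_mkcond big_ord_recr/= -big_mkcond/= mulrDl IH.
case: leqP => Kn; last first.
  by rewrite mul0r addr0 (maxn_idPr Kn).
rewrite (maxn_idPl (leqW Kn)) exprS; ring.
Qed.

(** Second moments may grow like [r ^- k] into the past: the weights
    [beta ^+ k = r ^+ 2 ^+ k] still leave a geometric tail of ratio [r]. *)
Lemma integral_avg2_tail (P : probability T R) (beta D r : R) K n
    (x : nat -> T -> R) : 0 <= r < 1 -> beta = r ^+ 2 -> 0 <= D ->
  (forall k, measurable_fun setT (x k)) ->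
  (forall k, (K <= k)%N -> (k < n)%N ->
    (\int[P]_t (x k t ^+ 2)%:E <= (D / r ^+ k)%:E)%E) ->
  (\int[P]_t (avg2_tail beta K n (x ^~ t))%:E <= (2 * D * r ^+ K)%:E)%E.
Proof.
move=> /andP[r0 r1] -> D0 mx xD; have h : 0 < 1 - r by rewrite subr_gt0.
have q0 : 0 <= 1 - r ^+ 2 by rewrite subr_ge0 exprn_ile1// ltW.
rewrite /avg2_tail; under eq_integral do rewrite mulr_sumr.
under eq_integral do under eq_bigr do rewrite mulrA.
have := @integral_sum_le _ _ _ P 'I_n (index_enum 'I_n) (fun k => (K <= k)%N)
  (fun k => (1 - r ^+ 2) * r ^+ 2 ^+ k) (fun k => D / r ^+ k)
  (fun k t => x k t ^+ 2).
move=> H; apply: (le_trans (H _ _ _ _)).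
- by move=> k; rewrite mulr_ge0 ?exprn_ge0 ?sqr_ge0.
- by move=> k; exact: measurable_funX.
- by move=> k t; exact: sqr_ge0.
- by move=> k _ Kk; exact: xD.
rewrite lee_fin; apply: (@le_trans _ _
  ((1 - r ^+ 2) * D * \sum_(k < n | (K <= k)%N) r ^+ k)).
  rewrite mulr_sumr; apply: ler_sum => k _.
  have [->|rn0] := eqVneq r 0.
    rewrite expr0n/= subr0 !mul1r; case: (nat_of_ord k) => [|m].
      by rewrite !expr0 divr1 mulr1 mul1r.
    by rewrite !expr0n/= mul0r mulr0.
  rewrite -exprM mulnC exprM expr2 -subr_ge0 le_eqVlt; apply/orP; left.
  by apply/eqP; field; rewrite expf_neq0.
apply: (@le_trans _ _ ((1 - r ^+ 2) * D * (r ^+ K / (1 - r)))).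
  by rewrite ler_wpM2l ?mulr_ge0// geom_tail_le// r0.
have -> : (1 - r ^+ 2) * D * (r ^+ K / (1 - r)) = (1 + r) * D * r ^+ K.
  by field; rewrite gt_eqF.
rewrite ler_wpM2r ?exprn_ge0// ler_wpM2r//; lra.
Qed.

End MeasurableLimits.

(** * Moments of regular innovations *)

Section Powers.
Context {R : realType}.

(** Either [y <= s], or [(y / s) ^+ 2 <= (y / s) `^ p].  Choosing [s] as the
    distance between two parameters gives second moments of the right order. *)
Lemma sqr_le_powR (p y s : R) : 2 <= p -> 0 <= y -> 0 < s ->
  y ^+ 2 <= s ^+ 2 + s ^+ 2 / s `^ p * y `^ p.
Proof.
move=> p2 y0 s0; have [ys|sy] := leP y s.
  apply: (@le_trans _ _ (s ^+ 2)); first by rewrite ler_sqr ?nnegrE// ltW.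
  by rewrite lerDl mulr_ge0 ?divr_ge0 ?powR_ge0 ?sqr_ge0.
apply: (@le_trans _ _ (s ^+ 2 / s `^ p * y `^ p)); last first.
  by rewrite lerDr sqr_ge0.
have t1 : 1 <= y / s by rewrite ler_pdivlMr// mul1r ltW.
have -> : s ^+ 2 / s `^ p * y `^ p = s ^+ 2 * (y / s) `^ p.
  have -> : y `^ p = (y / s) `^ p * s `^ p.
    by rewrite -powRM ?divr_ge0 ?(ltW s0)// divfK// gt_eqF.
  by field; rewrite gt_eqF// powR_gt0.
rewrite -[y in leLHS](divfK (lt0r_neq0 s0)) exprMn mulrC ler_wpM2l ?sqr_ge0//.
by rewrite -powR_mulrn ?divr_ge0 ?(ltW s0)// ler_powR.
Qed.

End Powers.

Section Regular.
Context {R : realType} {dU : measure_display} {calU : measurableType dU}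
  {d : nat} (mu : probability calU R) (X : calU -> 'rV[R]_d -> 'rV[R]_d)
  (p : R) (c : R -> R).
Hypotheses (p2 : 2 <= p) (mX : is_innovation X) (c_cont : continuous c)
  (regX : forall x, (\int[mu]_u (enorm (X u x) `^ p)%:E <=
     (c 0 * (1 + expR (c 0 * enorm x)))%:E)%E)
  (regXX : forall x y, (\int[mu]_u (enorm (X u x - X u y) `^ p)%:E <=
     (c (enorm x + enorm y) * enorm (x - y) `^ p)%:E)%E).

Lemma measurable_innovation d' (T : measurableType d') (a : T -> calU)
    (b : T -> borel_rV R d) j :
  measurable_fun setT a -> measurable_fun setT b ->
  measurable_fun setT (fun t => X (a t) (b t) 0 j).
Proof.
move=> ma mb.
have mab : measurable_fun setT (fun t => (a t, b t)) by exact: measurable_fun_pair.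
exact: measurableT_comp (measurable_coord_rV j) (measurableT_comp mX mab).
Qed.

Lemma measurable_innovation1 x j : measurable_fun setT (fun u => X u x 0 j).
Proof.
by apply: (@measurable_innovation _ _ idfun (fun=> x)); [exact: measurable_id|exact: measurable_cst].
Qed.

Lemma growth_ge0 : 0 <= c 0.
Proof.
have : (0 <= (c 0 * (1 + expR (c 0 * enorm (0 : 'rV[R]_d))))%:E)%E.
  apply: le_trans (regX 0); apply: integral_ge0 => u _.
  by rewrite lee_fin powR_ge0.
by rewrite lee_fin pmulr_lge0// ltr_wpDl ?expR_gt0.
Qed.

(** Bounds second moments of gradients on the ball of radius [r], using
    [y ^+ 2 <= 1 + y `^ p]. *)
Definition moment_bound r : R := 1 + c 0 * (1 + expR (c 0 * r)).

Lemma moment_bound_ge0 r : 0 <= moment_bound r.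
Proof. by rewrite addr_ge0// mulr_ge0 ?growth_ge0// addr_ge0// expR_ge0. Qed.

Lemma moment_bound_homo : {homo moment_bound : r r' / r <= r'}.
Proof.
move=> r r' rr'; rewrite lerD2l ler_wpM2l ?growth_ge0// lerD2l ler_expR.
by rewrite ler_wpM2l ?growth_ge0.
Qed.

Lemma innovation_sqr x j :
  (\int[mu]_u ((X u x 0 j) ^+ 2)%:E <= (moment_bound (enorm x))%:E)%E.
Proof.
rewrite /moment_bound -[X in (1 + X)%:E]mul1r.
apply: (@integral_affine_le _ _ _ mu _ (fun u => enorm (X u x) `^ p)) => //.
- by apply: measurable_funX; exact: measurable_innovation1.
- apply: (measurableT_comp (@measurable_powR R p)).
  by apply: measurable_enorm => i; exact: measurable_innovation1.
- by move=> u; exact: sqr_ge0.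
- by move=> u; exact: powR_ge0.
- move=> u; rewrite mul1r.
  have := @sqr_le_powR R p (enorm (X u x)) 1 p2 (enorm_ge0 _) ltr01.
  rewrite expr1n powR1 divr1 mul1r; apply: le_trans.
  rewrite -(@real_normK _ (X u x 0 j)) ?num_real// ler_sqr ?nnegrE ?enorm_ge0//.
  exact: coord_le_enorm.
Qed.

Lemma lipschitz_bounded r : exists B, 0 <= B /\
  forall x y : 'rV[R]_d, enorm x <= r -> enorm y <= r ->
  c (enorm x + enorm y) <= B.
Proof.
have [r0|r0] := leP 0 r; last first.
  exists 0; split => // x y xr; have := le_trans (enorm_ge0 x) xr.
  by rewrite leNgt r0.
have r20 : 0 <= r + r by rewrite addr_ge0.
have cw : {within `[0, (r + r)], continuous c}.
  exact: continuous_subspaceT.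
have [t _ tmax] := EVT_max r20 cw.
exists `|c t|; split => // x y xr yr; apply: le_trans (ler_norm _).
by apply: tmax; rewrite in_itv/= addr_ge0 ?enorm_ge0//= lerD.
Qed.

Lemma enorm_sub_eq0 (x y : 'rV[R]_d) : enorm (x - y) = 0 -> x = y.
Proof.
move=> xy; apply/rowP => j; apply/eqP; rewrite -subr_eq0 -normr_eq0 eq_le normr_ge0.
by rewrite andbT -xy; have := coord_le_enorm (x - y) j; rewrite !mxE.
Qed.

Lemma innovation_lip_sqr r : exists B, 0 <= B /\
  forall (x y : 'rV[R]_d) j, enorm x <= r -> enorm y <= r ->
  (\int[mu]_u ((X u x 0 j - X u y 0 j) ^+ 2)%:E <=
   (B * enorm (x - y) ^+ 2)%:E)%E.
Proof.
have [B [B0 cB]] := lipschitz_bounded r.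
exists (1 + B); split; first by rewrite addr_ge0.
move=> x y j xr yr.
have := enorm_ge0 (x - y); rewrite le_eqVlt => /orP[/eqP e0|e0].
  have -> : x = y by apply: enorm_sub_eq0.
  rewrite integral0_eq ?subrr ?enorm0 ?expr0n ?mulr0//.
  by move=> u _; rewrite subrr expr0n.
set e := enorm (x - y) in e0 *.
apply: (@le_trans _ _ (e ^+ 2 + (e ^+ 2 / e `^ p) * (B * e `^ p))%:E); last first.
  rewrite lee_fin mulrDl mul1r lerD2l mulrC -mulrA ler_wpM2l//.
  by rewrite mulrC divfK// gt_eqF// powR_gt0.
apply: (@integral_affine_le _ _ _ mu _
  (fun u => enorm (X u x - X u y) `^ p)) => //.
- by apply: measurable_funX; apply: measurable_funB; exact: measurable_innovation1.
- apply: (measurableT_comp (@measurable_powR R p)).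
  apply: measurable_enorm => i; under eq_fun do rewrite !mxE.
  by apply: measurable_funB; exact: measurable_innovation1.
- by move=> u; exact: sqr_ge0.
- by move=> u; exact: powR_ge0.
- exact: sqr_ge0.
- by rewrite divr_ge0 ?sqr_ge0 ?powR_ge0.
- move=> u; have := @sqr_le_powR R p (enorm (X u x - X u y)) e p2 (enorm_ge0 _) e0.
  apply: le_trans; rewrite -(@real_normK _ (_ - _)) ?num_real//.
  rewrite ler_sqr ?nnegrE ?enorm_ge0//.
  by have := coord_le_enorm (X u x - X u y) j; rewrite !mxE.
- apply: (le_trans (regXX x y)); rewrite lee_fin ler_wpM2r ?powR_ge0//.
  exact: cB.
Qed.

(** Markov's inequality for the [p]-th power of the difference. *)
Lemma innovation_lip_tail r : exists B, 0 <= B /\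
  forall (x y : 'rV[R]_d) j (e : R), enorm x <= r -> enorm y <= r -> 0 < e ->
  (mu [set u | (e < `|X u x 0 j - X u y 0 j|)%R] <=
   (B * enorm (x - y) `^ p / e `^ p)%:E)%E.
Proof.
have [B [B0 cB]] := lipschitz_bounded r.
exists B; split => // x y j e xr yr e0.
have mE : measurable_fun setT (fun u => enorm (X u x - X u y) `^ p).
  apply: (measurableT_comp (@measurable_powR R p)).
  apply: measurable_enorm => i; under eq_fun do rewrite !mxE.
  by apply: measurable_funB; exact: measurable_innovation1.
apply: (@le_trans _ _ (mu [set u | (e `^ p < enorm (X u x - X u y) `^ p)%R])).
  have p0 : 0 < p by rewrite (lt_le_trans _ p2).
  apply: le_measure; rewrite ?inE.
  - rewrite -[X in measurable X]setTI; apply: measurable_fun_ltr => //.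
    apply: measurableT_comp => //.
    by apply: measurable_funB; exact: measurable_innovation1.
  - by rewrite -[X in measurable X]setTI; exact: measurable_fun_ltr.
  - move=> u /= eu; rewrite gt0_ltr_powR ?nnegrE ?enorm_ge0 ?(ltW e0)//.
    apply: (lt_le_trans eu).
    by have := coord_le_enorm (X u x - X u y) j; rewrite !mxE.
apply: prob_gt_le => //; first by move=> u; exact: powR_ge0.
  exact: powR_gt0.
apply: (le_trans (regXX x y)); rewrite lee_fin ler_wpM2r ?powR_ge0//.
exact: cB.
Qed.

(** * The averaged direction *)

Context (eps alpha beta : R).
Hypotheses (eps_gt0 : 0 < eps) (alpha_bd : 0 <= alpha < 1)
  (beta_bd : alpha ^+ 2 < beta < 1).
Context (Q : probability (@path dU calU) R) (iQ : iid_law mu Q).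

Lemma integral_coord k (h : calU -> \bar R) : measurable_fun setT h ->
  (forall u, 0 <= h u)%E -> (\int[Q]_s h (s k) = \int[mu]_u h u)%E.
Proof.
move=> mh h0.
pose C : {mfun (@path dU calU) >-> calU} :=
  HB.pack (fun s : @path dU calU => s k)
    (isMeasurableFun.Build _ _ _ _ _ (measurable_coord k)).
rewrite -(ge0_integral_distribution (P := Q) C mh h0).
apply: eq_measure_integral => A mA _.
transitivity (Q (box (fun i => if i == k then A else setT))).
  congr (Q _); apply/seteqP; split=> s /=.
    by move=> sA i; case: eqP => // ->.
  by move/(_ k); rewrite eqxx.
transitivity (\prod_(i < k.+1) mu (if i == k :> nat then A else setT))%E.
  apply: iQ => i; first by case: ifP.
  by move=> ki; rewrite gtn_eqF.
rewrite big_ord_recr/= eqxx big1 ?mul1e// => i _.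
by rewrite ltn_eqF// probability_setT.
Qed.

Let C0 := dir_bound alpha beta.
Let dir n x := direction eps alpha beta n x.

(** A fourth root of [beta], because two square roots are lost: one half of the
    exponent absorbs the growth of second moments into the past, one half is
    spent as the scale [s] of [direction_dist_avg2]. *)
Definition rate : R := Num.sqrt (Num.sqrt beta).

Lemma rate_bd : 0 < rate < 1.
Proof.
have b0 := beta_gt0 beta_bd; have b1 := beta_lt1 beta_bd.
rewrite /rate !sqrtr_gt0 b0/= -(@sqrtr1 R) ltr_sqrt// -(@sqrtr1 R).
by rewrite ltr_sqrt.
Qed.

Lemma rate_pow4 : beta = rate ^+ 2 ^+ 2.
Proof.
by rewrite /rate sqr_sqrtr ?sqrtr_ge0// sqr_sqrtr// ltW// (beta_gt0 beta_bd).
Qed.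

Lemma rate2_bd : 0 <= rate ^+ 2 < 1.
Proof.
case/andP: rate_bd => r0 r1; rewrite sqr_ge0/=.
by rewrite expr_lt1// ltW.
Qed.

Lemma le_div_rate2 (D : R) k : 0 <= D -> D <= D / rate ^+ 2 ^+ k.
Proof.
case/andP: rate_bd => r0 _; case/andP: rate2_bd => q0 /ltW q1 D0.
by rewrite ler_pdivlMr ?exprn_gt0// ler_piMr// exprn_ile1.
Qed.

(** The mean direction at a fixed parameter when the past has length [n]; it
    tends to the Adam vector field. *)
Definition mean_dir n (y : 'rV[R]_d) j : R :=
  (\int[Q]_s dir n (fun k => X (s k) y 0 j))%R.

Lemma measurable_coord_innovation k (y : 'rV[R]_d) j :
  measurable_fun setT (fun s : @path dU calU => X (s k) y 0 j).
Proof.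
by apply: measurable_innovation; [exact: measurable_coord|exact: measurable_cst].
Qed.

Lemma measurable_dir n (y : 'rV[R]_d) j :
  measurable_fun setT (fun s : @path dU calU => dir n (fun k => X (s k) y 0 j)).
Proof.
apply: (@measurable_direction _ _ _ _ _ _ _
  (fun k (s : @path dU calU) => X (s k) y 0 j)) => // k.
exact: measurable_coord_innovation.
Qed.

Lemma mean_dir_le n y j : `|mean_dir n y j| <= C0.
Proof.
apply: Rintegral_norm_le; first exact: measurable_dir.
by move=> s; exact: direction_le.
Qed.

(** The weighted second moment of the gradients older than [K] has an integral of
    order [rate ^+ 2 ^+ K]; the scale [rate ^+ K] balances the two terms of
    [direction_dist_avg2]. *)
Lemma mean_dir_truncate r : exists A, 0 <= A /\
  forall K n (y : 'rV[R]_d) j, (K <= n)%N -> enorm y <= r ->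
  `|mean_dir n y j - mean_dir K y j| <= A * rate ^+ K.
Proof.
case/andP: rate_bd => r0 r1; case/andP: rate2_bd => q0 q1.
set D := moment_bound r; have D0 : 0 <= D by exact: moment_bound_ge0.
set l := dir_lip eps alpha beta; have l0 : 0 <= l by exact: dir_lip_ge0.
exists (1 + l * (2 * D)); split.
  by rewrite addr_ge0// mulr_ge0// mulr_ge0.
move=> K n y j Kn yr; have rK : 0 < rate ^+ K by rewrite exprn_gt0.
apply: (Rintegral_dist_le (C := C0)); [exact: measurable_dir| |
  by move=> s; exact: direction_le|by move=> s; exact: direction_le|].
  exact: measurable_dir.
have -> : (1 + l * (2 * D)) * rate ^+ K =
    rate ^+ K + l / rate ^+ K * (2 * D * rate ^+ 2 ^+ K).
  by rewrite -exprM mulnC exprM; field; rewrite gt_eqF.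
apply: (integral_affine_le
  (g := fun s : @path dU calU => avg2_tail beta K n (fun k => X (s k) y 0 j))).
- by apply: measurableT_comp => //; apply: measurable_funB; exact: measurable_dir.
- apply: (@measurable_avg2_tail _ _ _ beta K n
    (fun k (s : @path dU calU) => X (s k) y 0 j)) => k.
  exact: measurable_coord_innovation.
- by move=> s; exact: normr_ge0.
- move=> s; rewrite mulr_ge0 ?(ltW (onem_beta_gt0 beta_bd))// sumr_ge0// => k _.
  by rewrite mulr_ge0 ?sqr_ge0 ?exprn_ge0 ?(ltW (beta_gt0 beta_bd)).
- exact: ltW.
- by rewrite divr_ge0// ltW.
- move=> s; rewrite -[avg2_tail _ _ _ _]add0r.
  have := @direction_window R eps alpha beta eps_gt0 alpha_bd beta_bd K n
    (fun k => X (s k) y 0 j) (fun k => X (s k) y 0 j) 0 (rate ^+ K) Kn rK.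
  rewrite expr0n/=; apply => k _; by rewrite subrr normr0.
- apply: (integral_avg2_tail rate2_bd rate_pow4 D0).
    by move=> k; exact: measurable_coord_innovation.
  move=> k Kk kn; rewrite (integral_coord k (h := fun u => (X u y 0 j ^+ 2)%:E)).
  + apply: (le_trans (innovation_sqr _ _)); rewrite lee_fin.
    apply: (@le_trans _ _ D); first exact: moment_bound_homo.
    exact: le_div_rate2.
  + apply/measurable_EFinP; apply: measurable_funX.
    exact: measurable_innovation1.
  + by move=> u; rewrite lee_fin sqr_ge0.
Qed.

(** The scale of [direction_dist_avg2] is the distance of the parameters. *)
Lemma mean_dir_lip r : exists L, 0 <= L /\
  forall n (x y : 'rV[R]_d) j, enorm x <= r -> enorm y <= r ->
  `|mean_dir n x j - mean_dir n y j| <= L * enorm (x - y).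
Proof.
have [B [B0 BP]] := innovation_lip_sqr r.
set l := dir_lip eps alpha beta; have l0 : 0 <= l by exact: dir_lip_ge0.
exists (1 + l * (2 * B)); split.
  by rewrite addr_ge0// mulr_ge0// mulr_ge0.
move=> n x y j xr yr; have := enorm_ge0 (x - y); rewrite le_eqVlt => /orP[/eqP e0|e0].
  have -> : x = y by apply: enorm_sub_eq0.
  by rewrite !subrr normr0 enorm0 mulr0.
set e := enorm (x - y) in e0 *.
apply: (Rintegral_dist_le (C := C0)); [exact: measurable_dir| |
  by move=> s; exact: direction_le|by move=> s; exact: direction_le|].
  exact: measurable_dir.
have -> : (1 + l * (2 * B)) * e = e + l / e * (2 * (B * e ^+ 2) * (rate ^+ 2) ^+ 0).
  by field; rewrite gt_eqF.
apply: (integral_affine_le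
  (g := fun s : @path dU calU => avg2_tail beta 0 n
     (fun k => X (s k) x 0 j - X (s k) y 0 j))).
- by apply: measurableT_comp => //; apply: measurable_funB; exact: measurable_dir.
- apply: (@measurable_avg2_tail _ _ _ beta 0 n
    (fun k (s : @path dU calU) => X (s k) x 0 j - X (s k) y 0 j)) => k.
  by apply: measurable_funB; exact: measurable_coord_innovation.
- by move=> s; exact: normr_ge0.
- move=> s; rewrite mulr_ge0 ?(ltW (onem_beta_gt0 beta_bd))// sumr_ge0// => k _.
  by rewrite mulr_ge0 ?sqr_ge0 ?exprn_ge0 ?(ltW (beta_gt0 beta_bd)).
- exact: ltW.
- by rewrite divr_ge0// ltW.
- by move=> s; exact: direction_dist_avg2.
- case/andP: rate_bd => r0 r1; case/andP: rate2_bd => q0 q1.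
  apply: (integral_avg2_tail rate2_bd rate_pow4).
  + by rewrite mulr_ge0 ?sqr_ge0.
  + by move=> k; apply: measurable_funB; exact: measurable_coord_innovation.
  move=> k Kk kn; rewrite (integral_coord k
    (h := fun u => ((X u x 0 j - X u y 0 j) ^+ 2)%:E)).
  + apply: (le_trans (BP _ _ _ xr yr)); rewrite lee_fin.
    by rewrite le_div_rate2// mulr_ge0 ?sqr_ge0.
  + apply/measurable_EFinP; apply: measurable_funX.
    by apply: measurable_funB; exact: measurable_innovation1.
  + by move=> u; rewrite lee_fin sqr_ge0.
Qed.

(** * The Adam vector field as a limit of averaged directions *)

Section Field.
Context {d1 : measure_display} {Omega1 : measurableType d1}
  {P1 : probability Omega1 R} {V : nat -> {RV P1 >-> calU}}.
Hypothesis lawV : iid_law mu (distribution P1 (path_of (V := V))).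

Lemma distribution_path_of C : measurable C ->
  Q C = distribution P1 (path_of (V := V)) C.
Proof. by move=> mC; apply: (iid_law_unique iQ) => //; exact: lawV. Qed.

Lemma integral_path_of (F : @path dU calU -> \bar R) : measurable_fun setT F ->
  (forall s, 0 <= F s)%E ->
  (\int[P1]_w F (path_of (V := V) w) = \int[Q]_s F s)%E.
Proof.
move=> mF F0.
rewrite -(ge0_integral_distribution (P := P1) (path_of (V := V)) mF F0).
by apply: eq_measure_integral => C mC _; exact/esym/distribution_path_of.
Qed.

Let x (y : 'rV[R]_d) j k w := X (V k w) y 0 j.

Let mx y j k : measurable_fun setT (x y j k).
Proof.
by apply: measurable_innovation; [exact: measurable_funP|exact: measurable_cst].
Qed.

Lemma mean_dir_path n y j :
  mean_dir n y j = (\int[P1]_w dir n (fun k => x y j k w))%R.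
Proof.
congr fine; have mD := measurable_dir n y j.
transitivity (\int[distribution P1 (path_of (V := V))]_s
    (dir n (fun k => X (s k) y 0 j))%:E)%E.
  by apply: eq_measure_integral => C mC _; exact: distribution_path_of.
rewrite integral_distribution//; first exact/measurable_EFinP.
apply: (@bounded_integrable _ _ _ _
  (fun w => dir n (fun k => X (path_of (V := V) w k) y 0 j)) C0).
  exact: (measurableT_comp mD (measurable_path_of (V := V))).
by move=> w; exact: direction_le.
Qed.

(** The series of second moments has a finite integral, hence converges almost
    surely; then [avg1_le], applied to absolute values, bounds the partial sums
    of the series of first moments. *)
Lemma ae_cvg_moments y j : {ae P1, forall w,
  cvgn (series (fun k => beta ^+ k * `|x y j k w| ^+ 2)) /\
  cvgn (series (fun k => alpha ^+ k * x y j k w))}.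
Proof.
have b0 := beta_gt0 beta_bd; have b1 := onem_beta_gt0 beta_bd.
case/andP: alpha_bd => a0 a1.
pose e k w := (beta ^+ k * (x y j k w) ^+ 2)%:E.
have me k : measurable_fun setT (e k).
  by apply/measurable_EFinP; apply: measurable_funM => //; exact: measurable_funX.
have e0 k w : (0 <= e k w)%E.
  by rewrite lee_fin mulr_ge0 ?sqr_ge0 ?exprn_ge0 ?(ltW b0).
set S := fun w => (\sum_(k <oo) e k w)%E.
have mS : measurable_fun setT S by apply: ge0_emeasurable_sum.
have S0 w : (0 <= S w)%E by apply: nneseries_ge0.
set D := moment_bound (enorm y).
have D0 : 0 <= D by exact: moment_bound_ge0.
have iS : P1.-integrable setT S.
  apply/integrableP; split => //.
  under eq_integral do rewrite gee0_abs//.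
  rewrite integral_nneseries//.
  apply: (@le_lt_trans _ _ (D / (1 - beta))%:E); last exact: ltry.
  apply: lime_le.
    by apply: is_cvg_nneseries => n _ _; apply: integral_ge0.
  apply: nearW => n; rewrite big_mkord.
  apply: (@le_trans _ _ (\sum_(k < n) (beta ^+ k * D)%:E)%E).
    apply: lee_sum => k _; rewrite EFinM.
    under eq_integral do rewrite /e EFinM.
    rewrite ge0_integralZl//; last 3 first.
    - by apply/measurable_EFinP; exact: measurable_funX.
    - by move=> w _; rewrite lee_fin sqr_ge0.
    - by rewrite lee_fin exprn_ge0 ?(ltW b0).
    rewrite lee_wpmul2l ?lee_fin ?exprn_ge0 ?(ltW b0)//.
    rewrite (integral_path_of (F := fun s => ((X (s k) y 0 j) ^+ 2)%:E)).
    + rewrite (integral_coord k (h := fun u => (X u y 0 j ^+ 2)%:E)).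
      * exact: innovation_sqr.
      * apply/measurable_EFinP; apply: measurable_funX.
        exact: measurable_innovation1.
      * by move=> u; rewrite lee_fin sqr_ge0.
    + apply/measurable_EFinP; apply: measurable_funX.
      exact: measurable_coord_innovation.
    + by move=> s; rewrite lee_fin sqr_ge0.
  rewrite sumEFin lee_fin -mulr_suml mulrC ler_wpM2l// geom_sum_le//.
  by rewrite (ltW b0) (beta_lt1 beta_bd).
apply: filterS (integrable_ae measurableT iS) => w /(_ I) Sfin.
have bnd n : \sum_(k < n) beta ^+ k * (x y j k w) ^+ 2 <= fine (S w).
  rewrite -lee_fin fineK// -sumEFin -(big_mkord xpredT (fun k => e k w)).
  by apply: nneseries_lim_ge => k _ _; exact: e0.
split.
  apply: nondecreasing_is_cvgn.
    apply: nondecreasing_series => k _ _.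
    by rewrite mulr_ge0 ?sqr_ge0 ?exprn_ge0 ?(ltW b0).
  exists (fine (S w)) => _ [n _ <-]; rewrite /series/= big_mkord.
  apply: le_trans (bnd n); apply: ler_sum => k _.
  by rewrite real_normK ?num_real.
apply: normed_cvg; apply: nondecreasing_is_cvgn.
  by apply: nondecreasing_series => k _ _; exact: normr_ge0.
exists (C0 * Num.sqrt ((1 - beta) * fine (S w)) / (1 - alpha)) => _ [n _ <-].
have -> : [normed series (fun k => alpha ^+ k * x y j k w)] n =
    \sum_(k < n) `|alpha ^+ k * x y j k w|.
  by rewrite -(big_mkord xpredT (fun k => `|alpha ^+ k * x y j k w|)).
rewrite ler_pdivlMr ?subr_gt0// mulrC.
have := @avg1_le R alpha beta alpha_bd beta_bd n (fun k => `|x y j k w|).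
rewrite ger0_norm; last first.
  rewrite mulr_ge0 ?subr_ge0 ?(ltW a1)// sumr_ge0// => k _.
  by rewrite mulr_ge0 ?exprn_ge0.
rewrite /avg1; under eq_bigr do rewrite -[alpha ^+ _]ger0_norm ?exprn_ge0// -normrM.
move=> H; apply: (le_trans H); rewrite ler_wpM2l ?(ltW (dir_bound_gt0 _ _))//.
apply: ler_wsqrtr; rewrite ler_wpM2l ?(ltW b1)//.
apply: le_trans (bnd n); apply: ler_sum => k _.
by rewrite real_normK ?num_real.
Qed.

(** Dominated convergence: directions are bounded by a constant. *)
Lemma mean_dir_cvg y j :
  mean_dir n y j @[n --> \oo] --> adam_field X alpha beta eps V y 0 j.
Proof.
have b0 := beta_gt0 beta_bd; have b1 := onem_beta_gt0 beta_bd.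
case/andP: (alpha_bd) => a0 a1; have a1' : 0 < 1 - alpha by rewrite subr_gt0.
pose B w := series (fun k => beta ^+ k * `|x y j k w| ^+ 2).
pose A w := series (fun k => alpha ^+ k * x y j k w).
pose g n w := (Num.sqrt ((1 - beta) * B w n) + eps)^-1 * A w n.
pose g_lim w := (Num.sqrt ((1 - beta) * limn (B w)) + eps)^-1 * limn (A w).
have dirE n w : dir n (fun k => x y j k w) = (1 - alpha) * g n w.
  rewrite /dir /direction /g /avg1 /avg2 /A /B /series/= !big_mkord.
  have -> : \sum_(k < n) beta ^+ k * `|x y j k w| ^+ 2 =
      \sum_(k < n) beta ^+ k * x y j k w ^+ 2.
    by apply: eq_bigr => k _; rewrite real_normK ?num_real.
  by rewrite -mulrA [X in _ * X]mulrC.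
have mB n : measurable_fun setT (fun w => B w n).
  apply: measurable_sum => k; apply: measurable_funM => //.
  by apply: measurable_funX; exact: measurableT_comp.
have mA n : measurable_fun setT (fun w => A w n).
  by apply: measurable_sum => k; exact: measurable_funM.
have mg (u v : Omega1 -> R) : measurable_fun setT u -> measurable_fun setT v ->
    measurable_fun setT (fun w => (Num.sqrt ((1 - beta) * u w) + eps)^-1 * v w).
  move=> mu' mv; apply: measurable_funM => //.
  apply: measurable_funV; last by move=> t; rewrite addr_ge0 ?sqrtr_ge0 ?ltW.
  by apply: measurable_funD => //; apply: measurable_fun_sqrt; exact: measurable_funM.
have mgn n : measurable_fun setT (g n) by exact: mg.
have mgl : measurable_fun setT g_lim by apply: mg; exact: measurable_limn.
have gb n w : `|g n w| <= C0 / (1 - alpha).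
  rewrite ler_pdivlMr// mulrC -{1}(gtr0_norm a1') -normrM -dirE.
  exact: direction_le.
have cg : {ae P1, forall w, setT w ->
    (EFin \o g ^~ w) n @[n --> \oo] --> (EFin \o g_lim) w}.
  apply: filterS (ae_cvg_moments y j) => w [cB cA] _.
  apply: cvg_EFin; first by apply: nearW => n.
  apply: cvgM => //; apply: cvgV.
    by rewrite gt_eqF// ltr_wpDl ?sqrtr_ge0.
  apply: cvgD; last exact: cvg_cst.
  apply: continuous_cvg; first exact: sqrt_continuous.
  by apply: cvgM => //; exact: cvg_cst.
have cdom : P1.-integrable setT (EFin \o (cst (C0 / (1 - alpha)) : Omega1 -> R)).
  exact: finite_measure_integrable_cst.
have [ig _ cI] := @dominated_convergence _ _ _ P1 setT measurableT
  (fun n => EFin \o g n) (EFin \o g_lim) (EFin \o cst (C0 / (1 - alpha)))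
  (fun n => (measurable_EFinP _ _).2 (mgn n)) ((measurable_EFinP _ _).2 mgl)
  cg cdom (aeW _ (fun w n _ => gb n w)).
rewrite /adam_field mxE.
have -> : (mean_dir ^~ y) ^~ j = (fun n => (1 - alpha) * (\int[P1]_w g n w)%R).
  apply/funext => n; rewrite mean_dir_path -RintegralZl//.
    by apply: eq_Rintegral => w _; exact: dirE.
  exact: bounded_integrable (gb n).
apply: cvgM; first exact: cvg_cst.
rewrite unlock; apply: fine_cvg; rewrite fineK//.
exact: integrable_fin_num.
Qed.

End Field.

(** * Adam as a function of the innovation path *)

Context (gamma : nat -> R) (start : 'rV[R]_d).
Hypotheses (gamma_gt0 : forall n, (0 < n)%N -> 0 < gamma n)
  (gamma_decr : forall m n, (0 < m)%N -> (m <= n)%N -> gamma n <= gamma m).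

Notation path := (@path dU calU).
Notation time := (training_time gamma).

(** The parameter, the first moment and the second moment after [n] steps. *)
Fixpoint adam_state n (s : path) : 'rV[R]_d * 'rV[R]_d * 'rV[R]_d :=
  if n is i.+1 then
    let x := X (s i) (adam_state i s).1.1 in
    let m := alpha *: (adam_state i s).1.2 + (1 - alpha) *: x in
    let v := \row_j (beta * (adam_state i s).2 0 j + (1 - beta) * x 0 j ^+ 2) in
    (\row_j ((adam_state i s).1.1 0 j + gamma i.+1 *
      (Num.sqrt (v 0 j / (1 - beta ^+ i.+1)) + eps)^-1 * m 0 j), m, v)
  else (start, 0, 0).

Definition theta n s := (adam_state n s).1.1.
Definition grad i s j := X (s i) (theta i s) 0 j.
(** Gradients listed backwards in time, as [avg1] and [avg2] expect them. *)
Definition past i s j k := grad (i - k) s j.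

(** Unrolling the two recursions into weighted sums over the past. *)
Lemma adam_state_moments i s j :
  (adam_state i.+1 s).1.2 0 j = avg1 alpha i.+1 (past i s j) /\
  (adam_state i.+1 s).2 0 j = avg2 beta i.+1 (past i s j).
Proof.
have shift (w : R) (F : nat -> R) i0 : \sum_(k < i0.+2) w ^+ k * F (i0.+1 - k)%N =
    F i0.+1 + w * \sum_(k < i0.+1) w ^+ k * F (i0 - k)%N.
  rewrite big_ord_recl/= expr0 mul1r subn0; congr (_ + _).
  rewrite mulr_sumr; apply: eq_bigr => k _; rewrite /bump/= add1n subSS exprS.
  by rewrite mulrA.
elim: i => [|i [IHm IHv]].
  rewrite /= !mxE /avg1 /avg2 !big_ord_recl !big_ord0 /past /grad /theta/=.
  by rewrite !mulr0 !add0r !expr0 !addr0 !mul1r.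
have -> : (adam_state i.+2 s).1.2 0 j =
    alpha * (adam_state i.+1 s).1.2 0 j + (1 - alpha) * grad i.+1 s j.
  by rewrite /grad /theta [adam_state i.+2 s]/= [LHS]mxE; congr (_ + _); rewrite mxE.
have -> : (adam_state i.+2 s).2 0 j =
    beta * (adam_state i.+1 s).2 0 j + (1 - beta) * grad i.+1 s j ^+ 2.
  by rewrite /grad /theta [adam_state i.+2 s]/= [LHS]mxE.
rewrite IHm IHv /avg1 /avg2 /past.
rewrite (shift alpha (fun k => grad k s j)) (shift beta (fun k => grad k s j ^+ 2)).
by split; ring.
Qed.

Definition step i s j : R := avg1 alpha i.+1 (past i s j) /
  (Num.sqrt (avg2 beta i.+1 (past i s j) / (1 - beta ^+ i.+1)) + eps).

Lemma thetaS i s j : theta i.+1 s 0 j = theta i s 0 j + gamma i.+1 * step i s j.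
Proof.
have [Em Ev] := adam_state_moments i s j.
rewrite /step -Em -Ev /theta [adam_state i.+1 s]/= [LHS]mxE -/(theta i s).
by rewrite -mulrA [X in gamma _ * X]mulrC.
Qed.

Lemma onem_betaX_bd i : 0 < 1 - beta ^+ i.+1 <= 1.
Proof.
have b0 := beta_gt0 beta_bd; have b1 := beta_lt1 beta_bd.
rewrite subr_gt0 gerBl exprn_ge0 ?(ltW b0)// andbT.
by rewrite exprn_ilt1// ltW.
Qed.

Lemma step_le i s j : `|step i s j| <= C0.
Proof.
rewrite /step normrM normfV.
have /andP[c0 c1] := onem_betaX_bd i.
set B := avg2 _ _ _; have B0 : 0 <= B by exact: (avg2_ge0 beta_bd).
have h : 0 < Num.sqrt (B / (1 - beta ^+ i.+1)) + eps by rewrite ltr_wpDl ?sqrtr_ge0.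
rewrite (gtr0_norm h) ler_pdivrMr//.
apply: (le_trans (avg1_le alpha_bd beta_bd _ _)).
rewrite ler_wpM2l ?(ltW (dir_bound_gt0 _ _))// -/B.
apply: (@le_trans _ _ (Num.sqrt (B / (1 - beta ^+ i.+1)))); last by rewrite lerDl ltW.
apply: ler_wsqrtr; rewrite ler_pdivlMr// ler_piMr//.
Qed.

(** The parameter moves at most at this speed with respect to training time. *)
Definition speed : R := C0 *+ d.

Lemma speed_ge0 : 0 <= speed.
Proof. by rewrite mulrn_wge0// ltW// dir_bound_gt0. Qed.

Lemma timeS n : time n.+1 = time n + gamma n.+1.
Proof. by rewrite /training_time big_nat_recr. Qed.

Lemma time_homo : {homo time : m n / (m <= n)%N >-> m <= n}.
Proof.
apply: homo_leq => [x|y x z|n]; [exact: lexx|exact: le_trans|].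
by rewrite timeS lerDl ltW// gamma_gt0.
Qed.

Lemma time_ge0 n : 0 <= time n.
Proof.
by rewrite -[X in X <= _](_ : time 0 = 0) ?time_homo// /training_time big_nil.
Qed.

Lemma sum_gamma m n : (m <= n)%N ->
  \sum_(m <= i < n) gamma i.+1 = time n - time m.
Proof.
move=> mn; rewrite /training_time -(@telescope_sumr _ m n time)//.
by apply: eq_bigr => i _; rewrite timeS addrC addKr.
Qed.

Lemma theta_dist m n s : (m <= n)%N ->
  enorm (theta n s - theta m s) <= speed * (time n - time m).
Proof.
move=> mn; rewrite -(telescope_sumr (theta ^~ s) mn).
apply: (le_trans (enorm_sum _ _ _)); rewrite -sum_gamma// mulr_sumr.
apply: ler_sum => i _; rewrite mulrC.
rewrite /speed mulrnAr; apply: enorm_le_bound => j.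
rewrite coordB thetaS addrC addKr normrM (gtr0_norm (gamma_gt0 _))//.
rewrite ler_wpM2l ?step_le// ltW// gamma_gt0//.
Qed.

Lemma adam_state_splice n L s s' a : (a <= n)%N ->
  adam_state a (splice n L s s') = adam_state a s.
Proof.
elim: a => //= a IH an; rewrite IH ?(ltnW an)//.
by rewrite [splice n L s s' a]/splice an.
Qed.

Lemma theta_splice n L s s' a : (a <= n)%N ->
  theta a (splice n L s s') = theta a s.
Proof. by move=> an; rewrite /theta adam_state_splice. Qed.

Lemma measurable_theta n : measurable_fun setT (theta n : path -> borel_rV R d).
Proof.
elim/ltn_ind: n => -[_|n IH].
  exact: measurable_cst.
apply: measurable_to_rV => j; under eq_fun do rewrite thetaS.
have mth m : (m <= n)%N ->
    measurable_fun setT (theta m : path -> borel_rV R d) by exact: IH.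
have mp k : measurable_fun setT (fun s : path => past n s j k).
  apply: measurable_innovation; first exact: measurable_coord.
  by apply: mth; rewrite leq_subr.
apply: measurable_funD.
  exact: (measurableT_comp (measurable_coord_rV j) (mth n (leqnn n))).
apply: measurable_funM => //; apply: measurable_funM.
  apply: measurable_funM => //; apply: measurable_sum => k.
  exact: measurable_funM.
apply: measurable_funV; last by move=> t; rewrite addr_ge0 ?sqrtr_ge0 ?ltW.
apply: measurable_funD => //; apply: measurable_fun_sqrt.
apply: measurable_funM => //; apply: measurable_funM => //.
apply: measurable_sum => k.
by apply: measurable_funM => //; exact: measurable_funX.
Qed.

Lemma measurable_grad i j : measurable_fun setT (fun s : path => grad i s j).
Proof.
by apply: measurable_innovation; [exact: measurable_coord|exact: measurable_theta].
Qed.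

Lemma measurable_theta_ball n r : measurable [set s : path | enorm (theta n s) <= r].
Proof.
rewrite -[X in measurable X]setTI.
apply: (measurable_fun_ler (f := fun s : path => enorm (theta n s)) (g := cst r)
  _ _ measurableT) => //.
apply: measurable_enorm => j.
exact: (measurableT_comp (measurable_coord_rV j) (measurable_theta n)).
Qed.

(** Bounding an integral by bounding it conditionally on the past of time [n]. *)
Lemma resample_le n L (h : path -> R) (b : R) : measurable_fun setT h ->
  (forall s, 0 <= h s) ->
  (forall s, (\int[Q]_s' (h (splice n L s s'))%:E <= b%:E)%E) ->
  (\int[Q]_s (h s)%:E <= b%:E)%E.
Proof.
move=> mh h0 hb; rewrite (resample n L iQ (h := fun s => (h s)%:E))//; last exact/measurable_EFinP.
apply: (@le_trans _ _ (\int[Q]_s (cst b%:E s))%E); last first.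
  by rewrite integral_cst//= probability_setT mule1.
apply: ge0_le_integral => //.
- by move=> s _; apply: integral_ge0 => s' _; rewrite lee_fin.
- apply: (@measurable_fun_fubini_tonelli_F _ _ _ _ _ Q
    (fun z : path * path => (h (splice n L z.1 z.2))%:E)).
    apply/measurable_EFinP.
    exact: (measurableT_comp mh (measurable_splice n L)).
  by move=> z; rewrite lee_fin.
Qed.

(** The innovation at time [a] is independent of the parameter at time [a]. *)
Lemma grad_sqr_le a r j : (\int[Q]_s
  (grad a s j ^+ 2 * \1_[set s : path | (enorm (theta a s) <= r)%R] s)%:E
  <= (moment_bound r)%:E)%E.
Proof.
apply: (@resample_le a 0).
- apply: measurable_funM; first by apply: measurable_funX; exact: measurable_grad.
  by apply: measurable_indic; exact: measurable_theta_ball.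
- by move=> s; rewrite mulr_ge0 ?sqr_ge0.
move=> s; have gradE s' : grad a (splice a 0 s s') j = X (s' 0%N) (theta a s) 0 j.
  by rewrite /grad theta_splice// [splice a 0 s s' a]/splice ltnn subnn.
under eq_integral do rewrite gradE indicE.
case: (leP (enorm (theta a s)) r) => sr; last first.
  rewrite integral0_eq ?lee_fin ?moment_bound_ge0// => s' _.
  by rewrite memNset ?mulr0//= theta_splice//; apply/negP; rewrite -ltNge.
have memE s' :
    (splice a 0 s s' \in [set s : path | enorm (theta a s) <= r]) = true.
  by apply: mem_set; rewrite /= theta_splice.
under eq_integral do rewrite memE mulr1.
rewrite (integral_coord 0 (h := fun u => (X u (theta a s) 0 j ^+ 2)%:E)).
- by apply: (le_trans (innovation_sqr _ _)); rewrite lee_fin moment_bound_homo.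
- by apply/measurable_EFinP; apply: measurable_funX; exact: measurable_innovation1.
- by move=> u; rewrite lee_fin sqr_ge0.
Qed.

(** Both parameters are functions of the innovations before time [i], so that
    [innovation_lip_tail] applies conditionally; their distance is at most
    [speed] times the elapsed training time. *)
Lemma grad_freeze r : exists B, 0 <= B /\
  forall a i j (e : R), (a <= i)%N -> 0 < e ->
  (Q [set s : path | [/\ enorm (theta a s) <= r, enorm (theta i s) <= r &
     e < `|grad i s j - X (s i) (theta a s) 0 j| ]]%R
   <= (B * (speed * (time i - time a)) `^ p / e `^ p)%:E)%E.
Proof.
have [B [B0 BP]] := innovation_lip_tail r.
exists B; split => // a i j e ai e0.
set E := [set s : path | _].
have mdiff : measurable_fun setT (fun s : path => `|grad i s j - X (s i) (theta a s) 0 j|).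
  apply: measurableT_comp => //; apply: measurable_funB; first exact: measurable_grad.
  by apply: measurable_innovation; [exact: measurable_coord|exact: measurable_theta].
have mE : measurable E.
  rewrite (_ : E = [set s : path | enorm (theta a s) <= r] `&`
      ([set s : path | enorm (theta i s) <= r] `&`
       [set s : path | e < `|grad i s j - X (s i) (theta a s) 0 j|])); last first.
    by apply/seteqP; split=> s /=; [case|move=> [? []]].
  apply: measurableI; first exact: measurable_theta_ball.
  apply: measurableI; first exact: measurable_theta_ball.
  by rewrite -[X in measurable X]setTI; exact: measurable_fun_ltr.
rewrite -[E]setIT -integral_indic//.
have rhs0 : 0 <= B * (speed * (time i - time a)) `^ p / e `^ p.
  by rewrite divr_ge0 ?powR_ge0// mulr_ge0// powR_ge0.
apply: (@resample_le i 0 (\1_E)); [exact: measurable_indic|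
  by move=> s; rewrite indicE|move=> s].
have [sr|sr] := pselect (enorm (theta a s) <= r /\ enorm (theta i s) <= r); last first.
  rewrite integral0_eq ?lee_fin// => s' _; congr EFin; rewrite indicE memNset//.
  by move=> [h1 h2 _]; apply: sr; move: h1 h2; rewrite !theta_splice.
have mD : measurable [set u | (e < `|X u (theta i s) 0 j - X u (theta a s) 0 j|)%R].
  rewrite -[X in measurable X]setTI; apply: measurable_fun_ltr => //.
  by apply: measurableT_comp => //; apply: measurable_funB; exact: measurable_innovation1.
set D := [set u | _] in mD.
apply: (@le_trans _ _ (\int[Q]_s' (\1_D (s' 0%N))%:E)%E).
  apply: ge0_le_integral => //.
  - apply/measurable_EFinP; apply: (measurableT_comp (measurable_indic mE)).
    exact: (measurableT_comp (measurable_splice i 0) (measurable_pair1 _)).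
  - apply/measurable_EFinP; apply: (measurableT_comp (measurable_indic mD)).
    exact: measurable_coord.
  - move=> s' _; rewrite lee_fin !indicE; case: (boolP (_ \in E)) => // /set_mem.
    move=> [_ _]; rewrite /grad !theta_splice// [splice i 0 s s' i]/splice.
    by rewrite ltnn subnn => h; rewrite mem_set.
rewrite (integral_coord 0 (h := fun u => (\1_D u)%:E)).
- rewrite integral_indic// setIT; case: sr => sra sri.
  apply: (le_trans (BP _ _ _ _ sri sra e0)); rewrite lee_fin.
  rewrite ler_wpM2r ?invr_ge0 ?powR_ge0// ler_wpM2l//.
  rewrite ge0_ler_powR ?nnegrE ?enorm_ge0 ?(le_trans _ p2)//.
    by rewrite mulr_ge0 ?speed_ge0// subr_ge0 time_homo.
  exact: theta_dist.
- by apply/measurable_EFinP; exact: measurable_indic.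
- by move=> u; rewrite lee_fin.
Qed.

(** * Concentration of the frozen directions *)

(** From [expR x <= 1 / (1 - x)]. *)
Lemma expR_le_quad (x : R) : x <= 1 / 2 -> expR x <= 1 + x + 2 * x ^+ 2.
Proof.
move=> x2; have x1 : 0 < 1 - x by lra.
have H : expR x <= (1 - x)^-1.
  rewrite -[x in expR x]opprK expRN lef_pV2 ?posrE ?expR_gt0//.
  exact: expR_ge1Dx.
apply: (le_trans H); rewrite -[X in _ <= X](mulfK (lt0r_neq0 x1)).
rewrite ler_pdivlMr//  mulVf ?gt_eqF//; nra.
Qed.

(** The linear term of [expR_le_quad] integrates to zero. *)
Lemma expR_moment_le d' (T : measurableType d') (P : probability T R)
    (f : T -> R) (b l : R) : measurable_fun setT f ->
  (forall x, `|f x| <= b) -> (`|l| * (2 * b) <= 1 / 2) ->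
  (\int[P]_x (expR (l * (f x - (\int[P]_x f x)%R)))%:E <=
   (expR (8 * l ^+ 2 * b ^+ 2))%:E)%E.
Proof.
move=> mf fb lb; set m := (\int[P]_x f x)%R.
have mb : `|m| <= b by exact: Rintegral_norm_le.
have b0 : 0 <= b by exact: le_trans (normr_ge0 _) mb.
have fmb x : `|f x - m| <= 2 * b.
  by rewrite (le_trans (ler_normB _ _))// mulr2n mulrDl mul1r lerD.
have lfm x : `|l * (f x - m)| <= `|l| * (2 * b) by rewrite normrM ler_wpM2l.
pose v := 8 * l ^+ 2 * b ^+ 2.
have mfm : measurable_fun setT (fun x => f x - m) by exact: measurable_funB.
have mlfm : measurable_fun setT (fun x => l * (f x - m)) by exact: measurable_funM.
have ilfm : P.-integrable setT (EFin \o (fun x => l * (f x - m))).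
  exact: bounded_integrable lfm.
have iR : P.-integrable setT (EFin \o f) by exact: bounded_integrable fb.
have ic : P.-integrable setT (EFin \o (cst (1 + v) : T -> R)).
  exact: finite_measure_integrable_cst.
apply: (@le_trans _ _ (\int[P]_x ((1 + v)%:E + (l * (f x - m))%:E))%E).
  apply: ge0_le_integral => //.
  - by apply/measurable_EFinP; exact: measurable_fun_expR.
  - by apply: emeasurable_funD => //; exact/measurable_EFinP.
  - move=> x _; rewrite -EFinD lee_fin.
    apply: (le_trans (expR_le_quad _)).
      by rewrite (le_trans (ler_norm _))// (le_trans (lfm x)).
    rewrite addrAC lerD2r lerD2l /v.
    have -> : 8 * l ^+ 2 * b ^+ 2 = 2 * (`|l| * (2 * b)) ^+ 2.
      rewrite exprMn real_normK ?num_real//; ring.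
    rewrite ler_wpM2l// -(@real_normK _ (l * (f x - m))) ?num_real//.
    by rewrite ler_sqr ?nnegrE// mulr_ge0// mulr_ge0.
rewrite (@integralD _ _ _ P _ _ (cst (1 + v)%:E) (fun x => (l * (f x - m))%:E))//.
rewrite integral_cst//= probability_setT mule1.
have -> : (\int[P]_x (l * (f x - m))%:E = 0)%E.
  transitivity ((\int[P]_x (l * (f x - m))%R)%R%:E).
    rewrite /Rintegral fineK//; exact: integrable_fin_num.
  rewrite RintegralZl//; last by apply: bounded_integrable fmb.
  rewrite RintegralB//; last exact: finite_measure_integrable_cst.
  rewrite Rintegral_cst//= probability_setT/= mulr1 -/m subrr mulr0//.
by rewrite adde0 lee_fin (le_trans (expR_ge1Dx _)).
Qed.

(** [frozen K i] is the direction computed from the [K] most recent innovations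
    with the parameter frozen at the time these start; given the past before
    that time, its mean is [mean_dir K]. *)
Definition frozen K i (s : path) j : R :=
  dir K (fun k => X (s (i - k)%N) (theta (i.+1 - K) s) 0 j).

Definition deviation K i (s : path) j : R :=
  frozen K i s j - mean_dir K (theta (i.+1 - K) s) j.

Lemma measurable_frozen K i j :
  measurable_fun setT (fun s : path => frozen K i s j).
Proof.
apply: (@measurable_direction _ _ _ _ _ _ _
  (fun k (s : path) => X (s (i - k)%N) (theta (i.+1 - K) s) 0 j)) => // k.
by apply: measurable_innovation; [exact: measurable_coord|exact: measurable_theta].
Qed.

(** Adding [C0] makes the integrand nonnegative, as Tonelli requires. *)
Lemma measurable_mean_dir K i j :
  measurable_fun setT (fun s : path => mean_dir K (theta i s) j).
Proof.
have mF : measurable_fun setT (fun z : path * path =>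
    dir K (fun k => X (z.2 k) (theta i z.1) 0 j)).
  apply: (@measurable_direction _ _ _ _ _ _ _
    (fun k (z : path * path) => X (z.2 k) (theta i z.1) 0 j)) => // k.
  apply: measurable_innovation.
    exact: (measurableT_comp (measurable_coord k) measurable_snd).
  exact: (measurableT_comp (measurable_theta i) measurable_fst).
have C00 : 0 <= C0 by rewrite ltW// dir_bound_gt0.
have E s : mean_dir K (theta i s) j =
    fine (\int[Q]_s' (dir K (fun k => X (s' k) (theta i s) 0 j) + C0)%:E)%E - C0.
  rewrite -/(Rintegral Q setT (fun s' : path =>
    dir K (fun k => X (s' k) (theta i s) 0 j) + C0)) RintegralD//.
  - by rewrite Rintegral_cst//= probability_setT/= mulr1 addrK.
  - apply: (@bounded_integrable _ _ _ _ _ C0); first exact: measurable_dir.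
    by move=> s'; exact: direction_le.
  - exact: finite_measure_integrable_cst.
under eq_fun do rewrite E.
apply: measurable_funB => //.
apply: (measurableT_comp (fine_measurable measurableT)).
apply: (@measurable_fun_fubini_tonelli_F _ _ _ _ _ Q
  (fun z : path * path => (dir K (fun k => X (z.2 k) (theta i z.1) 0 j) + C0)%:E)).
  by apply/measurable_EFinP; exact: measurable_funD.
move=> z; rewrite lee_fin -lerBlDr sub0r.
have := direction_le eps_gt0 alpha_bd beta_bd K
  (fun k => X (z.2 k) (theta i z.1) 0 j).
by rewrite ler_norml => /andP[].
Qed.

Lemma measurable_deviation K i j :
  measurable_fun setT (fun s : path => deviation K i s j).
Proof.
by apply: measurable_funB; [exact: measurable_frozen|exact: measurable_mean_dir].
Qed.

Lemma deviation_splice K i n L s s' j : (i < n)%N ->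
  deviation K i (splice n L s s') j = deviation K i s j.
Proof.
move=> ni; rewrite /deviation /frozen; case: K => [|K].
  by rewrite /dir /direction /avg1 /avg2 !big_ord0 theta_splice// subn0.
rewrite theta_splice; last by rewrite subSS (leq_trans (leq_subr _ _))// ltnW.
congr (_ - _); congr dir; apply/funext => k.
by rewrite [splice n L s s' (i - k)%N]/splice (leq_ltn_trans (leq_subr _ _) ni).
Qed.

(** Within a residue class modulo [K] the deviations are martingale differences:
    consecutive ones depend on disjoint blocks of [K] innovations. *)
Definition class_sum K M l n (s : path) j : R :=
  \sum_(M <= i < n | (i %% K == l)%N) gamma i.+1 * deviation K i s j.

Lemma measurable_class_sum K M l n j :
  measurable_fun setT (fun s : path => class_sum K M l n s j).
Proof.
rewrite /class_sum; under eq_fun do rewrite big_mkcond.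
apply: measurable_sum => i; case: (i %% K == l)%N => //.
by apply: measurable_funM => //; exact: measurable_deviation.
Qed.

(** Induction on [n].  If [n] lies in the class, the term of index [n] is, given
    the older innovations, a function with mean zero of the last [K] ones, and all
    earlier terms of the class depend on the older innovations only.  Resampling the last
    [K] innovations therefore splits off a factor bounded by [expR_moment_le]. *)
Lemma class_sum_moment K M l n j (t : R) : (0 < K)%N -> (K.-1 <= M)%N ->
  (forall i, (M <= i)%N -> `|t * gamma i.+1| * (2 * C0) <= 1 / 2) ->
  (\int[Q]_s (expR (t * class_sum K M l n s j))%:E <=
   (expR (8 * t ^+ 2 * C0 ^+ 2 * \sum_(M <= i < n) gamma i.+1 ^+ 2))%:E)%E.
Proof.
move=> K0 KM tb; elim/ltn_ind: n => n IH.
have C00 : 0 < C0 by rewrite dir_bound_gt0.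
have base : (n <= M)%N -> (\int[Q]_s (expR (t * class_sum K M l n s j))%:E <=
   (expR (8 * t ^+ 2 * C0 ^+ 2 * \sum_(M <= i < n) gamma i.+1 ^+ 2))%:E)%E.
  move=> nM; rewrite /class_sum big_geq// mulr0 expR0.
  under eq_integral do rewrite big_geq// mulr0 expR0.
  by rewrite integral_cst//= probability_setT mule1.
case: n IH base => [|n] IH base; first exact: base.
case: (ltnP n M) => [nM|Mn]; first exact: base.
rewrite [in leRHS]big_nat_recr//=.
case: (boolP (n %% K == l)%N) => nl; last first.
  have E s : class_sum K M l n.+1 s j = class_sum K M l n s j.
    by rewrite /class_sum big_mkcond big_nat_recr//= (negbTE nl) addr0 -big_mkcond.
  under eq_integral do rewrite E.
  apply: (le_trans (IH n (ltnSn n))); rewrite lee_fin ler_expR.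
  have h8 : 0 <= 8 * t ^+ 2 * C0 ^+ 2.
    by apply: mulr_ge0; [apply: mulr_ge0 => //; exact: sqr_ge0|exact: sqr_ge0].
  by rewrite (ler_wpM2l h8)// lerDl sqr_ge0.
have Kn : (K <= n.+1)%N by rewrite -(prednK K0) ltnS (leq_trans KM).
pose a := (n.+1 - K)%N.
have an : (a <= n)%N by rewrite /a -(prednK K0) subSS leq_subr.
have naE : (n - a = K.-1)%N.
  by rewrite /a -{1}(prednK K0) subSS subKn// (leq_trans KM).
have E s : class_sum K M l n.+1 s j =
    class_sum K M l n s j + gamma n.+1 * deviation K n s j.
  by rewrite /class_sum big_mkcond big_nat_recr//= nl -big_mkcond.
have Esplice s s' : class_sum K M l n.+1 (splice a K.-1 s s') j =
    class_sum K M l n s j + gamma n.+1 *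
      (dir K (fun k => X (s' k) (theta a s) 0 j) - mean_dir K (theta a s) j).
  have E1 : class_sum K M l n (splice a K.-1 s s') j = class_sum K M l n s j.
    rewrite /class_sum big_nat_cond [RHS]big_nat_cond; apply: eq_bigr => i.
    move=> /andP[/andP[Mi ni] il]; rewrite deviation_splice//.
    have : (K %| n - i)%N.
      by rewrite -eqn_mod_dvd ?(ltnW ni)// (eqP nl) (eqP il).
    move=> /dvdn_leq; rewrite subn_gt0 => /(_ ni) Kni.
    rewrite /a; lia.
  have E2 : deviation K n (splice a K.-1 s s') j =
      dir K (fun k => X (s' k) (theta a s) 0 j) - mean_dir K (theta a s) j.
    rewrite /deviation /frozen -/a theta_splice//; congr (_ - _).
    rewrite /dir; apply: direction_eq => k kK.
    have -> : splice a K.-1 s s' (n - k)%N = s' k; last by [].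
    rewrite /splice ltnNge (_ : (a <= n - k)%N)/=; last by rewrite /a; lia.
    by congr s'; rewrite /flip /a; move: K0 kK Kn; clear; case: ifP; lia.
  by rewrite E E1 E2.
have mE m : measurable_fun setT (fun s : path => expR (t * class_sum K M l m s j)).
  apply: measurable_fun_expR.
  by apply: measurable_funM => //; exact: measurable_class_sum.
rewrite (resample a K.-1 iQ (h := fun s => (expR (t * class_sum K M l n.+1 s j))%:E)); last 2 first.
- by apply/measurable_EFinP.
- by move=> s; rewrite lee_fin expR_ge0.
pose v := 8 * (t * gamma n.+1) ^+ 2 * C0 ^+ 2.
apply: (@le_trans _ _ (\int[Q]_s ((expR v)%:E * (expR (t * class_sum K M l n s j))%:E))%E).
  apply: ge0_le_integral => //.
  - by move=> s _; apply: integral_ge0 => s' _; rewrite lee_fin expR_ge0.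
  - apply: (@measurable_fun_fubini_tonelli_F _ _ _ _ _ Q (fun z : path * path =>
      (expR (t * class_sum K M l n.+1 (splice a K.-1 z.1 z.2) j))%:E)).
      apply/measurable_EFinP.
      exact: (measurableT_comp (mE n.+1) (measurable_splice a K.-1)).
    by move=> z; rewrite lee_fin expR_ge0.
  - by apply: measurable_funeM; exact/measurable_EFinP.
  move=> s _.
  under eq_integral do rewrite Esplice mulrDr expRD EFinM.
  have mexp : measurable_fun setT (fun s' : path => (expR (t * (gamma n.+1 *
      (dir K (fun k => X (s' k) (theta a s) 0 j) -
       mean_dir K (theta a s) j))))%:E).
    apply/measurable_EFinP; apply: measurable_fun_expR.
    apply: measurable_funM => //; apply: measurable_funM => //.
    by apply: measurable_funB => //; exact: measurable_dir.
  rewrite ge0_integralZl//; try by move=> *; rewrite lee_fin expR_ge0.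
  rewrite muleC; apply: lee_wpmul2r; first by rewrite lee_fin expR_ge0.
  under eq_integral do rewrite mulrA.
  apply: expR_moment_le; first exact: measurable_dir.
    by move=> s'; exact: direction_le.
  exact: tb.
have mEn := (measurable_EFinP _ _).2 (mE n).
rewrite ge0_integralZl//; try by move=> *; rewrite lee_fin expR_ge0.
rewrite [X in expR (_ * X)]addrC mulrDr expRD EFinM /v exprMn.
have -> : 8 * (t ^+ 2 * gamma n.+1 ^+ 2) * C0 ^+ 2 = 8 * t ^+ 2 * C0 ^+ 2 * gamma n.+1 ^+ 2.
  by ring.
by apply: lee_wpmul2l; [rewrite lee_fin expR_ge0|exact: IH].
Qed.

(** * The accumulated noise of a window *)

Context (f : 'rV[R]_d -> 'rV[R]_d).
Hypotheses (f_lim : forall y j, mean_dir n y j @[n --> \oo] --> f y 0 j)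
  (gamma_cvg : gamma n @[n --> \oo] --> 0)
  (time_unbounded : forall x : R, exists n, x < time n).

Lemma field_coord_le y j : `|f y 0 j| <= C0.
Proof.
have h : `|mean_dir n y j| @[n --> \oo] --> `|f y 0 j|.
  by apply: cvg_norm; exact: f_lim.
rewrite -(cvg_lim _ h)//; apply: limr_le; first by apply/cvg_ex; eexists; exact: h.
by apply: nearW => n; exact: mean_dir_le.
Qed.

Lemma field_truncate r : exists A, 0 <= A /\
  forall K (y : 'rV[R]_d) j, enorm y <= r ->
  `|f y 0 j - mean_dir K y j| <= A * rate ^+ K.
Proof.
have [A [A0 AP]] := mean_dir_truncate r; exists A; split => // K y j yr.
have h : `|mean_dir n y j - mean_dir K y j| @[n --> \oo] -->
    `|f y 0 j - mean_dir K y j|.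
  by apply: cvg_norm; apply: cvgB; [exact: f_lim|exact: cvg_cst].
rewrite -(cvg_lim _ h)//; apply: limr_le; first by apply/cvg_ex; eexists; exact: h.
by exists K => // n /= Kn; exact: AP.
Qed.

Lemma field_lip r : exists L, 0 <= L /\
  forall (x y : 'rV[R]_d) j, enorm x <= r -> enorm y <= r ->
  `|f x 0 j - f y 0 j| <= L * enorm (x - y).
Proof.
have [L [L0 LP]] := mean_dir_lip r; exists L; split => // x y j xr yr.
have h : `|mean_dir n x j - mean_dir n y j| @[n --> \oo] -->
    `|f x 0 j - f y 0 j|.
  by apply: cvg_norm; apply: cvgB; exact: f_lim.
rewrite -(cvg_lim _ h)//; apply: limr_le; first by apply/cvg_ex; eexists; exact: h.
by apply: nearW => n; exact: LP.
Qed.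

Lemma probability_bigsetU_le d' (T : measurableType d') (P : probability T R)
    (I : Type) (r : seq I) (E : I -> set T) (b : I -> R) :
  (forall i, measurable (E i)) -> (forall i, (P (E i) <= (b i)%:E)%E) ->
  (P (\big[setU/set0]_(i <- r) E i) <= (\sum_(i <- r) b i)%:E)%E.
Proof.
move=> mE Eb; elim: r => [|i r IH]; first by rewrite !big_nil measure0.
rewrite !big_cons EFinD; apply: le_trans (leeD (Eb i) IH).
apply: measureU2 => //; exact: bigsetU_measurable.
Qed.

Lemma time_lt n m : (n < m)%N -> time n < time m.
Proof.
by move=> nm; apply: lt_le_trans (time_homo nm); rewrite timeS ltrDl gamma_gt0.
Qed.

(** The last index before a given training time. *)
Lemma time_cover M (x : R) : time M <= x ->
  exists n, [/\ (M <= n)%N, time n <= x & x < time n.+1].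
Proof.
move=> Mx; have exn : exists n, x < time n by exact: time_unbounded.
have xm := ex_minnP exn; case: xm => -[|m] xm mmin.
  by move: xm; rewrite ltNge (le_trans (time_homo (leq0n M))).
exists m; split => //; last first.
  by rewrite leNgt; apply/negP => /mmin; rewrite ltnn.
rewrite leqNgt; apply/negP => mM; move: xm; rewrite ltNge.
by rewrite (le_trans (time_homo mM)).
Qed.

(** A grid of mesh [h] in training time.  That its size [J] does not depend on
    [M] allows a union bound over the grid. *)
Lemma time_grid (T h : R) : 0 < T -> 0 < h -> exists J, forall M,
  exists g : nat -> nat, forall n, (M <= n)%N -> time n - time M <= T ->
  exists k, [/\ (k < J)%N, (M <= g k)%N, (g k <= n)%N &
    time n - time (g k) <= h + gamma M.+1].
Proof.
move=> T0 h0; exists (Num.truncn (T / h)).+1 => M.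
have /choice[g gP] : forall k : nat, exists n : nat, [/\ (M <= n)%N,
    time n <= time M + k%:R * h & time M + k%:R * h < time n.+1].
  by move=> k; apply: time_cover; rewrite lerDl mulr_ge0// ltW.
exists g => n Mn nT; set y := time n - time M in nT.
have y0 : 0 <= y by rewrite subr_ge0 time_homo.
have yh0 : 0 <= y / h by rewrite divr_ge0// ltW.
pose k := Num.truncn (y / h).
have [k1 k2] : k%:R <= y / h /\ y / h < k.+1%:R.
  by have := truncn_itv yh0 => /andP[].
have [g1 g2 g3] := gP k; exists k; split => //.
- by rewrite ltnS; apply: le_truncn; rewrite ler_pM2r ?invr_gt0.
- rewrite leqNgt; apply/negP => /time_lt; rewrite ltNge => /negP; apply.
  apply: (le_trans g2); move: k1; rewrite ler_pdivlMr// /y; lra.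
- move: k2; rewrite ltr_pdivrMr// -natr1 mulrDl mul1r /y => k2.
  have : gamma (g k).+1 <= gamma M.+1 by exact: gamma_decr.
  move: g3; rewrite timeS; lra.
Qed.

(** All but finitely many step sizes are below [k].  With [k] small, second
    moments along the trajectory grow more slowly into the past than the weights
    decay, although no bound on the trajectory before [M] is assumed. *)
Lemma time_backward (k : R) : 0 < k ->
  exists A, 0 <= A /\ forall b M, (b <= M)%N ->
  time M - time b <= A + k * (M - b)%:R.
Proof.
move=> k0.
have [n0 _ n0P] : \forall n \near \oo, gamma n <= k.
  exact: (cvgr_le 0 gamma_cvg k k0).
exists (time n0); split; first exact: time_ge0.
move=> b M bM; rewrite -sum_gamma//.
apply: (@le_trans _ _ (\sum_(b <= i < M) (k + (if (i < n0)%N then gamma i.+1 else 0)))).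
  apply: ler_sum => i _; case: ltnP => i0; first by rewrite lerDr ltW.
  by rewrite addr0; apply: n0P; rewrite /= ltnW.
rewrite big_split/= [leLHS]addrC; apply: lerD; last first.
  by rewrite sumr_const_nat mulr_natr.
rewrite -big_mkcond/=.
rewrite -[leRHS]subr0 -[X in _ - X](_ : time 0 = 0); last first.
  by rewrite /training_time big_nil.
rewrite -sum_gamma//.
apply: (@le_trans _ _ (\sum_(0 <= i < M | (i < n0)%N) gamma i.+1)).
  rewrite [leRHS](@big_cat_nat _ _ _ b)//= lerDr; apply: sumr_ge0 => i _.
  by rewrite ltW// gamma_gt0.
case: (leqP M n0) => Mn0.
  rewrite [leRHS](@big_cat_nat _ _ _ M)//= big_mkcond/=.
  rewrite -[leLHS]addr0 lerD//.
    apply: ler_sum => i _; case: ifP => // _; rewrite ltW// gamma_gt0//.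
  by apply: sumr_ge0 => i _; rewrite ltW// gamma_gt0.
rewrite (@big_cat_nat _ _ _ n0)//= ?(ltnW Mn0)// [X in _ + X]big_nat_cond.
rewrite [X in _ + X]big1 ?addr0; last first.
  by move=> i /andP[/andP[ni _] ini]; move: ini; rewrite ltnNge ni.
by rewrite big_mkcond/= ler_sum// => i _; case: ifP => // _; rewrite ltW// gamma_gt0.
Qed.

(** ** Deviations of the frozen directions *)

Lemma deviation_le K i (s : path) j : `|deviation K i s j| <= 2 * C0.
Proof.
rewrite /deviation (le_trans (ler_normB _ _))// mulr2n mulrDl mul1r lerD//.
  exact: direction_le.
exact: mean_dir_le.
Qed.

(** Azuma's inequality; [t] below minimises the exponent, and is small enough for
    [class_sum_moment] because [a <= 4 * C0 * T]. *)
Lemma class_sum_tail K M l n j (a T : R) :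
  (0 < K)%N -> (K.-1 <= M)%N -> 0 < a -> 0 < T -> a <= 4 * C0 * T ->
  \sum_(M <= i < n) gamma i.+1 <= T ->
  (Q [set s : path | (a < `|class_sum K M l n s j|)%R] <=
   (2 * expR (- (a ^+ 2 / (32 * C0 ^+ 2 * (gamma M.+1 * T)))))%:E)%E.
Proof.
move=> K0 KM a0 T0 aT sT; have C00 : 0 < C0 by rewrite dir_bound_gt0.
set G := gamma M.+1; have G0 : 0 < G by exact: gamma_gt0.
have s2T : \sum_(M <= i < n) gamma i.+1 ^+ 2 <= G * T.
  apply: le_trans (ler_wpM2l (ltW G0) sT); rewrite mulr_sumr.
  rewrite big_nat_cond [leRHS]big_nat_cond; apply: ler_sum => i /andP[/andP[Mi _] _].
  by rewrite expr2 ler_wpM2r ?gamma_decr// ltW// gamma_gt0.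
pose t := a / (16 * C0 ^+ 2 * (G * T)).
have GT0 : 0 < G * T by rewrite mulr_gt0.
have t0 : 0 < t.
  by apply: divr_gt0 => //; apply: mulr_gt0 => //; rewrite mulr_gt0 ?exprn_gt0.
have tb (e : R) : `|e| = t -> forall i, (M <= i)%N ->
    `|e * gamma i.+1| * (2 * C0) <= 1 / 2.
  move=> et i Mi; rewrite normrM et (gtr0_norm (gamma_gt0 _))//.
  apply: (@le_trans _ _ (t * G * (2 * C0))).
    have C20 : 0 <= 2 * C0 by rewrite mulr_ge0// ltW.
    by rewrite (ler_wpM2r C20)// (ler_wpM2l (ltW t0))// gamma_decr.
  have -> : t * G * (2 * C0) = a / (8 * C0 * T).
    by rewrite /t; field; rewrite !gt_eqF.
  have h8 : 0 < 8 * C0 * T by apply: mulr_gt0 => //; exact: mulr_gt0.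
  rewrite ler_pdivrMr//.
  by have -> : 1 / 2 * (8 * C0 * T) = 4 * C0 * T by field.
have onesided (e : R) : `|e| = t ->
    (Q [set s : path | (expR (t * a) < expR (e * class_sum K M l n s j))%R] <=
     (expR (- (a ^+ 2 / (32 * C0 ^+ 2 * (G * T)))))%:E)%E.
  move=> et.
  have me : measurable_fun setT (fun s : path => expR (e * class_sum K M l n s j)).
    apply: measurable_fun_expR; apply: measurable_funM => //.
    exact: measurable_class_sum.
  apply: (le_trans (prob_gt_le me _ _ (class_sum_moment l n j K0 KM (tb e et)))).
  - by move=> s; exact: expR_ge0.
  - exact: expR_gt0.
  rewrite lee_fin -expRN -expRD ler_expR.
  have -> : e ^+ 2 = t ^+ 2 by rewrite -(@real_normK _ e) ?num_real// et.
  apply: (@le_trans _ _ (8 * t ^+ 2 * C0 ^+ 2 * (G * T) - t * a)).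
    rewrite lerD2r; apply: ler_wpM2l => //.
    by apply: mulr_ge0; [apply: mulr_ge0 => //; exact: sqr_ge0|exact: sqr_ge0].
  rewrite le_eqVlt; apply/orP; left; apply/eqP.
  by rewrite /t; field; rewrite !gt_eqF.
have mc : measurable_fun setT (fun s : path => class_sum K M l n s j).
  exact: measurable_class_sum.
have mset (e : R) :
    measurable [set s : path | (expR (t * a) < expR (e * class_sum K M l n s j))%R].
  rewrite -[X in measurable X]setTI; apply: measurable_fun_ltr => //.
  by apply: measurable_fun_expR; exact: measurable_funM.
apply: (@le_trans _ _ (Q ([set s : path | (expR (t * a) < expR (t * class_sum K M l n s j))%R] `|`
    [set s : path | (expR (t * a) < expR (- t * class_sum K M l n s j))%R]))).
  apply: le_measure; rewrite ?inE.
  - rewrite -[X in measurable X]setTI; apply: measurable_fun_ltr => //.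
    exact: measurableT_comp.
  - exact: measurableU.
  move=> s /=; rewrite !ltr_expR mulNr -mulrN !ltr_pM2l//.
  rewrite ltr_normr => /orP[]; by [left|right].
apply: (le_trans (measureU2 _ (mset _) (mset _))).
have -> : 2 = 1 + 1 :> R by [].
rewrite mulrDl mul1r EFinD; apply: leeD; apply: onesided.
  by rewrite gtr0_norm.
by rewrite normrN gtr0_norm.
Qed.

Lemma deviation_sum_classes K M n (s : path) j : (0 < K)%N ->
  \sum_(M <= i < n) gamma i.+1 * deviation K i s j =
  \sum_(l < K) class_sum K M l n s j.
Proof.
move=> K0; rewrite /class_sum (exchange_big_dep xpredT)//=.
apply: eq_bigr => i _; rewrite (bigD1 (Ordinal (ltn_pmod i K0)))//=.
rewrite big1 ?addr0// => l /andP[/eqP il]; rewrite -val_eqE/= il eqxx//.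
Qed.

(** A union bound over the residue classes, each allowed [a / K]. *)
Lemma deviation_sum_tail K M n j (a T : R) :
  (0 < K)%N -> (K.-1 <= M)%N -> 0 < a -> 0 < T -> a <= 4 * C0 * T ->
  \sum_(M <= i < n) gamma i.+1 <= T ->
  exists E : set path, [/\ measurable E,
   (Q E <= (2 * K%:R * expR (- (a ^+ 2 / (32 * C0 ^+ 2 * T)
      / (K%:R ^+ 2 * gamma M.+1))))%:E)%E &
   forall s, ~ E s ->
     `|\sum_(M <= i < n) gamma i.+1 * deviation K i s j| <= a].
Proof.
move=> K0 KM a0 T0 aT sT.
have C00 : 0 < C0 by rewrite dir_bound_gt0.
have KR : 0 < K%:R :> R by rewrite ltr0n.
have aK0 : 0 < a / K%:R by rewrite divr_gt0.
have aK : a / K%:R <= 4 * C0 * T.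
  by apply: le_trans aT; rewrite ler_pdivrMr// ler_peMr ?(ltW a0)// ler1n.
exists (\big[setU/set0]_(l < K) [set s : path | (a / K%:R < `|class_sum K M l n s j|)%R]).
have mE (l : 'I_K) : measurable [set s : path | (a / K%:R < `|class_sum K M l n s j|)%R].
  rewrite -[X in measurable X]setTI; apply: measurable_fun_ltr => //.
  by apply: measurableT_comp => //; exact: measurable_class_sum.
split.
- by apply: bigsetU_measurable => l _; exact: mE.
- have H := probability_bigsetU_le (index_enum 'I_K) mE
    (fun l : 'I_K => @class_sum_tail K M l n j _ T K0 KM aK0 T0 aK sT).
  apply: (le_trans H).
  have -> : (a / K%:R) ^+ 2 / (32 * C0 ^+ 2 * (gamma M.+1 * T)) =
      a ^+ 2 / (32 * C0 ^+ 2 * T) / (K%:R ^+ 2 * gamma M.+1).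
    by field; rewrite !gt_eqF// gamma_gt0.
  by rewrite lee_fin sumr_const card_ord -[leLHS]mulr_natr mulrAC lexx.
- move=> s sE; rewrite deviation_sum_classes//.
  apply: (le_trans (ler_norm_sum _ _ _)).
  apply: (@le_trans _ _ (\sum_(l < K) a / K%:R)).
    apply: ler_sum => l _; rewrite leNgt; apply/negP => h; apply: sE.
    by rewrite -bigcup_seq; exists l => //=; rewrite mem_index_enum.
  by rewrite sumr_const card_ord -[leLHS]mulr_natr divfK// gt_eqF.
Qed.

(** ** Freezing the parameter *)

Lemma sum_gamma_shift K M N : (0 < K)%N ->
  \sum_((M + K)%N <= i < N) gamma (i.+1 - K).+1 <= \sum_(M <= i < N) gamma i.+1.
Proof.
move=> K0; rewrite big_addn.
apply: (@le_trans _ _ (\sum_(M <= i < N - K) gamma i.+1)).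
  by apply: ler_sum => i _; apply: gamma_decr; lia.
case: (leqP M (N - K)) => MN; last first.
  rewrite big_geq ?(ltnW MN)//; apply: sumr_ge0 => i _.
  by rewrite ltW// gamma_gt0.
rewrite [leRHS](@big_cat_nat _ _ _ (N - K))//= ?leq_subr// lerDl.
by apply: sumr_ge0 => i _; rewrite ltW// gamma_gt0.
Qed.

Lemma time_le_steps a b : (a <= b)%N ->
  time b - time a <= (b - a)%:R * gamma a.+1.
Proof.
move=> ab; rewrite -sum_gamma//.
apply: (@le_trans _ _ (\sum_(a <= i < b) gamma a.+1)); last first.
  by rewrite sumr_const_nat mulr_natl.
rewrite big_nat_cond [leRHS]big_nat_cond; apply: ler_sum => i /andP[/andP[ai _] _].
exact: gamma_decr.
Qed.

(** A union bound over the pairs [(i, k)]: each has probability of order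
    [(K * gamma) `^ p], there are [K] values of [k], and one factor [gamma] is
    kept in the sum over [i], which is at most [T]. *)
Lemma freeze_event r : exists B, 0 <= B /\
  forall K M N j (e T : R), (0 < K)%N -> 0 < e -> 0 <= T ->
  time N - time M <= T ->
  exists E : set path, [/\ measurable E,
   (Q E <= (B / e `^ p * T *
      (K%:R `^ (p + 1) * gamma M.+1 `^ (p - 1)))%:E)%E &
   forall s, ~ E s -> forall i k, (M + K <= i)%N -> (i < N)%N -> (k < K)%N ->
     enorm (theta (i.+1 - K) s) <= r -> enorm (theta (i - k) s) <= r ->
     `|grad (i - k) s j - X (s (i - k)%N) (theta (i.+1 - K) s) 0 j| <= e].
Proof.
have [B [B0 BP]] := grad_freeze r.
exists (B * speed `^ p); split; first by rewrite mulr_ge0// powR_ge0.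
move=> K M N j e T K0 e0 T0 MNT; set G := gamma M.+1.
have G0 : 0 < G by exact: gamma_gt0.
have KR : 0 < K%:R :> R by rewrite ltr0n.
have p1 : 0 <= p - 1 by rewrite subr_ge0 (le_trans _ p2)// ler1n.
pose F i k := [set s : path | [/\ enorm (theta (i.+1 - K) s) <= r,
  enorm (theta (i - k) s) <= r &
  e < `|grad (i - k) s j - X (s (i - k)%N) (theta (i.+1 - K) s) 0 j| ]]%R.
have mF i k : measurable (F i k).
  rewrite (_ : F i k = [set s : path | enorm (theta (i.+1 - K) s) <= r] `&`
      ([set s : path | enorm (theta (i - k) s) <= r] `&`
       [set s : path | e < `|grad (i - k) s j - X (s (i - k)%N) (theta (i.+1 - K) s) 0 j|])); last first.
    by apply/seteqP; split=> s /=; [case|move=> [? []]].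
  apply: measurableI; first exact: measurable_theta_ball.
  apply: measurableI; first exact: measurable_theta_ball.
  rewrite -[X in measurable X]setTI; apply: measurable_fun_ltr => //.
  apply: measurableT_comp => //; apply: measurable_funB; first exact: measurable_grad.
  by apply: measurable_innovation; [exact: measurable_coord|exact: measurable_theta].
pose w := B * speed `^ p / e `^ p.
have w0 : 0 <= w by rewrite divr_ge0 ?powR_ge0// mulr_ge0// powR_ge0.
have QF i k : (M + K <= i)%N -> (k < K)%N ->
    (Q (F i k) <= (w * (K%:R `^ p * (G `^ (p - 1) * gamma (i.+1 - K).+1)))%:E)%E.
  move=> Mi kK; have aik := subSB_le i kK.
  apply: (le_trans (BP _ _ j e aik e0)); rewrite lee_fin.
  have g0 : 0 < gamma (i.+1 - K).+1 by exact: gamma_gt0.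
  have -> : w * (K%:R `^ p * (G `^ (p - 1) * gamma (i.+1 - K).+1)) =
      B * (speed `^ p * (K%:R `^ p * (G `^ (p - 1) * gamma (i.+1 - K).+1))) / e `^ p.
    by rewrite /w; ring.
  rewrite ler_wpM2r ?invr_ge0 ?powR_ge0// ler_wpM2l//.
  rewrite powRM ?speed_ge0 ?subr_ge0 ?time_homo// ler_wpM2l ?powR_ge0//.
  apply: (@le_trans _ _ ((K%:R * gamma (i.+1 - K).+1) `^ p)).
    rewrite ge0_ler_powR ?(le_trans _ p2)// ?nnegrE ?subr_ge0 ?time_homo//.
      by rewrite mulr_ge0 ?(ltW g0).
    apply: (le_trans (time_le_steps aik)); by rewrite ler_wpM2r ?(ltW g0)// ler_nat subBSB_le.
  rewrite powRM ?(ltW g0)// ler_wpM2l ?powR_ge0//.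
  have -> : gamma (i.+1 - K).+1 `^ p = gamma (i.+1 - K).+1 `^ (p - 1) * gamma (i.+1 - K).+1.
    rewrite -{3}[gamma _]powRr1 ?(ltW g0)// -powRD ?subrK//.
    by rewrite (gt_eqF g0) implybT.
  rewrite ler_wpM2r ?(ltW g0)// ge0_ler_powR// ?nnegrE ?(ltW g0) ?(ltW G0)//.
  by apply: gamma_decr => //; rewrite ltnS leq_subSB.
pose F' i k := if (M + K <= i)%N then F i k else set0.
exists (\big[setU/set0]_(M + K <= i < N) \big[setU/set0]_(k < K) F' i k).
have mF' i k : measurable (F' i k) by rewrite /F'; case: ifP.
have mF'' i : measurable (\big[setU/set0]_(k < K) F' i k).
  by apply: bigsetU_measurable => k _; exact: mF'.
have QF' i : (Q (\big[setU/set0]_(k < K) F' i k) <=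
    (\sum_(k < K) w * (K%:R `^ p * (G `^ (p - 1) * gamma (i.+1 - K).+1)))%:E)%E.
  apply: (@probability_bigsetU_le _ path Q 'I_K) => // k; rewrite /F'; case: ifP => [Mi|_].
    exact: QF.
  have g0 : 0 <= gamma (i.+1 - K).+1 by rewrite ltW// gamma_gt0.
  rewrite measure0 lee_fin; apply: mulr_ge0 => //; apply: mulr_ge0; first exact: powR_ge0.
  by apply: mulr_ge0 => //; exact: powR_ge0.
split.
- by apply: bigsetU_measurable => i _; exact: mF''.
- have H := probability_bigsetU_le (index_iota (M + K) N) mF'' QF'.
  apply: (le_trans H); rewrite lee_fin.
  under eq_bigr do rewrite sumr_const card_ord -[_ *+ K]mulr_natl.
  have -> : B * speed `^ p / e `^ p * T * (K%:R `^ (p + 1) * G `^ (p - 1)) =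
      (w * K%:R `^ (p + 1) * G `^ (p - 1)) * T by rewrite /w; ring.
  apply: (@le_trans _ _ ((w * K%:R `^ (p + 1) * G `^ (p - 1)) *
      \sum_((M + K)%N <= i < N) gamma (i.+1 - K).+1)); last first.
    rewrite ler_wpM2l//; first by rewrite mulr_ge0 ?powR_ge0// mulr_ge0// powR_ge0.
    apply: (le_trans (sum_gamma_shift _ _ K0)).
    case: (leqP M N) => MN; first by rewrite sum_gamma.
    by rewrite big_geq ?(ltnW MN).
  rewrite mulr_sumr le_eqVlt; apply/orP; left; apply/eqP.
  have -> : K%:R `^ (p + 1) = K%:R `^ p * K%:R :> R.
    by rewrite powRD ?powRr1// (gt_eqF KR) implybT.
  apply: eq_bigr => i _; rewrite mulrA; set x := _ `^ p; set y := _ `^ (p - 1).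
  set z := gamma _; clearbody x y z; ring.
- move=> s sE i k Mi iN kK sr1 sr2; rewrite leNgt; apply/negP => h; apply: sE.
  rewrite -bigcup_seq; exists i; first by rewrite /= mem_index_iota Mi.
  rewrite -bigcup_seq; exists (Ordinal kK); first by rewrite /= mem_index_enum.
  by rewrite /F' /= Mi.
Qed.

(** ** Truncating the past *)

(** The constant [k] is chosen so that the exponential growth of the moments at
    distance [speed * k * n] is at most the rate [rate ^- 2] per step. *)
Lemma moment_bound_growth : exists k, 0 < k /\
  forall r, exists D, 0 <= D /\
  forall n : nat, moment_bound (r + speed * (k * n%:R)) <= D / rate ^+ 2 ^+ n.
Proof.
have c0 := growth_ge0; have sp := speed_ge0.
case/andP: rate2_bd => q0 q1; case/andP: rate_bd => r0 r1.
have q0' : 0 < rate ^+ 2 by rewrite exprn_gt0.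
have cs : 0 < c 0 * speed + 1 by rewrite ltr_wpDl ?mulr_ge0.
exists ((1 - rate ^+ 2) / (c 0 * speed + 1)); split.
  by rewrite divr_gt0 ?subr_gt0.
set k := _ / _; move=> r.
exists (1 + c 0 + c 0 * expR (c 0 * r)); split.
  by rewrite !addr_ge0 ?mulr_ge0 ?expR_ge0.
move=> n; pose y := c 0 * speed * k.
have y1 : y <= 1 - rate ^+ 2.
  rewrite /y /k mulrA ler_pdivrMr// mulrC ler_wpM2l ?subr_ge0 ?(ltW q1)//.
  by rewrite lerDl.
have ey : expR y <= (rate ^+ 2)^-1.
  rewrite -[y]opprK expRN lef_pV2 ?posrE ?expR_gt0//.
  apply: le_trans (expR_ge1Dx _); lra.
have qn : 0 < rate ^+ 2 ^+ n by rewrite exprn_gt0.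
have qn1 : 1 <= (rate ^+ 2 ^+ n)^-1.
  by rewrite invf_ge1// exprn_ile1 ?(ltW q1).
rewrite /moment_bound.
have -> : expR (c 0 * (r + speed * (k * n%:R))) = expR (c 0 * r) * expR y ^+ n.
  rewrite -expRM_natl -expRD; congr expR; rewrite /y; ring.
have eyn : expR y ^+ n <= (rate ^+ 2 ^+ n)^-1.
  by rewrite -exprVn lerXn2r ?nnegrE ?expR_ge0 ?invr_ge0.
rewrite mulrDl mulrDl mul1r mulrDr mulr1 addrA; apply: lerD; first apply: lerD => //.
  by rewrite ler_peMr.
by rewrite -mulrA ler_wpM2l// ler_wpM2l ?expR_ge0.
Qed.

(** Markov's inequality, after integrating the tail on the event that the
    parameter is bounded at time [M]: there the parameter at an earlier time is
    controlled by [time_backward]. *)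
Lemma tail_event r T : 0 <= T -> exists D, 0 <= D /\
  forall K M N j (e : R), 0 < e -> time N - time M <= T ->
  exists E : set path, [/\ measurable E,
   (Q E <= (D / e * rate ^+ K)%:E)%E &
   forall s, ~ E s -> enorm (theta M s) <= r ->
     \sum_((M + K)%N <= i < N) gamma i.+1 * avg2_tail beta K i.+1 (past i s j)
     <= e].
Proof.
move=> T0; have [k [k0 kP]] := moment_bound_growth.
have [A [A0 AP]] := time_backward k0.
have [D [D0 DP]] := kP (r + speed * (T + A)).
case/andP: rate2_bd => q0 q1; case/andP: rate_bd => r0 r1.
exists (T * (2 * D)); split; first by rewrite mulr_ge0// mulr_ge0.
move=> K M N j e e0 MNT.
pose S := [set s : path | enorm (theta M s) <= r].
have mS : measurable S by exact: measurable_theta_ball.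
pose x i kk (s : path) := past i s j kk * \1_S s.
have mx i kk : measurable_fun setT (x i kk).
  apply: measurable_funM; first exact: measurable_grad.
  exact: measurable_indic.
pose h s := \sum_((M + K)%N <= i < N) gamma i.+1 * avg2_tail beta K i.+1 (x i ^~ s).
have mt i : measurable_fun setT (fun s : path => avg2_tail beta K i.+1 (x i ^~ s)).
  exact: measurable_avg2_tail.
have t0 i (s : path) : 0 <= avg2_tail beta K i.+1 (x i ^~ s).
  rewrite mulr_ge0 ?(ltW (onem_beta_gt0 beta_bd))// sumr_ge0// => kk _.
  by rewrite mulr_ge0 ?sqr_ge0 ?exprn_ge0 ?(ltW (beta_gt0 beta_bd)).
have mh : measurable_fun setT h.
  by apply: measurable_sum => i; exact: measurable_funM.
have g0 i : 0 <= gamma i.+1 by rewrite ltW// gamma_gt0.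
have h0 s : 0 <= h s by apply: sumr_ge0 => i _; rewrite mulr_ge0.
have ht : (\int[Q]_s (h s)%:E <= (T * (2 * D) * rate ^+ K)%:E)%E.
  apply: (le_trans (integral_sum_le (G := fun=> 2 * D * rate ^+ 2 ^+ K) g0 mt t0 _)).
    move=> i; rewrite mem_index_iota => /andP[Mi iN] _.
    apply: (integral_avg2_tail rate2_bd rate_pow4 D0) => // kk Kkk kki.
    have bi : (i - kk <= i)%N by exact: leq_subr.
    pose rho := r + speed * (T + A) + speed * (k * kk%:R).
    apply: (@le_trans _ _ (\int[Q]_s (grad (i - kk) s j ^+ 2 *
        \1_[set s : path | (enorm (theta (i - kk) s) <= rho)%R] s)%:E)%E).
      apply: ge0_le_integral => //.
      - by move=> s _; rewrite lee_fin sqr_ge0.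
      - by apply/measurable_EFinP; apply: measurable_funX.
      - apply/measurable_EFinP; apply: measurable_funM.
          by apply: measurable_funX; exact: measurable_grad.
        by apply: measurable_indic; exact: measurable_theta_ball.
      move=> s _; rewrite lee_fin /x /past; have [sS|sS] := pselect (S s); last first.
        rewrite [\1_S s]indicE memNset// mulr0 expr0n/=.
        by rewrite mulr_ge0 ?sqr_ge0.
      rewrite [\1_S s]indicE mem_set// mulr1 indicE mem_set ?mulr1//=.
      have ATk : 0 <= A + k * kk%:R by rewrite addr_ge0// mulr_ge0// ltW.
      apply: (@le_trans _ _ (enorm (theta M s) + speed * (T + (A + k * kk%:R)))); last first.
        by rewrite /rho -addrA -mulrDr addrA; apply: lerD.
      apply: (le_trans (enorm_le_dist _ (theta M s))); rewrite lerD2l.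
      case: (leqP M (i - kk)) => Mb.
        apply: (le_trans (theta_dist s Mb)); rewrite ler_wpM2l ?speed_ge0//.
        apply: (@le_trans _ _ T); last by rewrite lerDl.
        apply: le_trans MNT; rewrite lerD2r.
        by apply: time_homo; exact: leq_trans bi (ltnW iN).
      rewrite enormB; apply: (le_trans (theta_dist s (ltnW Mb))).
      rewrite ler_wpM2l ?speed_ge0//.
      apply: (le_trans (AP _ _ (ltnW Mb))); apply: (@le_trans _ _ (A + k * kk%:R)).
        rewrite lerD2l ler_wpM2l ?(ltW k0)// ler_nat subB_le//.
        exact: leq_trans (leq_addr _ _) Mi.
      by rewrite lerDr.
    by apply: (le_trans (grad_sqr_le _ _ _)); rewrite lee_fin; exact: DP.
  rewrite lee_fin -mulr_suml -[leRHS]mulrA.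
  apply: (@le_trans _ _ (T * (2 * D * rate ^+ 2 ^+ K))).
    rewrite ler_wpM2r//; first by rewrite !mulr_ge0// exprn_ge0.
    case: (leqP (M + K) N) => MN; last by rewrite big_geq ?(ltnW MN).
    rewrite sum_gamma//; apply: le_trans MNT.
    by rewrite lerD2l lerN2 time_homo// leq_addr.
  rewrite ler_wpM2l// ler_wpM2l ?mulr_ge0// -exprM mulnC exprM.
  by rewrite expr2 ler_piMl ?exprn_ge0 ?(ltW r0)// exprn_ile1 ?(ltW r0) ?(ltW r1).
exists [set s : path | e < h s]; split.
- by rewrite -[X in measurable X]setTI; exact: measurable_fun_ltr.
- have -> : T * (2 * D) / e * rate ^+ K = T * (2 * D) * rate ^+ K / e by ring.
  exact: prob_gt_le.
- move=> s /negP; rewrite -leNgt => hs sM; apply: le_trans hs.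
  rewrite /h le_eqVlt; apply/orP; left; apply/eqP.
  apply: eq_bigr => i _; congr (_ * avg2_tail _ _ _ _); apply/funext => kk.
  by rewrite /x indicE mem_set ?mulr1.
Qed.

(** ** Collecting the errors *)

Definition noise M n (s : path) j : R :=
  \sum_(M <= i < n) gamma i.+1 * (step i s j - f (theta i s) 0 j).

(** A trivial bound, used on the first [K] steps of a window. *)
Lemma noise_le M n s j : (M <= n)%N ->
  `|noise M n s j| <= 2 * C0 * (time n - time M).
Proof.
move=> Mn; rewrite -sum_gamma// mulr_sumr.
apply: (le_trans (ler_norm_sum _ _ _)); apply: ler_sum => i _.
rewrite normrM (gtr0_norm (gamma_gt0 _))// mulrC.
rewrite ler_wpM2r ?(ltW (gamma_gt0 _))//.
rewrite (le_trans (ler_normB _ _))// mulr2n mulrDl mul1r lerD//.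
  exact: step_le.
exact: field_coord_le.
Qed.

Lemma noise_split M m n s j : (M <= m)%N -> (m <= n)%N ->
  noise M n s j = noise M m s j + noise m n s j.
Proof. by move=> Mm mn; rewrite /noise (big_cat_nat Mm mn). Qed.

Section Decomposition.
Variables (r T A L e u : R) (K M : nat) (s : path) (j : 'I_d).
Hypotheses (T0 : 0 <= T) (A0 : 0 <= A) (L0 : 0 <= L) (u0 : 0 < u) (K0 : (0 < K)%N)
  (AP : forall K (y : 'rV[R]_d) j, enorm y <= r ->
     `|f y 0 j - mean_dir K y j| <= A * rate ^+ K)
  (LP : forall (x y : 'rV[R]_d) j, enorm x <= r -> enorm y <= r ->
     `|f x 0 j - f y 0 j| <= L * enorm (x - y)).

Let lip := dir_lip eps alpha beta.

(** The deterministic part of the error: bias correction, truncation of the mean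
    direction, and the motion of the parameter during one block. *)
Definition det_error : R := C0 * (beta ^+ M / (1 - beta)) + A * rate ^+ K +
  L * (speed * (K%:R * gamma M.+1)).

(** Along the chain: direction with bias correction, direction, frozen direction,
    mean direction at the frozen parameter, field there, field. *)
Lemma step_error i : (M + K <= i)%N ->
  (forall m, (M <= m)%N -> (m <= i)%N -> enorm (theta m s) <= r) ->
  (forall k, (k < K)%N -> `|grad (i - k) s j -
      X (s (i - k)%N) (theta (i.+1 - K) s) 0 j| <= e) ->
  `|step i s j - f (theta i s) 0 j - deviation K i s j| <=
  det_error + (u + lip / u * e ^+ 2) +
  lip / u * avg2_tail beta K i.+1 (past i s j).
Proof.
move=> Mi ball fr.
have Ma := leq_subSB Mi; have ai := subSS_leq i K0.
have := @direction_bias R eps alpha beta eps_gt0 alpha_bd beta_bd i.+1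
  (past i s j) isT.
rewrite -/(step i s j) => E1.
have E2 := @direction_window R eps alpha beta eps_gt0 alpha_bd beta_bd K i.+1
  (past i s j) (fun k => X (s (i - k)%N) (theta (i.+1 - K) s) 0 j) e u
  (leqW (leq_trans (leq_addl _ _) Mi)) u0 fr.
rewrite -/(frozen K i s j) in E2.
have E3 := AP K j (ball _ Ma ai).
have Mi' : (M <= i)%N := leq_trans (leq_addr _ _) Mi.
have E4 := LP j (ball _ Ma ai) (ball _ Mi' (leqnn i)).
have b0 := beta_gt0 beta_bd; have b1 := onem_beta_gt0 beta_bd.
have C00 : 0 < C0 by rewrite dir_bound_gt0.
have E1' : C0 * (beta ^+ i.+1 / (1 - beta)) <= C0 * (beta ^+ M / (1 - beta)).
  rewrite ler_wpM2l ?(ltW C00)// ler_wpM2r ?invr_ge0 ?(ltW b1)//.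
  by rewrite ler_wiXn2l ?(ltW b0) ?(ltW (beta_lt1 beta_bd))// leqW.
have E4' : enorm (theta (i.+1 - K) s - theta i s) <= speed * (K%:R * gamma M.+1).
  rewrite enormB; apply: (le_trans (theta_dist s ai)).
  rewrite ler_wpM2l ?speed_ge0//; apply: (le_trans (time_le_steps ai)).
  apply: ler_pM => //; first by rewrite ltW// gamma_gt0.
    by rewrite ler_nat; have := subBSB_le i 0 K; rewrite subn0.
  exact: gamma_decr.
have E4'' := le_trans E4 (ler_wpM2l L0 E4').
rewrite /deviation /det_error.
move: E1 E2 E3 E4''; rewrite -/dir -/C0 -/lip mulrDr.
set d1 := direction _ _ _ _ _; set z := frozen _ _ _ _; set md := mean_dir _ _ _.
set fa := f (theta (i.+1 - K) s) 0 j; set fi := f (theta i s) 0 j.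
set tl := avg2_tail _ _ _ _; set x := step _ _ _.
move=> E1 E2 E3 E4''.
have -> : x - fi - (z - md) = (x - d1) + (d1 - z) + (md - fa) + (fa - fi) by ring.
apply: (le_trans (ler_normD _ _)).
apply: (le_trans (lerD (ler_normD _ _) (lexx _))).
apply: (le_trans (lerD (lerD (ler_normD _ _) (lexx _)) (lexx _))).
rewrite distrC in E3; rewrite -/d1 in E1.
apply: (le_trans (lerD (lerD (lerD (le_trans E1 E1') E2) E3) E4'')).
rewrite le_eqVlt; apply/orP; left; apply/eqP; ring.
Qed.

Lemma noise_decomposition n : (M <= n)%N -> time n - time M <= T ->
  (forall m, (M <= m)%N -> (m <= n)%N -> enorm (theta m s) <= r) ->
  (forall i k, (M + K <= i)%N -> (i < n)%N -> (k < K)%N -> `|grad (i - k) s j -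
      X (s (i - k)%N) (theta (i.+1 - K) s) 0 j| <= e) ->
  `|noise M n s j| <= 2 * C0 * (K%:R * gamma M.+1) +
    T * (det_error + (u + lip / u * e ^+ 2)) +
    lip / u * \sum_((M + K)%N <= i < n)
      gamma i.+1 * avg2_tail beta K i.+1 (past i s j) +
    `|\sum_((M + K)%N <= i < n) gamma i.+1 * deviation K i s j|.
Proof.
move=> Mn nT ball fr.
have C00 : 0 < C0 by rewrite dir_bound_gt0.
have b0 := beta_gt0 beta_bd; have b1 := onem_beta_gt0 beta_bd.
have l0 : 0 <= lip by exact: dir_lip_ge0.
have lu0 : 0 <= lip / u by rewrite divr_ge0// ltW.
have C20 : 0 <= 2 * C0 by apply: mulr_ge0 => //; exact: ltW.
have g0 i : 0 <= gamma i.+1 by rewrite ltW// gamma_gt0.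
have r0 : 0 <= rate by case/andP: rate_bd => /ltW.
have b'0 : 0 <= det_error + (u + lip / u * e ^+ 2).
  rewrite addr_ge0//; last by rewrite addr_ge0 ?(ltW u0)// mulr_ge0 ?sqr_ge0.
  rewrite /det_error; apply: addr_ge0; first apply: addr_ge0.
  - by rewrite mulr_ge0 ?(ltW C00)// divr_ge0 ?(ltW b1)// exprn_ge0 ?(ltW b0).
  - by rewrite mulr_ge0 ?exprn_ge0.
  - by rewrite mulr_ge0// mulr_ge0 ?speed_ge0// mulr_ge0.
have tail0 i : 0 <= gamma i.+1 * avg2_tail beta K i.+1 (past i s j).
  rewrite mulr_ge0// mulr_ge0 ?(ltW b1)// sumr_ge0// => kk _.
  by rewrite mulr_ge0 ?sqr_ge0 ?exprn_ge0 ?(ltW b0).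
have start_le m : (M <= m)%N -> (m <= M + K)%N ->
    `|noise M m s j| <= 2 * C0 * (K%:R * gamma M.+1).
  move=> Mm mK; apply: (le_trans (noise_le _ _ Mm)).
  rewrite (ler_wpM2l C20)//; apply: (le_trans (time_le_steps Mm)).
  by rewrite ler_wpM2r// ler_nat leq_subLR.
case: (leqP (M + K) n) => MKn; last first.
  apply: (le_trans (start_le _ Mn (ltnW MKn))).
  have T1 : 0 <= T * (det_error + (u + lip / u * e ^+ 2)) by rewrite mulr_ge0.
  have T2 : 0 <= lip / u * \sum_((M + K)%N <= i < n)
      gamma i.+1 * avg2_tail beta K i.+1 (past i s j).
    by rewrite mulr_ge0// sumr_ge0.
  by rewrite -[leLHS]addr0 lerD// -[leLHS]addr0 lerD// lerDl.
rewrite (noise_split _ _ (leq_addr K M) MKn) -addrA -addrA.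
apply: (le_trans (ler_normD _ _)); apply: lerD; first by apply: start_le => //; exact: leq_addr.
have -> : noise (M + K) n s j =
    \sum_((M + K)%N <= i < n) gamma i.+1 *
      (step i s j - f (theta i s) 0 j - deviation K i s j) +
    \sum_((M + K)%N <= i < n) gamma i.+1 * deviation K i s j.
  by rewrite -big_split; apply: eq_bigr => i _ /=; rewrite -mulrDr subrK.
apply: (le_trans (ler_normD _ _)); rewrite addrA lerD2r.
apply: (le_trans (ler_norm_sum _ _ _)).
apply: (@le_trans _ _ (\sum_((M + K)%N <= i < n)
   (gamma i.+1 * (det_error + (u + lip / u * e ^+ 2)) +
    lip / u * (gamma i.+1 * avg2_tail beta K i.+1 (past i s j))))).
  rewrite big_nat_cond [leRHS]big_nat_cond; apply: ler_sum => i /andP[/andP[Mi ni] _].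
  rewrite normrM (ger0_norm (g0 i)) [lip / u * (_ * _)]mulrCA -mulrDr.
  rewrite ler_wpM2l//; apply: step_error => //.
    by move=> m Mm mi; apply: ball => //; rewrite (leq_trans mi)// ltnW.
  by move=> k kK; exact: fr.
rewrite big_split/= -mulr_suml -mulr_sumr lerD2r ler_wpM2r//.
rewrite sum_gamma//; apply: le_trans nT.
by rewrite lerD2l lerN2 time_homo// leq_addr.
Qed.

End Decomposition.

(** On the grid [deviation_sum_tail] applies; between grid points the sum moves by
    at most [2 * C0] times the elapsed time.  The three shares of [a] are the grid
    point, the mesh and one step. *)
Lemma deviation_event (T a : R) : 0 < T -> 0 < a -> exists J, exists b, 0 < b /\
  forall K M N j, (0 < K)%N -> time N - time M <= T ->
  2 * C0 * (K%:R * gamma M.+1) <= a ->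
  exists E : set path, [/\ measurable E,
   (Q E <= (J%:R * (2 * K%:R * expR (- (b / (K%:R ^+ 2 * gamma M.+1)))))%:E)%E &
   forall s, ~ E s -> forall n, (M + K <= n)%N -> (n <= N)%N ->
     `|\sum_((M + K)%N <= i < n) gamma i.+1 * deviation K i s j| <= 3 * a].
Proof.
move=> T0 a0; have C00 : 0 < C0 by rewrite dir_bound_gt0.
have C20 : 0 < 2 * C0 by apply: mulr_gt0.
have h0 : 0 < a / (2 * C0) by rewrite divr_gt0.
have [J JP] := time_grid T0 h0.
pose T' := T + a / C0.
have T'0 : 0 < T' by rewrite addr_gt0// divr_gt0.
have aT' : a <= 4 * C0 * T'.
  have -> : 4 * C0 * T' = 4 * C0 * T + 4 * a by rewrite /T'; field; rewrite gt_eqF.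
  have : 0 < 4 * C0 * T by apply: mulr_gt0 => //; exact: mulr_gt0.
  lra.
pose b := a ^+ 2 / (32 * C0 ^+ 2 * T').
have b0 : 0 < b.
  apply: divr_gt0; first exact: exprn_gt0.
  by apply: mulr_gt0 => //; apply: mulr_gt0 => //; exact: exprn_gt0.
exists J, b; split => // K M N j K0 MNT KG.
have KR : 0 < K%:R :> R by rewrite ltr0n.
have G0 : 0 < gamma M.+1 by exact: gamma_gt0.
have [g gP] := JP (M + K)%N.
have MMK : (M <= M + K)%N by exact: leq_addr.
have KM : (K.-1 <= M + K)%N by rewrite (leq_trans (leq_pred K))// leq_addl.
have sT n : (n <= N)%N -> \sum_((M + K)%N <= i < n) gamma i.+1 <= T'.
  move=> nN; case: (leqP (M + K) n) => Mn; last first.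
    by rewrite big_geq ?(ltnW Mn)// (ltW T'0).
  rewrite sum_gamma// (@le_trans _ _ T)//; last by rewrite lerDl divr_ge0 ?ltW.
  apply: le_trans MNT; rewrite lerD ?time_homo// lerN2 time_homo//.
have /choice[F FP] : forall k : nat, exists E : set path, [/\ measurable E,
   (Q E <= (2 * K%:R * expR (- (b / (K%:R ^+ 2 * gamma (M + K).+1))))%:E)%E &
   forall s, ~ E s ->
   `|\sum_((M + K)%N <= i < minn (g k) N) gamma i.+1 * deviation K i s j| <= a].
  move=> k; apply: deviation_sum_tail => //.
  by apply: sT; exact: geq_minr.
have mF k : measurable (F k) by case: (FP k).
exists (\big[setU/set0]_(k < J) F k); split.
- by apply: bigsetU_measurable.
- have QF k := let: And3 _ h _ := FP k in h.
  have H := probability_bigsetU_le (index_enum 'I_J) (fun k : 'I_J => mF k)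
    (fun k : 'I_J => QF k).
  apply: (le_trans H); rewrite lee_fin sumr_const card_ord -[leLHS]mulr_natl.
  apply: ler_wpM2l => //; apply: ler_wpM2l; first by apply: mulr_ge0.
  rewrite ler_expR lerN2; apply: ler_wpM2l; first exact: ltW.
  rewrite lef_pV2 ?posrE; last 2 first.
  + by apply: mulr_gt0; [exact: exprn_gt0|exact: gamma_gt0].
  + by apply: mulr_gt0; [exact: exprn_gt0|exact: gamma_gt0].
  by apply: ler_wpM2l; [exact: exprn_ge0|exact: gamma_decr].
move=> s sF n Mn nN.
have nT : time n - time (M + K) <= T.
  by apply: le_trans MNT; rewrite lerD ?time_homo// lerN2 time_homo.
have [k [kJ Mg gn gh]] := gP n Mn nT.
have := FP k; case=> _ _ /(_ s); have -> : minn (g k) N = g k.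
  by apply/minn_idPl; exact: leq_trans nN.
move=> Hk.
rewrite (big_cat_nat Mg gn)/=; apply: (le_trans (ler_normD _ _)).
have -> : 3 * a = a + 2 * a by ring.
apply: lerD.
  apply: Hk => sk; apply: sF; rewrite -bigcup_seq; exists (Ordinal kJ) => //=.
  by rewrite mem_index_enum.
apply: (le_trans (ler_norm_sum _ _ _)).
apply: (@le_trans _ _ (2 * C0 * (time n - time (g k)))).
  rewrite -sum_gamma// mulr_sumr; apply: ler_sum => i _.
  rewrite normrM (gtr0_norm (gamma_gt0 _))// mulrC.
  by apply: ler_wpM2r; [rewrite ltW// gamma_gt0|exact: deviation_le].
apply: (le_trans (ler_wpM2l (ltW C20) gh)); rewrite mulrDr.
have -> : 2 * C0 * (a / (2 * C0)) = a by field; rewrite gt_eqF.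
have : 2 * C0 * gamma (M + K).+1 <= a.
  apply: le_trans KG; apply: ler_wpM2l; first exact: ltW.
  apply: (@le_trans _ _ (gamma M.+1)); first exact: gamma_decr.
  by rewrite ler_peMl ?ler1n// ltW.
lra.
Qed.

(** Each of the terms of [noise_decomposition] is allotted a fixed share of
    [delta]. *)
Lemma noise_event T r0 delta : 0 < T -> 0 < delta ->
  exists kappa c1 c2, [/\ 0 < kappa, 0 <= c1, 0 < c2 &
  forall K M j, (0 < K)%N -> K%:R * gamma M.+1 <= kappa -> rate ^+ K <= kappa ->
    beta ^+ M <= kappa ->
  exists E : set path, [/\ measurable E,
   (Q E <= (c1 * (K%:R `^ (p + 1) * gamma M.+1 `^ (p - 1) + rate ^+ K +
      K%:R * expR (- (c2 / (K%:R ^+ 2 * gamma M.+1)))))%:E)%E &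
   forall s, ~ E s -> enorm (theta M s) <= r0 ->
     forall n, (M <= n)%N -> time n - time M <= T -> `|noise M n s j| <= delta]].
Proof.
move=> T0 d0; have C00 : 0 < C0 by rewrite dir_bound_gt0.
have C20 : 0 < 2 * C0 by apply: mulr_gt0.
have b0 := beta_gt0 beta_bd; have b1 := onem_beta_gt0 beta_bd.
set r := r0 + speed * T; have T0' := ltW T0.
have [A [A0 AP]] := field_truncate r; have [L [L0 LP]] := field_lip r.
have [B [B0 BP]] := freeze_event r; have [D [D0 DP]] := tail_event r0 T0'.
pose lip := dir_lip eps alpha beta; have l0 : 0 <= lip by exact: dir_lip_ge0.
have l1 : 0 < lip + 1 by rewrite ltr_wpDl.
(* The scale [u] costs [T * u = delta / 8]; [e] makes the freezing error at most
   [u], and [eta] makes the tail at most [delta / 8]. *)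
pose u := delta / (8 * T); have u0 : 0 < u by rewrite divr_gt0// mulr_gt0.
pose e := u / (lip + 1); have e0 : 0 < e by rewrite divr_gt0.
pose eta := delta / 8 * e; have eta0 : 0 < eta by rewrite mulr_gt0// divr_gt0.
have a0 : 0 < delta / 8 by rewrite divr_gt0.
have [J [b [b'0 JP]]] := deviation_event T0 a0.
pose W := C0 * (1 / (1 - beta)) + A + L * speed.
have W0 : 0 <= W.
  apply: addr_ge0; first apply: addr_ge0 => //.
    by apply: mulr_ge0; [exact: ltW|rewrite divr_ge0// ltW].
  by apply: mulr_ge0 => //; exact: speed_ge0.
have S0 : 0 < 2 * C0 + T * W by rewrite ltr_pwDl// mulr_ge0.
pose kappa := delta / 8 / (2 * C0 + T * W).
have k0 : 0 < kappa by rewrite divr_gt0.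
exists kappa, (B / e `^ p * T + D / eta + 2 * J%:R), b; split => //.
  apply: addr_ge0; last exact: mulr_ge0.
  apply: addr_ge0; last by rewrite divr_ge0// ltW.
  by rewrite mulr_ge0// divr_ge0// powR_ge0.
move=> K M j K0 KG rK bM.
have [N [MN NT1 NT2]] := @time_cover M (time M + T) ltac:(by rewrite lerDl).
have NT : time N - time M <= T by rewrite lerBlDl.
have KGa : 2 * C0 * (K%:R * gamma M.+1) <= delta / 8.
  apply: (le_trans (ler_wpM2l (ltW C20) KG)); rewrite /kappa mulrA ler_pdivrMr//.
  rewrite mulrC ler_wpM2l ?(ltW a0)// lerDl mulr_ge0//.
have [E1 [mE1 QE1 HE1]] := BP K M N j e T K0 e0 T0' NT.
have [E2 [mE2 QE2 HE2]] := DP K M N j eta eta0 NT.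
have [E3 [mE3 QE3 HE3]] := JP K M N j K0 NT KGa.
exists (E1 `|` (E2 `|` E3)); split.
- by apply: measurableU => //; exact: measurableU.
- apply: (le_trans (measureU2 _ mE1 (measurableU _ _ mE2 mE3))).
  apply: (le_trans (leeD QE1 (measureU2 _ mE2 mE3))).
  apply: (le_trans (leeD (lexx _) (leeD QE2 QE3))).
  rewrite -!EFinD lee_fin.
  set x := _ * gamma M.+1 `^ (p - 1); set y := rate ^+ K.
  set z := K%:R * expR _.
  have x0 : 0 <= x by rewrite mulr_ge0 ?powR_ge0.
  have y0 : 0 <= y by case/andP: rate_bd => /ltW ? _; exact: exprn_ge0.
  have z0 : 0 <= z by rewrite mulr_ge0// expR_ge0.
  have -> : J%:R * (2 * K%:R * expR (- (b / (K%:R ^+ 2 * gamma M.+1)))) =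
    2 * J%:R * z by rewrite /z; ring.
  have h1 : 0 <= B / e `^ p * T by rewrite mulr_ge0// divr_ge0// powR_ge0.
  have h2 : 0 <= D / eta by rewrite divr_ge0// ltW.
  have h3 : 0 <= 2 * J%:R :> R by apply: mulr_ge0.
  move: x0 y0 z0 h1 h2 h3; clear; move: (B / _ * T) (D / eta) (2 * J%:R) x y z.
  move=> a1 a2 a3 x y z x0 y0 z0 h1 h2 h3; nra.
move=> s sE sr n Mn nT.
have nN : (n <= N)%N.
  rewrite leqNgt; apply/negP => /time_homo; rewrite leNgt => /negP; apply.
  by apply: le_lt_trans NT2; rewrite -lerBlDl.
have ball m : (M <= m)%N -> (m <= N)%N -> enorm (theta m s) <= r.
  move=> Mm mN; apply: (le_trans (enorm_le_dist _ (theta M s))).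
  apply: lerD => //; apply: (le_trans (theta_dist s Mm)).
  apply: ler_wpM2l; first exact: speed_ge0.
  by apply: le_trans NT; rewrite lerD2r time_homo.
have H := noise_decomposition (r := r) (T := T) (A := A) (L := L) (e := e) (u := u)
  (K := K) (s := s) (j := j) T0' A0 L0 u0 K0 (fun K y j => @AP K y j) (fun x y j => @LP x y j) Mn nT.
have {}H := H (fun m Mm mn => ball m Mm (leq_trans mn nN)).
have {}H : `|noise M n s j| <= 2 * C0 * (K%:R * gamma M.+1) +
    T * (det_error A L K M + (u + lip / u * e ^+ 2)) +
    lip / u * \sum_((M + K)%N <= i < n)
      gamma i.+1 * avg2_tail beta K i.+1 (past i s j) +
    `|\sum_((M + K)%N <= i < n) gamma i.+1 * deviation K i s j|.
  apply: H => i k Mi ni kK.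
  have Ma := leq_subSB Mi; have aik := subSB_le i kK.
  have iN := leq_trans ni nN.
  have ikN : (i - k <= N)%N by rewrite (leq_trans (leq_subr _ _))// ltnW.
  apply: HE1 => //; first by move=> h; apply: sE; left.
    by apply: ball => //; exact: leq_trans aik ikN.
  by apply: ball => //; exact: leq_trans Ma aik.
apply: (le_trans H).
have lu : lip / u * e <= 1.
  have -> : lip / u * e = lip / (lip + 1).
    by rewrite /e; field; rewrite !gt_eqF.
  by rewrite ler_pdivrMr// mul1r lerDl.
have lu0 : 0 <= lip / u by rewrite divr_ge0// ltW.
have H1 : T * det_error A L K M + 2 * C0 * (K%:R * gamma M.+1) <= delta / 8.
  apply: (@le_trans _ _ (kappa * (2 * C0 + T * W))); last first.
    by rewrite /kappa divfK// gt_eqF.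
  have -> : kappa * (2 * C0 + T * W) = T * (kappa * W) + 2 * C0 * kappa by ring.
  apply: lerD; last by apply: ler_wpM2l => //; exact: ltW.
  apply: ler_wpM2l => //.
  have -> : kappa * W = C0 * (kappa / (1 - beta)) + A * kappa + L * (speed * kappa).
    by rewrite /W; field; rewrite gt_eqF.
  apply: lerD; first apply: lerD.
  - apply: ler_wpM2l; first exact: ltW.
    by apply: ler_wpM2r => //; rewrite invr_ge0 ltW.
  - exact: ler_wpM2l.
  - by apply: ler_wpM2l => //; apply: ler_wpM2l => //; exact: speed_ge0.
have H2 : T * u = delta / 8 by rewrite /u; field; rewrite gt_eqF.
have H3 : T * (lip / u * e ^+ 2) <= delta / 8.
  rewrite -H2; apply: ler_wpM2l => //; rewrite expr2 mulrA.
  apply: (le_trans (ler_wpM2r (ltW e0) lu)); rewrite mul1r /e.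
  by rewrite ler_pdivrMr// ler_peMr ?(ltW u0)// lerDr.
have H4 : lip / u * \sum_((M + K)%N <= i < n)
      gamma i.+1 * avg2_tail beta K i.+1 (past i s j) <= delta / 8.
  apply: (@le_trans _ _ (lip / u * eta)).
    apply: ler_wpM2l => //; apply: le_trans (HE2 s _ sr); last first.
      by move=> h; apply: sE; right; left.
    have t0 i : 0 <= gamma i.+1 * avg2_tail beta K i.+1 (past i s j).
      apply: mulr_ge0; first by rewrite ltW// gamma_gt0.
      apply: mulr_ge0; first exact: ltW.
      by apply: sumr_ge0 => kk _; rewrite mulr_ge0 ?sqr_ge0 ?exprn_ge0 ?(ltW b0).
    case: (leqP (M + K) n) => MKn; last by rewrite big_geq ?(ltnW MKn)// sumr_ge0.
    by rewrite [leRHS](big_cat_nat MKn nN)/= lerDl sumr_ge0.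
  rewrite /eta mulrCA; rewrite -[leRHS]mulr1; apply: ler_wpM2l => //; exact: ltW.
have H5 : `|\sum_((M + K)%N <= i < n) gamma i.+1 * deviation K i s j| <=
    3 * (delta / 8).
  case: (leqP (M + K) n) => MKn.
    by apply: HE3 => // h; apply: sE; right; right.
  by rewrite big_geq ?(ltnW MKn)// normr0 mulr_ge0// ltW.
move: H1 H2 H3 H4 H5.
set x1 := det_error _ _ _ _; set x2 := _ * (K%:R * _); set x3 := lip / u * e ^+ 2.
set x4 := lip / u * _; set x5 := `|_|; clearbody x1 x2 x3 x4 x5 => H1 H2 H3 H4 H5.
rewrite !mulrDr; lra.
Qed.

(** ** The length of the blocks *)

Lemma expRN_le (x : R) n : (0 < n)%N -> 0 < x -> expR (- x) <= n`!%:R / x ^+ n.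
Proof.
case: n => // n _ x0; have xn : 0 < x ^+ n.+1 by exact: exprn_gt0.
have f0 : 0 < (n.+1)`!%:R :> R by rewrite ltr0n fact_gt0.
rewrite expRN -[leRHS]invf_div lef_pV2 ?posrE ?expR_gt0 ?divr_gt0//.
have := expR_ge1Dxn n (ltW x0); lra.
Qed.

Fact block_exponent q : (0 < q)%N -> (1 + 4 * q <= 9 * q)%N.
Proof. lia. Qed.

(** The block length is about [G `^ (- 9^-1)].  Then [K `^ (p + 1) * G `^ (p - 1)]
    is at most [G `^ ((8 * p - 10) / 9)], and this exponent is at least [p / 3]
    exactly when [p >= 2]; the two other terms decay faster than any power of
    [G]. *)
Lemma block_length (c2 : R) : 0 < c2 -> exists c3, 0 <= c3 /\
  forall G, 0 < G <= 1 -> exists K, [/\ (0 < K)%N, K%:R ^+ 9 * G <= 1,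
   rate ^+ K <= c3 * G &
   K%:R `^ (p + 1) * G `^ (p - 1) + rate ^+ K +
     K%:R * expR (- (c2 / (K%:R ^+ 2 * G))) <= c3 * G `^ (p / 3)].
Proof.
move=> c20; case/andP: rate_bd => r0 r1.
pose q := (Num.truncn (p / 3)).+1.
have q0 : (0 < q)%N by [].
have p3 : 0 <= p / 3 by rewrite divr_ge0// (le_trans _ p2).
have pq : p / 3 <= q%:R by have /andP[_ /ltW] := truncn_itv p3.
clearbody q; pose lam := - ln rate; have lam0 : 0 < lam by rewrite oppr_gt0 ln_lt0// r0.
have cE n : rate ^+ n = expR (- (lam * n%:R)).
  by rewrite /lam mulNr opprK mulrC expRM_natl lnK// posrE.
pose cb := ((9 * q)`!)%:R / lam ^+ (9 * q) / rate.
pose cc := ((2 * q)`!)%:R / c2 ^+ (2 * q).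
have cb0 : 0 <= cb by rewrite divr_ge0 ?ltW// divr_gt0 ?exprn_gt0// ltr0n fact_gt0.
have cc0 : 0 <= cc by rewrite divr_ge0 ?ltW// ?exprn_gt0// ltr0n fact_gt0.
exists (1 + cb + cc); split; first by rewrite !addr_ge0.
move=> G /andP[G0 G1]; have iG1 : 1 <= G^-1 by rewrite invf_ge1.
pose y := G^-1 `^ 9^-1.
have y9 : y ^+ 9 = G^-1.
  by rewrite -powR_mulrn ?powR_ge0// -powRrM mulVf// powRr1// invr_ge0 ltW.
have y1 : 1 <= y by rewrite -(powRr0 G^-1); apply: ler_powR => //; rewrite invr_ge0.
have y0 : 0 <= y by exact: le_trans y1.
have /andP[Ky yK] := truncn_itv y0; set K := Num.truncn y in Ky yK.
have K0 : (0 < K)%N.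
  by rewrite lt0n; apply: contraTneq yK => ->; rewrite -leNgt.
have KR : 1 <= K%:R :> R by rewrite ler1n.
have K9 : K%:R ^+ 9 * G <= 1.
  by rewrite -ler_pdivlMr// mul1r -y9 lerXn2r// nnegrE.
have Gq : G ^+ q <= G `^ (p / 3) by rewrite -powR_mulrn ?(ltW G0)//; apply: ger_powR => //; rewrite G0.
have Gq1 : G ^+ q <= G.
  by rewrite -[leRHS]expr1; apply: ler_wiXn2l => //; exact: ltW.
have Gp0 : 0 <= G `^ (p / 3) by exact: powR_ge0.
have a_le : K%:R `^ (p + 1) * G `^ (p - 1) <= G `^ (p / 3).
  apply: (@le_trans _ _ (y `^ (p + 1) * G `^ (p - 1))).
    apply: ler_wpM2r; first exact: powR_ge0.
    by apply: ge0_ler_powR; rewrite ?nnegrE//; move: p2; lra.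
  have -> : y = G `^ (- 9^-1) by rewrite /y -[G^-1]powR_inv1 ?(ltW G0)// -powRrM mulN1r.
  rewrite -powRrM -powRD ?(gt_eqF G0) ?implybT//.
  by apply: ger_powR; [rewrite G0|move: p2; lra].
have b_le : rate ^+ K <= cb * G ^+ q.
  have -> : rate ^+ K = rate ^+ K.+1 / rate by rewrite exprSr mulfK// gt_eqF.
  have -> : cb * G ^+ q = ((9 * q)`!)%:R / lam ^+ (9 * q) * G ^+ q / rate by rewrite /cb; ring.
  apply: ler_wpM2r; first by rewrite invr_ge0 ltW.
  rewrite cE; have cK : 0 < lam * K.+1%:R by rewrite mulr_gt0.
  have q90 : (0 < 9 * q)%N by rewrite muln_gt0.
  apply: (le_trans (expRN_le q90 cK)); rewrite exprMn invfM mulrA.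
  apply: ler_wpM2l; first by rewrite divr_ge0// exprn_ge0// ltW.
  rewrite -[leRHS]invrK -[in leRHS]exprVn lef_pV2 ?posrE ?exprn_gt0 ?invr_gt0//.
  by rewrite -y9 -exprM lerXn2r// ?nnegrE// ltW.
have c_le : K%:R * expR (- (c2 / (K%:R ^+ 2 * G))) <= cc * G ^+ q.
  have KG : 0 < K%:R ^+ 2 * G by rewrite mulr_gt0// exprn_gt0// (lt_le_trans _ KR).
  have q20 : (0 < 2 * q)%N by rewrite muln_gt0.
  apply: (le_trans (ler_wpM2l _ (expRN_le q20 (divr_gt0 c20 KG)))) => //.
  have -> : K%:R * (((2 * q)`!)%:R / (c2 / (K%:R ^+ 2 * G)) ^+ (2 * q)) =
      cc * (K%:R * (K%:R ^+ 2 * G) ^+ (2 * q)).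
    by rewrite /cc expr_div_n invf_div; ring.
  apply: ler_wpM2l => //.
  have -> : K%:R * (K%:R ^+ 2 * G) ^+ (2 * q) =
      K%:R ^+ (1 + 4 * q) * G ^+ q * G ^+ q.
    rewrite exprMn -exprM mulnA [(2 * 2)%N]/= exprD expr1.
    by rewrite -[RHS]mulrA -exprD addnn -mul2n; ring.
  rewrite -[leRHS]mul1r; apply: ler_wpM2r; first by rewrite exprn_ge0// ltW.
  apply: (@le_trans _ _ ((K%:R ^+ 9 * G) ^+ q)); last first.
    by apply: exprn_ile1 => //; rewrite mulr_ge0 ?exprn_ge0// ltW.
  rewrite exprMn -exprM; apply: ler_wpM2r; first by rewrite exprn_ge0// ltW.
  exact: (ler_weXn2l KR (block_exponent q0)).
exists K; move: a_le b_le c_le cb0 cc0; clearbody cb cc => a_le b_le c_le cb0 cc0.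
have cb1 : cb <= 1 + cb + cc by rewrite addrAC lerDr addr_ge0.
split=> //.
  by rewrite (le_trans b_le)// (le_trans (ler_wpM2l cb0 Gq1))// ler_wpM2r// ltW.
rewrite !mulrDl mul1r; apply: lerD; first apply: lerD.
- exact: a_le.
- exact: le_trans b_le (ler_wpM2l cb0 Gq).
- exact: le_trans c_le (ler_wpM2l cc0 Gq).
Qed.

(** The block length of [block_length] also satisfies the smallness conditions of
    [noise_event] as soon as [gamma] is small. *)
Lemma noise_bound T r0 delta : 0 < T -> 0 < delta -> exists C M0, 0 <= C /\
  forall M, (M0 <= M)%N ->
  exists E : set path, [/\ measurable E, (Q E <= (C * gamma M.+1 `^ (p / 3))%:E)%E &
   forall s, ~ E s -> enorm (theta M s) <= r0 ->
     forall n j, (M <= n)%N -> time n - time M <= T -> `|noise M n s j| <= delta].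
Proof.
move=> T0 d0; have [kappa [c1 [c2 [k0 c10 c20 HE]]]] := noise_event r0 T0 d0.
have [c3 [c30 HK]] := block_length c20.
have c31 : 0 < c3 + 1 by rewrite ltr_wpDl.
pose g := Num.min 1 (Num.min (kappa ^+ 9) (kappa / (c3 + 1))).
have g0 : 0 < g by rewrite !lt_min ltr01 exprn_gt0// divr_gt0.
have [M1 _ M1P] : \forall n \near \oo, gamma n <= g.
  exact: (cvgr_le 0 gamma_cvg g g0).
have bcvg : beta ^+ n @[n --> \oo] --> 0.
  by apply: cvg_expr; rewrite gtr0_norm ?(beta_gt0 beta_bd) ?(beta_lt1 beta_bd).
have [M2 _ M2P] : \forall n \near \oo, beta ^+ n <= kappa.
  exact: (cvgr_le 0 bcvg kappa k0).
exists (d%:R * (c1 * c3)), (maxn M1 M2); split; first by rewrite !mulr_ge0.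
move=> M; rewrite geq_max => /andP[MM1 MM2]; set G := gamma M.+1.
have G0 : 0 < G by exact: gamma_gt0.
have /andP[G1 /andP[Gk Gc]] : (G <= 1) && ((G <= kappa ^+ 9) && (G <= kappa / (c3 + 1))).
  by rewrite -!le_min; apply: M1P => /=; exact: leqW.
have bM : beta ^+ M <= kappa by exact: M2P.
have [|K [K0 K9 rK sK]] := HK G; first by rewrite G0.
have KG : K%:R * G <= kappa.
  rewrite -(@ler_pXn2r _ 9)// ?nnegrE ?mulr_ge0 ?(ltW k0) ?(ltW G0)//.
  apply: le_trans Gk.
  have -> : (K%:R * G) ^+ 9 = K%:R ^+ 9 * G ^+ 8 * G.
    by rewrite exprMn [G ^+ 9]exprSr mulrA.
  rewrite -[leRHS]mul1r; apply: ler_wpM2r; first exact: ltW.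
  apply: le_trans K9; apply: ler_wpM2l; first exact: exprn_ge0.
  by rewrite -[leRHS]expr1; apply: ler_wiXn2l => //; exact: ltW.
have rk : rate ^+ K <= kappa.
  apply: (le_trans rK); apply: (@le_trans _ _ ((c3 + 1) * G)).
    by apply: ler_wpM2r; [exact: ltW|rewrite lerDl].
  by rewrite mulrC -ler_pdivlMr.
have /choice[E EP] := fun j => HE K M j K0 KG rk bM.
have mE j : measurable (E j) by case: (EP j).
have QE j : (Q (E j) <= (c1 * (c3 * G `^ (p / 3)))%:E)%E.
  case: (EP j) => _ h _; apply: (le_trans h); rewrite lee_fin.
  exact: ler_wpM2l.
exists (\big[setU/set0]_j E j); split.
- exact: bigsetU_measurable.
- apply: (le_trans (probability_bigsetU_le (index_enum 'I_d) mE QE)).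
  by rewrite lee_fin sumr_const card_ord -[leLHS]mulr_natl !mulrA.
move=> s sE sr n j Mn nT; have [_ _] := EP j; apply=> // sj; apply: sE.
by rewrite -bigcup_seq; exists j => //=; rewrite mem_index_enum.
Qed.

(** * From small noise to the semiflow *)

Context (Psi : R -> 'rV[R]_d -> 'rV[R]_d).
Hypothesis flow_Psi : is_semiflow f Psi.

Lemma theta_noise M m (s : path) j : (M <= m)%N ->
  (theta m s - theta M s - \sum_(M <= i < m) gamma i.+1 *: f (theta i s)) 0 j =
  noise M m s j.
Proof.
move=> Mm; rewrite /noise -(telescope_sumr (theta ^~ s) Mm) -sumrB summxE.
by apply: eq_bigr => i _; rewrite !coordB thetaS [X in _ - X]mxE; ring.
Qed.

(** [flow_comparison] with the accumulated noise as perturbation; the parameter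
    and the solution stay in a common ball because both move at bounded speed. *)
Lemma tracking (r T delta : R) : 0 < T -> 0 < delta ->
  exists eta M0, 0 < eta /\ forall M n s, (M0 <= M)%N -> (M <= n)%N ->
  enorm (theta M s) <= r -> time n - time M <= T ->
  (forall m j, (M <= m)%N -> (m <= n)%N -> `|noise M m s j| <= eta) ->
  enorm (theta n s - Psi (time n - time M) (theta M s)) <= delta.
Proof.
move=> T0 d0; set r' := r + speed * T; have [L [L0 LP]] := field_lip r'.
have sp := speed_ge0; have T0' := ltW T0.
have C00 : 0 <= C0 by rewrite ltW// dir_bound_gt0.
have L'0 : 0 <= L *+ d by exact: mulrn_wge0.
pose W := expR (L *+ d * T); have W0 : 0 < W by exact: expR_gt0.
pose V := L *+ d * (speed * 1) * T.
have V0 : 0 <= V by rewrite !mulr_ge0.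
pose g := delta / (2 * W * (V + 1)).
have g0 : 0 < g by rewrite divr_gt0// !mulr_gt0// ltr_wpDl.
have [M0 _ M0P] : \forall n \near \oo, gamma n <= g.
  exact: (cvgr_le 0 gamma_cvg g g0).
pose eta := delta / (2 * W * d.+1%:R).
exists eta, M0; split; first by rewrite divr_gt0// !mulr_gt0.
move=> M n s M0M Mn sr nT noise_le'.
have := @flow_comparison R d f C0 C00 field_coord_le Psi flow_Psi
  r' L L0 LP (fun i => gamma i.+1) g (eta *+ d) (theta ^~ s) (theta M s) M n.
rewrite sum_gamma// => /(_ _ Mn _ _ _ _)/le_trans; apply.
- by move=> i; rewrite ltW// gamma_gt0.
- by move=> i Mi; apply: M0P; rewrite /= (leq_trans M0M)// leqW.
- move=> m Mm mn; apply: enorm_le_bound => j; rewrite theta_noise//.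
  exact: noise_le'.
- move=> m Mm mn; apply: (le_trans (enorm_le_dist _ (theta M s))).
  apply: lerD => //; apply: (le_trans (theta_dist s Mm)); apply: ler_wpM2l => //.
  by apply: le_trans nT; rewrite lerD2r time_homo.
- move=> t t0 tn; apply: (le_trans (enorm_le_dist _ (theta M s))).
  apply: lerD => //; rewrite -{2}(flow0 flow_Psi (theta M s)).
  apply: (le_trans (flow_dist field_coord_le flow_Psi _ (lexx 0) t0)).
  by rewrite subr0; apply: ler_wpM2l => //; exact: le_trans tn nT.
rewrite subrr enorm0 add0r -/speed.
apply: (@le_trans _ _ ((eta *+ d + V * g) * W)); last first.
  have h1 : eta *+ d * W <= delta / 2.
    have -> : eta *+ d * W = delta / 2 * (d%:R / d.+1%:R).
      rewrite -[eta *+ d]mulr_natr /eta; field.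
      by rewrite !gt_eqF// ltr0n.
    rewrite ler_piMr ?divr_ge0 ?(ltW d0)// ler_pdivrMr ?ltr0n// mul1r ler_nat//.
  have h2 : V * g * W <= delta / 2.
    have V1 : 0 < V + 1 by rewrite ltr_wpDl.
    have -> : V * g * W = delta / 2 * (V / (V + 1)).
      by rewrite /g; field; rewrite !gt_eqF.
    by rewrite ler_piMr ?divr_ge0 ?(ltW d0)// ler_pdivrMr// mul1r lerDl.
  rewrite mulrDl; lra.
have tn0 : 0 <= time n - time M by rewrite subr_ge0 time_homo.
apply: ler_pM.
- apply: addr_ge0; first by apply: mulrn_wge0; rewrite ltW// divr_gt0// !mulr_gt0.
  apply: mulr_ge0 => //; apply: mulr_ge0 => //; apply: mulr_ge0 => //; exact: ltW.
- exact: expR_ge0.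
- rewrite lerD2l.
  have -> : V * g = L *+ d * (speed * g) * T by rewrite /V; ring.
  apply: ler_wpM2l => //; apply: mulr_ge0 => //; apply: mulr_ge0 => //; exact: ltW.
- by rewrite ler_expR; apply: ler_wpM2l.
Qed.

Lemma deviation_bound (r T delta : R) : 0 < T -> 0 < delta ->
  exists C M0, 0 <= C /\ forall M, (M0 <= M)%N ->
  exists E : set path, [/\ measurable E,
   (Q E <= (C * gamma M.+1 `^ (p / 3))%:E)%E &
   forall s, ~ E s -> enorm (theta M s) <= r -> forall n, (M <= n)%N ->
     time n - time M <= T ->
     enorm (theta n s - Psi (time n - time M) (theta M s)) <= delta].
Proof.
move=> T0 d0; have [eta [M1 [e0 HT]]] := tracking r T0 d0.
have [C [M2 [C0' HN]]] := noise_bound r T0 e0.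
exists C, (maxn M1 M2); split => // M; rewrite geq_max => /andP[MM1 MM2].
have [E [mE QE HE]] := HN M MM2; exists E; split => // s sE sr n Mn nT.
apply: HT => // m j Mm mn; apply: HE => //.
by apply: le_trans nT; rewrite lerD2r time_homo.
Qed.

(** ** Windows of unit length *)

(** Each window starts at the first index at which more than one unit of training
    time has elapsed since the preceding start. *)
Lemma windows : exists N : nat -> nat, [/\ forall k, (N k < N k.+1)%N,
  forall k, time (N k) + 1 < time (N k.+1) &
  forall n, exists k, [/\ (N k <= n)%N, (n < N k.+1)%N &
    time n <= time (N k) + 1]].
Proof.
have /choice[nx nxP] : forall M, exists n, [/\ (M <= n)%N,
    time n <= time M + 1 & time M + 1 < time n.+1].
  by move=> M; apply: time_cover; rewrite lerDl.
pose N k := iter k (fun M => (nx M).+1) 0%N.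
have NS k : (N k < N k.+1)%N by rewrite /N iterS ltnS; have [] := nxP (N k).
exists N; split => //; first by move=> k; rewrite [N k.+1]iterS; have [] := nxP (N k).
move=> n; have kN k : (k <= N k)%N.
  by elim: k => // k IH; exact: leq_ltn_trans IH (NS k).
have exk : exists k, (n < N k)%N by exists n.+1; exact: kN.
have := ex_minnP exk; case=> -[//|k] nk kmin; exists k; split => //.
- by rewrite leqNgt; apply/negP => /kmin; rewrite ltnn.
- have [_ h _] := nxP (N k); apply: le_trans h; apply: time_homo.
  by rewrite -ltnS; move: nk; rewrite [N k.+1]iterS.
Qed.

(** Between two starts the step sizes add up to at least one, and each of them is
    at least the step size at the later start. *)
Lemma sum_windows (N : nat -> nat) m : (forall k, (N k < N k.+1)%N) ->
  (forall k, time (N k) + 1 < time (N k.+1)) ->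
  \sum_(k < m) gamma (N k.+1).+1 `^ (p / 3) <=
  \sum_(N 0%N <= i < N m) gamma i.+1 `^ (1 + p / 3).
Proof.
move=> NS N1; have p3 : 0 <= p / 3 by rewrite divr_ge0// (le_trans _ p2).
elim: m => [|m IH]; first by rewrite big_ord0 big_geq.
have N0m : (N 0%N <= N m)%N.
  elim: {IH} m => // m IH; exact: leq_trans IH (ltnW (NS m)).
rewrite big_ord_recr/= (@big_cat_nat _ _ _ (N m))//= ?(ltnW (NS m))//.
apply: lerD => //; set w := gamma (N m.+1).+1 `^ _.
apply: (@le_trans _ _ (w * (time (N m.+1) - time (N m)))).
  by rewrite ler_peMr ?powR_ge0// lerBrDl ltW.
rewrite -sum_gamma ?(ltnW (NS m))// mulr_sumr.
apply: ler_sum_nat => i /andP[_ im].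
have g0 : 0 < gamma i.+1 by exact: gamma_gt0.
have -> : gamma i.+1 `^ (1 + p / 3) = gamma i.+1 `^ (p / 3) * gamma i.+1.
  by rewrite addrC powRD ?powRr1 ?(ltW g0)// (gt_eqF g0) implybT.
apply: ler_wpM2r; first exact: ltW.
apply: ge0_ler_powR => //; rewrite ?nnegrE ?(ltW (gamma_gt0 _))//.
by apply: gamma_decr => //; rewrite ltnS ltnW.
Qed.

(** Borel-Cantelli along the windows.  An arbitrary start [M] lies in the window
    of some [N k], at most a unit of training time after [N k]; this is why the
    horizon is [T + 1] and the radius [r + speed], and why each of the two noises
    from [N k] may use half of the budget. *)
Lemma deviation_ae (r T delta : R) : 0 < T -> 0 < delta ->
  (exists S, forall n, \sum_(0 <= i < n) gamma i.+1 `^ (1 + p / 3) <= S) ->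
  exists Z : set path, [/\ measurable Z, Q Z = 0%E &
   forall s, ~ Z s -> exists N0, forall M, (N0 <= M)%N ->
     enorm (theta M s) <= r -> forall n, (M <= n)%N -> time n - time M <= T ->
     enorm (theta n s - Psi (time n - time M) (theta M s)) <= delta].
Proof.
move=> T0 d0 [S SP]; have [eta [M1 [e0 HT]]] := tracking r T0 d0.
have T1 : 0 < T + 1 by rewrite addr_gt0.
have e20 : 0 < eta / 2 by rewrite divr_gt0.
have [C [M2 [C0' HN]]] := noise_bound (r + speed) T1 e20.
have [N [NS N1 Nk]] := windows.
have Nhomo : {homo N : i j / (i <= j)%N >-> (i <= j)%N}.
  by apply: homo_leq => [//|y x z|k]; [exact: leq_trans|exact: ltnW].
have kN k : (k <= N k)%N.
  by elim: k => // k IH; exact: leq_ltn_trans IH (NS k).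
have /choice[E EP] : forall k, exists E : set path, [/\ measurable E,
    (Q E <= (C * gamma (N k.+1).+1 `^ (p / 3))%:E)%E &
    (M2 <= k)%N -> forall s, ~ E s -> enorm (theta (N k.+1) s) <= r + speed ->
      forall n j, (N k.+1 <= n)%N -> time n - time (N k.+1) <= T + 1 ->
      `|noise (N k.+1) n s j| <= eta / 2].
  move=> k; case: (leqP M2 k) => Mk; last first.
    exists set0; rewrite measure0; split => //.
    by rewrite lee_fin mulr_ge0// powR_ge0.
  have [|E [mE QE HE]] := HN (N k.+1); last by exists E.
  by rewrite (leq_trans Mk)// (leq_trans (kN k))// ltnW.
have mE k : measurable (E k) by case: (EP k).
exists (lim_sup_set E); split.
- by apply: bigcap_measurable => // k _; apply: bigcup_measurable.
- apply: lim_sup_set_cvg0 => //; apply: (@le_lt_trans _ _ (C * S)%:E); last exact: ltry.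
  apply: lime_le; first by apply: is_cvg_nneseries => n _ _; exact: measure_ge0.
  apply: nearW => n; rewrite big_mkord.
  apply: (@le_trans _ _ (\sum_(k < n) (C * gamma (N k.+1).+1 `^ (p / 3))%:E)%E).
    by apply: lee_sum => k _; case: (EP k).
  rewrite sumEFin lee_fin -mulr_sumr; apply: ler_wpM2l => //.
  apply: (le_trans (sum_windows n NS N1)); apply: le_trans (SP (N n)).
  rewrite [leRHS](@big_cat_nat _ _ _ (N 0%N))//= ?Nhomo// lerDr.
  by apply: sumr_ge0 => i _; exact: powR_ge0.
move=> s sZ; have [K0 K0P] : exists K0, forall k, (K0 <= k)%N -> ~ E k s.
  apply: contrapT => H; apply: sZ => K _; apply: contrapT => H'; apply: H.
  by exists K => k Kk Eks; apply: H'; exists k.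
pose K := maxn K0 M2; exists (maxn M1 (N K.+1)) => M.
rewrite geq_max => /andP[MM1 MK] sr n Mn nT; apply: HT => // m j Mm mn.
have [k [kM Mk tk]] := Nk M.
have Kk : (K < k)%N.
  by rewrite -ltnS; apply: contraLR Mk; rewrite -!leqNgt => /Nhomo h; exact: leq_trans h MK.
case: k Kk kM Mk tk => // k; rewrite ltnS geq_max => /andP[K0k M2k] kM Mk tk.
have [_ _ /(_ M2k s (K0P _ K0k)) HE] := EP k.
have ball : enorm (theta (N k.+1) s) <= r + speed.
  apply: (le_trans (enorm_le_dist _ (theta M s))); apply: lerD => //.
  rewrite enormB; apply: (le_trans (theta_dist s kM)).
  by rewrite -[leRHS]mulr1; apply: ler_wpM2l; [exact: speed_ge0|rewrite lerBlDl].
have tm : time m - time M <= T by apply: le_trans nT; rewrite lerD2r time_homo.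
have h1 := HE ball m j (leq_trans kM Mm) ltac:(lra).
have h2 := HE ball M j kM ltac:(lra).
have -> : noise M m s j = noise (N k.+1) m s j - noise (N k.+1) M s j.
  by rewrite (noise_split s j kM Mm) addrAC subrr add0r.
by apply: (le_trans (ler_normB _ _)); rewrite [leRHS]splitr; exact: lerD.
Qed.

(** ** The maximal deviation *)

Lemma measurable_flow t j : 0 <= t ->
  measurable_fun setT (fun x : borel_rV R d => Psi t x 0 j).
Proof.
move=> t0; have C00 : 0 <= C0 by rewrite ltW// dir_bound_gt0.
apply: (@measurability _ _ (borel_rV R d) (measurableTypeR R) setT _
  (@RGenOInfty.G R)); first exact: RGenOInfty.measurableE.
move=> _ [_ [x ->] <-]; rewrite setTI; apply: sub_sigma_algebra.
have /continuousP := continuous_flow C00 field_coord_le field_lip flow_Psi (j := j) t0.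
by apply; exact: interval_open.
Qed.

Notation deviation_sup := (max_deviation gamma theta Psi).

Lemma time_le m n : 0 <= time n - time m -> (m <= n)%N.
Proof. by rewrite subr_ge0; apply: contraTT; rewrite -!ltnNge -ltNge => /time_lt. Qed.

(** The supremum is over a set that contains the index [N]. *)
Lemma max_deviation_ge0 T r N (s : path) : 0 <= T ->
  (0 <= deviation_sup T r N s)%E.
Proof.
move=> T0; apply: (@le_trans _ _ (enorm (theta N s - Psi (time N - time N) (theta N s)) *
    \1_[set x : 'rV[R]_d | enorm x <= r] (theta N s))%:E).
  by rewrite lee_fin mulr_ge0 ?enorm_ge0.
by apply: ereal_sup_ubound; exists N => //=; rewrite subrr lexx.
Qed.

Lemma max_deviation_le T r delta N (s : path) : 0 <= delta ->
  (enorm (theta N s) <= r -> forall n, (N <= n)%N -> time n - time N <= T ->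
    enorm (theta n s - Psi (time n - time N) (theta N s)) <= delta) ->
  (deviation_sup T r N s <= delta%:E)%E.
Proof.
move=> d0 H; apply: ge_ereal_sup => _ [n /= /andP[n0 nT] <-]; rewrite lee_fin indicE.
case: (boolP (_ \in _)) => [/set_mem/= sr|_]; last by rewrite mulr0.
by rewrite mulr1; apply: H => //; exact: time_le.
Qed.

(** A countable union over the indices of the window. *)
Lemma measurable_max_deviation T r N delta :
  measurable [set s : path | (delta%:E < deviation_sup T r N s)%E].
Proof.
pose D n (s : path) : R := enorm (theta n s - Psi (time n - time N) (theta N s)) *
  \1_[set x : 'rV[R]_d | enorm x <= r] (theta N s).
have -> : [set s : path | (delta%:E < deviation_sup T r N s)%E] =
    \bigcup_(n in [set n | 0 <= time n - time N <= T]) [set s : path | delta < D n s].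
  apply/seteqP; split=> [s /= /ereal_sup_gt[_ [n nT <-]]|s [n nT] /= h].
    by rewrite lte_fin => h; exists n.
  apply: (@lt_le_trans _ _ (D n s)%:E); first by rewrite lte_fin.
  by apply: ereal_sup_ubound; exists n.
apply: bigcup_measurable => n /= /andP[n0 _].
rewrite -[X in measurable X]setTI; apply: measurable_fun_ltr => //.
apply: measurable_funM; last first.
  exact: (measurable_indic (measurable_theta_ball N r)).
apply: measurable_enorm => j; under eq_fun do rewrite coordB.
apply: measurable_funB.
  exact: (measurableT_comp (measurable_coord_rV j) (measurable_theta n)).
exact: (measurableT_comp (measurable_flow j n0) (measurable_theta N)).
Qed.

Lemma max_deviation_cvg_probability T r delta : 0 < T -> 0 < delta ->
  Q [set s : path | (delta%:E < deviation_sup T r N s)%E] @[N --> \oo] --> 0%E.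
Proof.
move=> T0 d0; have [C [M0 [C0' H]]] := deviation_bound r T0 d0.
have p3 : 0 < p / 3 by rewrite divr_gt0// (lt_le_trans _ p2).
have bound M : (M0 <= M)%N ->
    (Q [set s : path | (delta%:E < deviation_sup T r M s)%E] <=
     (C * gamma M.+1 `^ (p / 3))%:E)%E.
  move=> /H [E [mE QE HE]]; apply: le_trans QE; apply: le_measure; rewrite ?inE//.
    exact: measurable_max_deviation.
  move=> s /=; apply: contraPP => sE; apply/negP; rewrite -leNgt.
  by apply: max_deviation_le; [exact: ltW|exact: HE].
have cg : (C * gamma M.+1 `^ (p / 3))%:E @[M --> \oo] --> 0%E.
  apply: cvg_EFin; first exact: nearW.
  rewrite -[X in _ --> X](mulr0 C); apply: cvgM; first exact: cvg_cst.
  have gS : gamma n.+1 @[n --> \oo] --> (0 : R) by rewrite (cvg_shiftS gamma).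
  apply/cvgrPdist_le => e e0; have e1 : 0 < e `^ (p / 3)^-1 by exact: powR_gt0.
  near=> n; rewrite sub0r normrN ger0_norm ?powR_ge0//.
  apply: (@le_trans _ _ ((e `^ (p / 3)^-1) `^ (p / 3))); last first.
    by rewrite -powRrM mulVf ?(lt0r_neq0 p3)// powRr1// ltW.
  apply: ge0_ler_powR; rewrite ?nnegrE ?(ltW p3) ?(ltW (gamma_gt0 _)) ?(ltW e1)//.
  by near: n; exact: (cvgr_le 0 gS).
have z0 : cst 0%E M @[M --> \oo] --> (0%E : \bar R) by exact: cvg_cst.
apply: (squeeze_cvge _ z0 cg).
exists M0 => // M /= M0M; rewrite measure_ge0; exact: bound.
Unshelve. all: by end_near. Qed.

Lemma cvge0 (u : nat -> \bar R) : (forall n, (0 <= u n)%E) ->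
  (forall m : nat, exists N, forall n, (N <= n)%N -> (u n <= (m.+1%:R^-1)%:E)%E) ->
  u n @[n --> \oo] --> 0%E.
Proof.
move=> u0 uP; apply/fine_cvgP; split.
  have [N NP] := uP 0%N; exists N => // n /= /NP h.
  by rewrite ge0_fin_numE// (le_lt_trans h)// ltry.
apply/cvgrPdist_le => e e0; have [m] := ltr_add_invr e0; rewrite add0r => me.
have [N NP] := uP m; exists N => // n /= /NP h.
rewrite sub0r normrN ger0_norm ?fine_ge0// (le_trans _ (ltW me))//.
by rewrite -lee_fin fineK// ge0_fin_numE// (le_lt_trans h)// ltry.
Qed.

Lemma max_deviation_cvg_ae T r : 0 < T ->
  (exists S, forall n, \sum_(0 <= i < n) gamma i.+1 `^ (1 + p / 3) <= S) ->
  exists Z : set path, [/\ measurable Z, Q Z = 0%E &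
    forall s, ~ Z s -> deviation_sup T r N s @[N --> \oo] --> 0%E].
Proof.
move=> T0 HS; have m0 (m : nat) : 0 < (m.+1%:R^-1 : R) by rewrite invr_gt0.
have /choice[Z ZP] := fun m => deviation_ae r T0 (m0 m) HS.
have mZ : measurable (\bigcup_m Z m).
  by apply: bigcup_measurable => m _; case: (ZP m).
exists (\bigcup_m Z m); split => //.
  apply/(negligibleP Q mZ); apply: negligible_bigcup => m.
  by have [mZm Zm0 _] := ZP m; exact/negligibleP.
move=> s sZ; apply: cvge0 => [N|m]; first by apply: max_deviation_ge0; exact: ltW.
have [_ _ /(_ s) [|N NP]] := ZP m; first by move=> h; apply: sZ; exists m.
by exists N => n Nn; apply: max_deviation_le; [rewrite invr_ge0|exact: NP].
Qed.

End Regular.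

(** * Adam on an arbitrary probability space *)

(** The two moment recursions determine the whole state. *)
Lemma adam_state_path_of {R : realType} {d : nat} {d1 dU : measure_display}
  {Omega : measurableType d1} {P : probability Omega R} {calU : measurableType dU}
  (X : calU -> 'rV[R]_d -> 'rV[R]_d) (eps alpha beta : R) (gamma : nat -> R)
  (start : 'rV[R]_d) (V : nat -> {RV P >-> calU})
  (th m v sigma : nat -> Omega -> 'rV[R]_d) :
  (forall w, [/\ th 0%N w = start, m 0%N w = 0 & v 0%N w = 0]) ->
  (forall n w,
    m n.+1 w = alpha *: m n w + (1 - alpha) *: X (V n w) (th n w) /\
    forall j : 'I_d,
    [/\ v n.+1 w 0 j =
          beta * v n w 0 j + (1 - beta) * (X (V n w) (th n w) 0 j) ^+ 2,
        sigma n.+1 w 0 j =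
          (Num.sqrt (v n.+1 w 0 j / (1 - beta ^+ n.+1)) + eps)^-1 &
        th n.+1 w 0 j =
          th n w 0 j + gamma n.+1 * sigma n.+1 w 0 j * m n.+1 w 0 j]) ->
  forall n w, adam_state X eps alpha beta gamma start n (path_of (V := V) w) =
    (th n w, m n w, v n w).
Proof.
move=> init rec; elim=> [|n IH] w; first by have [-> -> ->] := init w.
have [Em H] := rec n w; rewrite /= IH/= -/(path_of (V := V) w n).
have Ev : \row_j (beta * v n w 0 j + (1 - beta) * X (path_of (V := V) w n) (th n w) 0 j ^+ 2) =
    v n.+1 w.
  by apply/rowP => j; have [-> _ _] := H j; rewrite mxE.
rewrite Ev -Em; congr (_, _, _); apply/rowP => j.
by have [_ Es ->] := H j; rewrite mxE Es.
Qed.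

Lemma training_time_unbounded {R : realType} (gamma : nat -> R) :
  (forall n, (0 < n)%N -> 0 < gamma n) ->
  (\sum_(1 <= n <oo) (gamma n)%:E = +oo)%E ->
  forall x, exists n, x < training_time gamma n.
Proof.
move=> g0 gsum x; apply: contrapT => H.
have le_x n : training_time gamma n <= x.
  by rewrite leNgt; apply/negP => h; apply: H; exists n.
have : (\sum_(1 <= n <oo) (gamma n)%:E <= x%:E)%E; last by rewrite gsum leye_eq.
apply: lime_le.
  by apply: is_cvg_nneseries => n n1 _; rewrite lee_fin ltW// g0.
apply: nearW => -[|n]; rewrite sumEFin lee_fin; last exact: le_x.
by rewrite big_geq// (le_trans _ (le_x 0%N))// /training_time big_geq.
Qed.

Lemma eseries_bounded {R : realType} (u : nat -> R) : (forall n, 0 <= u n) ->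
  (\sum_(1 <= n <oo) (u n)%:E < +oo)%E ->
  exists S, forall n, \sum_(0 <= i < n) u i.+1 <= S.
Proof.
move=> u0 us; exists (fine (\sum_(1 <= n <oo) (u n)%:E)) => n.
rewrite -lee_fin fineK; last first.
  by rewrite ge0_fin_numE// nneseries_ge0// => k _ _; rewrite lee_fin.
rewrite -(big_add1 _ _ 0 n.+1 xpredT u)/= -sumEFin.
by apply: nneseries_lim_ge => k _ _; rewrite lee_fin.
Qed.

Unset Implicit Arguments.

Theorem theorem1p5 (R : realType) (eps alpha beta : R) (gamma : nat -> R)
  (heps : 0 < eps) (halpha : 0 <= alpha < 1) (hbeta : alpha ^+ 2 < beta < 1)
  (gamma_gt0 : forall n, (0 < n)%N -> 0 < gamma n)
  (gamma_nsum : (\sum_(1 <= n <oo) (gamma n)%:E = +oo)%E)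
  (gamma_decr : forall m n, (0 < m)%N -> (m <= n)%N -> gamma n <= gamma m)
  (gamma_cvg : gamma n @[n --> \oo] --> 0)
  (gamma_liminf :
    (0 < ereal_sup
       [set limn_einf (fun n : nat =>
          ((gamma n)^-1 * gamma (n + `|Num.ceil ((gamma n)^-1 * e)|)%N)%:E)
       | e in [set e : R | (0 < e)%R]])%E)
  (p : R) (hp : 2 <= p) (d : nat) (hd : (0 < d)%N) (start : 'rV[R]_d)
  (d0 dU d1 : measure_display)
  (Omega0 : measurableType d0) (P0 : probability Omega0 R)
  (calU : measurableType dU)
  (X : calU -> 'rV[R]_d -> 'rV[R]_d) (U : {RV P0 >-> calU})
  (innovation_XU : is_innovation X) (regular_XU : locally_regular p X U)
  (Omega : measurableType d1) (P : probability Omega R)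
  (theta : nat -> Omega -> 'rV[R]_d)
  (adam_theta : is_adam P X U gamma alpha beta eps start theta)
  (f : 'rV[R]_d -> 'rV[R]_d) (field_f : is_adam_field X U alpha beta eps f)
  (Psi : R -> 'rV[R]_d -> 'rV[R]_d) (semiflow_Psi : is_semiflow f Psi) :
  (forall T r : R, 0 < T -> 0 < r ->
     cvg_in_probability P
       (fun N w => max_deviation gamma theta Psi T r N w) (cst 0%E)) /\
  ((\sum_(1 <= n <oo) (gamma n `^ (1 + p / 3))%:E < +oo)%E ->
   forall T r : R, 0 < T -> 0 < r ->
     {ae P, forall w,
       max_deviation gamma theta Psi T r N w @[N --> \oo] --> 0%E}).
Proof.
have [c [c_cont reg]] := regular_XU.
have [V [iidV [m [v [sigma [init rec]]]]]] := adam_theta.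
have [d2 [Om2 [P2 [W [iidW fE] ] ] ] ] := field_f.
pose mu := distribution P0 U.
pose S : Omega -> path := path_of (V := V).
pose Q := distribution P S.
have iQ : iid_law mu Q by exact: iid_law_path_of.
have expectation_mu (g : calU -> 'rV[R]_d) : (forall j, measurable_fun setT (fun u => g u 0 j)) ->
    (\int[mu]_u (enorm (g u) `^ p)%:E = 'E_P0[fun w => (enorm (g (U w)) `^ p)%R])%E.
  move=> mg; rewrite unlock (ge0_integral_distribution (P := P0) U
    (f := fun u => (enorm (g u) `^ p)%:E))//.
    apply/measurable_EFinP.
    apply: (measurableT_comp (@measurable_powR R p)); exact: measurable_enorm.
  by move=> u; rewrite lee_fin powR_ge0.
have mX1 x j : measurable_fun setT (fun u => X u x 0 j).
  exact: measurable_innovation1.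
have regX x : (\int[mu]_u (enorm (X u x) `^ p)%:E <=
     (c 0 * (1 + expR (c 0 * enorm x)))%:E)%E.
  by rewrite expectation_mu//; have [] := reg x x.
have regXX x y : (\int[mu]_u (enorm (X u x - X u y) `^ p)%:E <=
     (c (enorm x + enorm y) * enorm (x - y) `^ p)%:E)%E.
  rewrite (expectation_mu (fun u => X u x - X u y)); first by have [] := reg x y.
  by move=> j; under eq_fun do rewrite coordB; exact: measurable_funB.
have f_lim y j : mean_dir X eps alpha beta Q n y j @[n --> \oo] --> f y 0 j.
  rewrite fE; apply: (mean_dir_cvg hp innovation_XU regX heps halpha hbeta iQ).
  exact: iid_law_path_of.
have t_infty := training_time_unbounded gamma_gt0 gamma_nsum.
have thetaE : theta = fun n w => Submission.theta X eps alpha beta gamma start n (S w).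
  apply/funext => n; apply/funext => w.
  by rewrite /Submission.theta (adam_state_path_of init rec).
have devE T r N w : max_deviation gamma theta Psi T r N w =
    max_deviation gamma (Submission.theta X eps alpha beta gamma start) Psi T r N (S w).
  by rewrite thetaE.
split=> [T r T0 r0 delta delta0|gsum T r T0 r0].
  have := max_deviation_cvg_probability hp innovation_XU c_cont regX regXX heps
    halpha hbeta iQ start gamma_gt0 gamma_decr f_lim gamma_cvg t_infty
    semiflow_Psi r T0 delta0.
  apply: cvg_trans; apply: near_eq_cvg; apply: nearW => N.
  congr (P _); apply/seteqP; split=> w /=; rewrite devE sube0 gee0_abs//;
    by apply: max_deviation_ge0; exact: ltW.
have [Z [mZ QZ ZP]] := max_deviation_cvg_ae hp innovation_XU c_cont regX regXX heps
    halpha hbeta iQ start gamma_gt0 gamma_decr f_lim gamma_cvg t_infty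
    semiflow_Psi r T0 (eseries_bounded (fun n => powR_ge0 _ _) gsum).
exists (S @^-1` Z); split => //.
  by rewrite -[X in measurable X]setTI; exact: measurable_path_of.
move=> w /= ncvg; apply: contrapT => sZ; apply: ncvg.
have -> : (fun N => max_deviation gamma theta Psi T r N w) = _ := funext (fun N => devE T r N w).
exact: ZP.
Qed.
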